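(* Let $v_1,\dots,v_n\in\mathbb{R}^d$, let $k\ge d$ be an integer budget, and let $p\ge 1$ be an integer. Let $x\in[0,1]^n$ be an optimal solution of the convex program \[ \min_{x\in\mathbb{R}^n}\ \Phi_p\Big(\sum_{i=1}^n x(i)\, v_i v_i^\top\Big)\quad\text{s.t.}\quad \sum_{i=1}^n x(i)\le k,\quad 0\le x(i)\le 1\ (1\le i\le n). \] For any $\varepsilon\in(0,1)$, let $\gamma=\max\{\varepsilon,1/p\}$. If $k\ge C\, d/(\gamma\varepsilon)$ for a sufficiently large absolute constant $C$, then there is a randomized polynomial time algorithm which returns $z\in\{0,1\}^n$ such that \[ \Phi_p\Big(\sum_{i=1}^n z(i)\, v_iv_i^\top\Big)\le (1+\varepsilon)\,\Phi_p\Big(\sum_{i=1}^n x(i)\, v_iv_i^\top\Big)\quad\text{and}\quad \sum_{i=1}^n z(i)\le k, \] with probability at least $1-O\!\left(\frac{(d^2+d/\gamma)^2}{\varepsilon^2p^2}\, e^{-\Omega(\gamma\sqrt d)}\right)-e^{-\Omega(\varepsilon d/\gamma)}$.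
   Context: For a $d\times d$ real symmetric positive definite matrix $A$ with eigenvalues $\lambda_1,\dots,\lambda_d>0$, $\Phi_p(A)=\big(\frac1d\operatorname{tr}(A^{-p})\big)^{1/p}=\big(\frac1d\sum_{i=1}^d\lambda_i^{-p}\big)^{1/p}$. The notations $O(\cdot)$ and $\Omega(\cdot)$ hide absolute constants. *)

(* Defs.v *)
From HB Require Import structures.
From mathcomp Require Import all_boot all_order all_algebra.
From mathcomp Require Import all_classical all_reals all_analysis.

Set Implicit Arguments.
Unset Strict Implicit.
Unset Printing Implicit Defensive.

Import Order.TTheory GRing.Theory Num.Theory.

Local Open Scope ring_scope.

(** * The p-norm design objective *)

Definition posdef (R : realType) (d : nat) (A : 'M[R]_d) : Prop :=
  A^T = A /\ forall u : 'cV[R]_d, u != 0 -> 0 < (u^T *m A *m u) 0 0.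

(* The usual convention is used that the objective is +oo when A is not
   positive definite, so that the convex program below makes sense on its whole
   feasible region. *)
Definition Phi (R : realType) (p d : nat) (A : 'M[R]_d) : \bar R :=
  if `[< posdef A >]
  then ((((d%:R)^-1 * \tr (invmx A ^+ p)) `^ (p%:R)^-1)%:E)
  else +oo%E.

Definition design_mx (R : realType) (n d : nat) (v : 'I_n -> 'cV[R]_d)
    (y : 'I_n -> R) : 'M[R]_d :=
  \sum_(i < n) y i *: (v i *m (v i)^T).

Definition feasible (R : realType) (n k : nat) (y : 'I_n -> R) : Prop :=
  \sum_(i < n) y i <= k%:R /\ forall i, 0 <= y i <= 1.

Definition optimal (R : realType) (n d k p : nat) (v : 'I_n -> 'cV[R]_d)
    (x : 'I_n -> R) : Prop :=
  feasible k x /\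
  forall y, feasible k y -> (Phi p (design_mx v x) <= Phi p (design_mx v y))%E.

(** * Randomized algorithms: a real RAM with biased coins

    A program is a fixed finite text, independent of the sizes and of the
    entries of its input.  It uses

    - natural-number registers, numbered by [nat], for counters and indices;
    - real memory, organised as numbered two-dimensional arrays whose entries
      are addressed by the values of index expressions.

    The only constants are natural numbers.  Real instructions are exact field
    operations (with x / 0 = 0) and comparisons; there is no conversion from
    reals to naturals, and no multiplication of naturals, so that the bit size
    of a natural register grows by at most a constant per step.  Randomness is a
    coin whose bias is a computed real.  Every instruction and every test costs
    one step; the expressions of a fixed program have constant size. *)

Inductive iexpr : Type :=
| ICst of nat
| IVar of nat
| IAdd of iexpr & iexpr
| ISub of iexpr & iexpr
| IHalf of iexpr.

(* [RGet a i j] is the entry (i, j) of array a. *)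
Inductive rexpr : Type :=
| RNat of iexpr
| RGet of nat & iexpr & iexpr
| RAdd of rexpr & rexpr
| RSub of rexpr & rexpr
| RMul of rexpr & rexpr
| RDiv of rexpr & rexpr.

Inductive bexpr : Type :=
| BILe of iexpr & iexpr
| BRLe of rexpr & rexpr
| BNot of bexpr
| BAnd of bexpr & bexpr.

(* [Flip r q] sets the natural register r to 1 with probability q, clamped to
   [0, 1], and to 0 otherwise. *)
Inductive cmd : Type :=
| Skip
| Seq of cmd & cmd
| ISet of nat & iexpr
| RSet of nat & iexpr & iexpr & rexpr
| Flip of nat & rexpr
| If of bexpr & cmd & cmd
| While of bexpr & cmd.

Record state (R : realType) : Type := State {
  ireg : nat -> nat;
  rmem : nat -> nat -> nat -> R
}.

Definition set_ireg (R : realType) (s : state R) (r m : nat) : state R :=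
  State (fun r' => if r' == r then m else ireg s r') (rmem s).

Definition set_rmem (R : realType) (s : state R) (a i j : nat) (x : R) :
    state R :=
  State (ireg s)
    (fun a' i' j' => if [&& a' == a, i' == i & j' == j] then x
                     else rmem s a' i' j').

Fixpoint ieval (R : realType) (s : state R) (e : iexpr) : nat :=
  match e with
  | ICst m => m
  | IVar r => ireg s r
  | IAdd e1 e2 => (ieval s e1 + ieval s e2)%N
  | ISub e1 e2 => (ieval s e1 - ieval s e2)%N
  | IHalf e1 => (ieval s e1)./2
  end.

Fixpoint reval (R : realType) (s : state R) (e : rexpr) : R :=
  match e with
  | RNat e1 => (ieval s e1)%:R
  | RGet a e1 e2 => rmem s a (ieval s e1) (ieval s e2)
  | RAdd e1 e2 => reval s e1 + reval s e2
  | RSub e1 e2 => reval s e1 - reval s e2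
  | RMul e1 e2 => reval s e1 * reval s e2
  | RDiv e1 e2 => reval s e1 / reval s e2
  end.

Fixpoint beval (R : realType) (s : state R) (b : bexpr) : bool :=
  match b with
  | BILe e1 e2 => (ieval s e1 <= ieval s e2)%N
  | BRLe e1 e2 => reval s e1 <= reval s e2
  | BNot b1 => ~~ beval s b1
  | BAnd b1 b2 => beval s b1 && beval s b2
  end.

(* A configuration is a stack of commands still to be executed and a state. *)
Definition config (R : realType) : Type := (seq cmd * state R)%type.

Definition halted (R : realType) (c : config R) : bool := nilp c.1.

(* One step of execution, as a finitely supported distribution. *)
Definition step (R : realType) (c : config R) : seq (R * config R) :=
  let: (K, s) := c in
  match K with
  | [::] => [:: (1, c)]
  | Skip :: K' => [:: (1, (K', s))]
  | Seq c1 c2 :: K' => [:: (1, (c1 :: c2 :: K', s))]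
  | ISet r e :: K' => [:: (1, (K', set_ireg s r (ieval s e)))]
  | RSet a e1 e2 e :: K' =>
      [:: (1, (K', set_rmem s a (ieval s e1) (ieval s e2) (reval s e)))]
  | Flip r e :: K' =>
      let q := Num.max 0 (Num.min 1 (reval s e)) in
      [:: (q, (K', set_ireg s r 1)); (1 - q, (K', set_ireg s r 0))]
  | If b c1 c2 :: K' => [:: (1, ((if beval s b then c1 else c2) :: K', s))]
  | While b c1 :: K' =>
      [:: (1, (if beval s b then c1 :: K else K', s))]
  end.

(* The probability that the configuration reached from c in t steps satisfies
   E; a halted configuration does not change any more. *)
Fixpoint prob (R : realType) (t : nat) (E : config R -> bool) (c : config R) :
    R :=
  if t is t'.+1 then \sum_(b <- step c) b.1 * prob t' E b.2
  else (E c)%:R.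

(** * Rounding algorithms for experimental design *)

Record input (R : realType) (n d : nat) : Type := Input {
  budget : nat;
  norm_exp : nat;
  vecs : 'I_n -> 'cV[R]_d;
  frac_sol : 'I_n -> R;
  accuracy : R
}.

(* Natural registers 0, 1, 2, 3 hold n, d, k, p; array 0 holds the vectors as
   rows, column 0 of array 1 holds x, and entry (0, 0) of array 2 holds
   epsilon.  Everything else is initially zero. *)
Definition init_state (R : realType) (n d : nat) (w : input R n d) : state R :=
  State (nth 0%N [:: n; d; budget w; norm_exp w])
    (fun a i j =>
       match a with
       | 0%N => if insub i is Some i' then
                  if insub j is Some j' then vecs w i' j' 0 else 0
                else 0
       | 1%N => if insub i is Some i' then
                  if j == 0%N then frac_sol w i' else 0
                else 0
       | 2%N => if (i == 0%N) && (j == 0%N) then accuracy w else 0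
       | _ => 0
       end).

Definition init (R : realType) (n d : nat) (A : cmd) (w : input R n d) :
    config R :=
  ([:: A], init_state w).

(* The returned 0/1 vector: z(i) = 1 iff entry (i, 0) of array 3 is nonzero. *)
Definition output (R : realType) (n : nat) (c : config R) (i : 'I_n) : bool :=
  rmem c.2 3 i 0 != 0.

(* Reals have unit size, and the integers k and p are given in binary.  The
   additive 2 makes the powers of [input_size] dominate all polynomials. *)
Definition input_size (R : realType) (n d : nat) (w : input R n d) : nat :=
  (n + d + trunc_log 2 (budget w) + trunc_log 2 (norm_exp w) + 2)%N.

(* On every input, and whatever the outcomes of the coins (of positive
   probability), A halts within (input_size)^e steps. *)
Definition runs_in_time (R : realType) (A : cmd) (e : nat) : Prop :=
  forall (n d : nat) (w : input R n d),
    prob (input_size w ^ e) (@halted R) (init A w) = 1.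

(* The probability that A has halted within t steps with an output satisfying
   E. *)
Definition prob_output (R : realType) (n d : nat) (A : cmd) (t : nat)
    (w : input R n d) (E : ('I_n -> bool) -> bool) : R :=
  prob t (fun c => halted c && E (output c)) (init A w).

(* Main.v *)
Require Import Defs.
From HB Require Import structures.
From mathcomp Require Import all_boot all_order all_algebra.
From mathcomp Require Import all_classical all_reals all_analysis.
From mathcomp Require Import zify ring lra.

(* The rounding is deterministic: a local search over the sets S of k indices,
   where Z is the sum of v_i v_i^T over S and X is the fractional matrix.  The
   exchange Z - v_i v_i^T + v_j v_j^T is the midpoint of Z - 2 v_i v_i^T and
   Z + 2 v_j v_j^T, so convexity bounds the change of a trace objective by
   G_i / (1 - c t_i) - G_j / (1 + c t_j), where t_i = v_i^T Z^-1 v_i and c = O(p).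
   When no exchange gains, averaging over S and over x yields
   <G, X> - <G, Z> <= O(c / k) <G, Z> (tr(X Z^-1) + d).

   First phase: tr(X (Z - l X)^-1) is kept at O(d / e) while the barrier l rises
   from -e to 1 - 2e, as in the Batson-Spielman-Srivastava argument; this needs
   k >= O(d / e^2) and ends with Z >= (1 - 2e) X.  If p eps >= 1, e = eps / 4
   suffices.  Otherwise e = 1 / 4 and a second phase, with k >= O(p d / eps),
   descends on (1/p) ln tr(Z^-p) + (eps / 8d) tr(X Z^-1).  At a stuck point,
   <Z^-(p+1), X> >= s tr(Z^-p) with s = Phi_p(Z) / Phi_p(X), and the second
   summand pays for the term tr(X Z^-1), which gives s <= 1 + eps.  The
   potential bounds the number of exchanges because Phi_p(X) <= Phi_p(Z) by
   optimality of x. *)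

Set Implicit Arguments.
Unset Strict Implicit.
Unset Printing Implicit Defensive.

Import Order.TTheory GRing.Theory Num.Theory.

Local Open Scope ring_scope.

(** * Deterministic structured programs *)

(** Every loop makes n or d rounds, fixed in advance, so the running time is immediate and progress
    must come from potentials: a useful exchange lowers the current potential by a fixed rho, and
    n^2 such exchanges would exhaust it. Once a stuck set or the target level is reached, further
    rounds do no harm.

    The exponent p is given in binary and may exceed every polynomial in the input size. The moments
    v^T N^(p+1) v are still computed by repeated multiplication: they carry weight only when p eps <
    1, and then k >= 3200 p d / eps with k < n forces p < n. If n <= k, all indices are taken.

    The barrier alone cannot settle the case p eps < 1, since accuracy eps would cost d / eps^2,
    more than the available p d / eps. Run with accuracy 1/4 it yields Z >= X / 2, so that the
    descent starts at a bounded distance above its lower bound.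

    No eigenvalues occur. A predicate [gram] carries a factor L with A = L L^T, which makes the
    trace against a positive semidefinite matrix a sum of values of a quadratic form; the convexity
    inequalities reduce to such traces. *)

(* The bool of [PFor] is the number of the register holding the bound: register
   0 (n) or 1 (d), which no program overwrites. *)
Inductive prog : Type :=
| PSkip
| PISet of nat & iexpr
| PRSet of nat & iexpr & iexpr & rexpr
| PSeq of prog & prog
| PIf of bexpr & prog & prog
| PFor of nat & bool & prog.

Fixpoint compile (c : prog) : cmd :=
  match c with
  | PSkip => Skip
  | PISet r e => ISet r e
  | PRSet a e1 e2 e => RSet a e1 e2 e
  | PSeq c1 c2 => Seq (compile c1) (compile c2)
  | PIf b c1 c2 => If b (compile c1) (compile c2)
  | PFor r m c1 =>
      Seq (ISet r (ICst 0))
        (While (BNot (BILe (IVar m) (IVar r)))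
          (Seq (compile c1) (ISet r (IAdd (IVar r) (ICst 1)))))
  end.

Fixpoint iwrites (c : prog) : seq nat :=
  match c with
  | PISet r _ => [:: r]
  | PSkip | PRSet _ _ _ _ => [::]
  | PSeq c1 c2 | PIf _ c1 c2 => iwrites c1 ++ iwrites c2
  | PFor r _ c1 => r :: iwrites c1
  end.

Fixpoint rwrites (c : prog) : seq nat :=
  match c with
  | PSkip | PISet _ _ => [::]
  | PRSet a _ _ _ => [:: a]
  | PSeq c1 c2 | PIf _ c1 c2 => rwrites c1 ++ rwrites c2
  | PFor _ _ c1 => rwrites c1
  end.

Fixpoint loops_ok (c : prog) : bool :=
  match c with
  | PSkip | PISet _ _ | PRSet _ _ _ _ => true
  | PSeq c1 c2 | PIf _ c1 c2 => loops_ok c1 && loops_ok c2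
  | PFor r _ c1 => (r \notin iwrites c1) && loops_ok c1
  end.

(** The bounds in registers 0 and 1 stay fixed and no body writes its own counter, so every loop
    makes exactly as many rounds as its bound says. *)
Definition wf (c : prog) : bool :=
  [&& 0%N \notin iwrites c, 1%N \notin iwrites c & loops_ok c].

Fixpoint cost (L : nat) (c : prog) : nat :=
  match c with
  | PSkip | PISet _ _ | PRSet _ _ _ _ => 1
  | PSeq c1 c2 | PIf _ c1 c2 => (cost L c1 + cost L c2).+1
  | PFor _ _ c1 => (L * (cost L c1).+3 + 3)%N
  end.

Section Semantics.
Variable R : realType.
Implicit Types (s : state R) (c : prog) (K : seq cmd).

Fixpoint den (c : prog) (s : state R) : state R :=
  match c with
  | PSkip => s
  | PISet r e => set_ireg s r (ieval s e)
  | PRSet a e1 e2 e => set_rmem s a (ieval s e1) (ieval s e2) (reval s e)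
  | PSeq c1 c2 => den c2 (den c1 s)
  | PIf b c1 c2 => if beval s b then den c1 s else den c2 s
  | PFor r m c1 =>
      iteri (ireg s m) (fun q s' => set_ireg (den c1 s') r q.+1)
        (set_ireg s r 0)
  end.

Lemma den_ireg c s r : r \notin iwrites c -> ireg (den c s) r = ireg s r.
Proof.
elim: c s => [|r' e|a e1 e2 e|c1 IH1 c2 IH2|b c1 IH1 c2 IH2|r' m c1 IH1] s /=.
- by [].
- by rewrite inE => /negPf ->.
- by [].
- by rewrite mem_cat => /norP[h1 h2]; rewrite IH2 // IH1.
- by rewrite mem_cat => /norP[h1 h2]; case: ifP => _; rewrite ?IH1 ?IH2.
- rewrite inE => /norP[h1 h2].
  elim: (ireg s m) => [|q IHq] /=; first by rewrite (negPf h1).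
  by rewrite (negPf h1) IH1.
Qed.

Lemma den_rmem c s a : a \notin rwrites c -> rmem (den c s) a = rmem s a.
Proof.
elim: c s => [|r' e|a' e1 e2 e|c1 IH1 c2 IH2|b c1 IH1 c2 IH2|r' m c1 IH1] s /=.
- by [].
- by [].
- rewrite inE => /negPf ha; apply/funext => i; apply/funext => j /=.
  by rewrite ha.
- by rewrite mem_cat => /norP[h1 h2]; rewrite IH2 // IH1.
- by rewrite mem_cat => /norP[h1 h2]; case: ifP => _; rewrite ?IH1 ?IH2.
- move=> h; elim: (ireg s m) => [|q IHq] //=.
  by rewrite IH1.
Qed.

(** Quantifying over the remaining time and the event makes the relation compose, with the times
    adding up. *)
Definition reaches (t : nat) (x y : config R) : Prop :=
  forall m E, prob (t + m) E x = prob m E y.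

Lemma reaches_trans t1 t2 x y z :
  reaches t1 x y -> reaches t2 y z -> reaches (t1 + t2) x z.
Proof. by move=> h1 h2 m E; rewrite -addnA h1 h2. Qed.

Lemma reaches_step x y : step x = [:: (1, y)] -> reaches 1 x y.
Proof. by move=> h m E; rewrite add1n /= h big_seq1 /= mul1r. Qed.

Lemma compile_reaches c L s K : wf c -> (ireg s 0 <= L)%N -> (ireg s 1 <= L)%N ->
  exists2 t, (t <= cost L c)%N & reaches t (compile c :: K, s) (K, den c s).
Proof.
move=> + h0 h1.
elim: c s K h0 h1 => [|r e|a e1 e2 e|c1 IH1 c2 IH2|b c1 IH1 c2 IH2|r m c1 IH1]
  s K h0 h1; rewrite /wf /= ?mem_cat ?inE.
- by move=> _; exists 1%N => //; apply: reaches_step.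
- by move=> _; exists 1%N => //; apply: reaches_step.
- by move=> _; exists 1%N => //; apply: reaches_step.
- move=> /and3P[/norP[a1 a2] /norP[b1 b2] /andP[l1 l2]].
  have [|t1 ht1 r1] := IH1 s (compile c2 :: K) h0 h1; first exact/and3P.
  have [|||t2 ht2 r2] := IH2 (den c1 s) K; rewrite ?den_ireg //.
    exact/and3P.
  exists (1 + (t1 + t2))%N; first by lia.
  apply: reaches_trans; first exact: reaches_step.
  exact: reaches_trans r1 r2.
- move=> /and3P[/norP[a1 a2] /norP[b1 b2] /andP[l1 l2]].
  have [|t1 ht1 r1] := IH1 s K h0 h1; first exact/and3P.
  have [|t2 ht2 r2] := IH2 s K h0 h1; first exact/and3P.
  exists (1 + (if beval s b then t1 else t2))%N; first by case: ifP => _; lia.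
  apply: reaches_trans; first exact: reaches_step.
  by case: ifP.
- move=> /and3P[/norP[a1 a2] /norP[b1 b2] /andP[l1 l2]].
  have wfc : wf c1 by exact/and3P.
  set W := While _ _.
  pose F q s' := set_ireg (den c1 s') r q.+1.
  pose st q := iteri q F (set_ireg s r 0).
  have st0 q : ireg (st q) 0 = ireg s 0.
    elim: q => [|q IHq] /=; first by rewrite (negPf a1).
    by rewrite (negPf a1) den_ireg.
  have st1 q : ireg (st q) 1 = ireg s 1.
    elim: q => [|q IHq] /=; first by rewrite (negPf b1).
    by rewrite (negPf b1) den_ireg.
  have stm q : ireg (st q) m = ireg s m by case: m {W}.
  have str q : ireg (st q) r = q by case: q => [|q] /=; rewrite eqxx.
  have hm : (ireg s m <= L)%N by case: m {W stm}.
  have loop q : (q <= ireg s m)%N -> exists2 t, (t <= q * (cost L c1).+3)%N &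
      reaches t (W :: K, st 0%N) (W :: K, st q).
    elim: q => [|q IHq] hq; first by exists 0%N.
    have [t1 ht1 r1] := IHq (ltnW hq).
    have [|||t2 ht2 r2] := IH1 (st q)
      [:: ISet r (IAdd (IVar r) (ICst 1)), W & K]; rewrite ?st0 ?st1 //.
    exists (t1 + (1 + (1 + (t2 + 1))))%N; first by lia.
    apply: (reaches_trans r1).
    apply: reaches_trans; first by apply: reaches_step; rewrite /= stm str -ltnNge hq.
    apply: reaches_trans; first exact: reaches_step.
    apply: (reaches_trans r2); apply: reaches_step => /=.
    by rewrite den_ireg // str addn1.
  have [t1 ht1 r1] := loop _ (leqnn _).
  exists (1 + (1 + (t1 + 1)))%N.
    have : (ireg s m * (cost L c1).+3 <= L * (cost L c1).+3)%N by rewrite leq_mul2r hm orbT.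
    by lia.
  apply: reaches_trans; first exact: reaches_step.
  apply: reaches_trans; first exact: reaches_step.
  apply: (reaches_trans r1); apply: reaches_step => /=.
  by rewrite stm str leqnn.
Qed.

Lemma prob_halted m (E : config R -> bool) s : prob m E ([::], s) = (E ([::], s))%:R.
Proof. by elim: m => //= m IH; rewrite big_seq1 /= mul1r. Qed.

End Semantics.

Lemma cost_poly c : exists e, forall L, (2 <= L)%N -> (cost L c <= L ^ e)%N.
Proof.
elim: c => [|r e|a e1 e2 e|c1 [e1 h1] c2 [e2 h2]|b c1 [e1 h1] c2 [e2 h2]|r m c1 [e1 h1]] /=.
- by exists 0%N.
- by exists 0%N.
- by exists 0%N.
1,2: exists (e1 + e2).+2 => L hL;
  have p1 : (L ^ e1 <= L ^ (e1 + e2))%N by rewrite leq_pexp2l ?leq_addr //; lia.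
1,2: have p2 : (L ^ e2 <= L ^ (e1 + e2))%N by rewrite leq_pexp2l ?leq_addl //; lia.
1,2: have p0 : (0 < L ^ (e1 + e2))%N by rewrite expn_gt0; lia.
1,2: have := h1 _ hL; have := h2 _ hL; rewrite !expnS mulnA => q1 q2.
1,2: have : (4 * L ^ (e1 + e2) <= L * L * L ^ (e1 + e2))%N by rewrite leq_mul2r (@leq_mul 2 2) ?orbT.
1,2: by lia.
exists (e1 + 4)%N => L hL.
have p0 : (0 < L ^ e1)%N by rewrite expn_gt0; lia.
have := h1 _ hL; rewrite expnD.
have : (8 <= L ^ 3)%N by rewrite (@leq_exp2r 2 L 3).
rewrite (expnS L 3) => h8 hc.
suff : (L * (cost L c1).+3 + 3 <= L * (8 * L ^ e1))%N.
  by move/leq_trans; apply; rewrite (mulnC (L ^ e1)%N) -mulnA leq_mul2l leq_mul2r h8 !orbT.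
by nia.
Qed.

(** A halted configuration stays put, so the time left over below the polynomial bound does not
    change any probability. *)
Lemma run_prog (R : realType) c : wf c ->
  exists e, forall (n d : nat) (w : input R n d) (E : config R -> bool),
    prob (input_size w ^ e) E (init (compile c) w)
    = (E ([::], den c (init_state w)))%:R.
Proof.
move=> wfc; have [e he] := cost_poly c; exists e => n d w E.
have hL : (n + d + 2 <= input_size w)%N by rewrite /input_size; lia.
have [||t ht] := @compile_reaches R c (input_size w) (init_state w) [::] wfc.
- by rewrite /=; lia.
- by rewrite /=; lia.
have ht' : (t <= input_size w ^ e)%N by apply: leq_trans ht (he _ _); lia.
move=> /(_ (input_size w ^ e - t)%N E); rewrite subnKC // => ->.
exact: prob_halted.
Qed.

(** * Positive definite matrices *)

Section Forms.
Variables (R : realType) (d : nat).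
Implicit Types (A B C M N P Q X Y Z : 'M[R]_d) (u v w : 'cV[R]_d) (c : R).

Definition bform A u w : R := (u^T *m A *m w) 0 0.

Definition psd A : Prop := A^T = A /\ forall u, 0 <= bform A u u.

Lemma bformDl A B u w : bform (A + B) u w = bform A u w + bform B u w.
Proof. by rewrite /bform mulmxDr mulmxDl mxE. Qed.

Lemma bformNl A u w : bform (- A) u w = - bform A u w.
Proof. by rewrite /bform mulmxN mulNmx mxE. Qed.

Lemma bformBl A B u w : bform (A - B) u w = bform A u w - bform B u w.
Proof. by rewrite bformDl bformNl. Qed.

Lemma bformZl c A u w : bform (c *: A) u w = c * bform A u w.
Proof. by rewrite /bform -scalemxAr -scalemxAl mxE. Qed.

Lemma bform_suml I (r : seq I) (F : I -> 'M[R]_d) u w :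
  bform (\sum_(i <- r) F i) u w = \sum_(i <- r) bform (F i) u w.
Proof.
apply: (big_morph (fun A => bform A u w)) => [A B|]; first exact: bformDl.
by rewrite /bform mulmx0 mul0mx mxE.
Qed.

Lemma bformBr A u v w : bform A u (v - w) = bform A u v - bform A u w.
Proof. by rewrite /bform mulmxBr !mxE. Qed.

Lemma bformZr A c u w : bform A u (c *: w) = c * bform A u w.
Proof. by rewrite /bform -scalemxAr mxE. Qed.

Lemma bformC A u w : bform A u w = bform A^T w u.
Proof.
have tr11 (X : 'M[R]_1) : X 0 0 = X^T 0 0 by rewrite mxE.
by rewrite /bform tr11 !trmx_mul trmxK mulmxA.
Qed.

Lemma bformBL A u v w : bform A (u - v) w = bform A u w - bform A v w.
Proof. by rewrite bformC bformBr -!(bformC A). Qed.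

Lemma bformZL A c u w : bform A (c *: u) w = c * bform A u w.
Proof. by rewrite bformC bformZr -(bformC A). Qed.

Lemma bformMr A B u w : bform (A * B) u w = bform A u (B *m w).
Proof. by rewrite /bform -mulmxE !mulmxA. Qed.

Lemma bformMl A B u w : bform (A * B) u w = bform B (A^T *m u) w.
Proof. by rewrite /bform -mulmxE trmx_mul trmxK !mulmxA. Qed.

Lemma bform_rank1 v u w : bform (v *m v^T) u w = bform 1 u v * bform 1 v w.
Proof.
rewrite /bform !mulmx1 !mulmxA -mulmxA mxE big_ord1.
by [].
Qed.

Lemma tr_rank1 A u w : \tr (A *m (u *m w^T)) = bform A w u.
Proof. by rewrite mulmxA mxtrace_mulC mulmxA /mxtrace big_ord1. Qed.

Lemma psd0 : psd 0.
Proof.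
by split=> [|u]; rewrite ?trmx0 // /bform mulmx0 mul0mx mxE.
Qed.

Lemma psdD A B : psd A -> psd B -> psd (A + B).
Proof.
move=> [sA pA] [sB pB]; split; first by rewrite linearD /= sA sB.
by move=> u; rewrite bformDl addr_ge0.
Qed.

Lemma psdZ c A : 0 <= c -> psd A -> psd (c *: A).
Proof.
move=> c0 [sA pA]; split; first by rewrite linearZ /= sA.
by move=> u; rewrite bformZl mulr_ge0.
Qed.

Lemma posdef_psd A : posdef A -> psd A.
Proof.
move=> [sA pA]; split=> // u; have [->|/pA/ltW//] := eqVneq u 0.
by rewrite /bform mulmx0 mxE.
Qed.

Lemma posdefD A B : posdef A -> psd B -> posdef (A + B).
Proof.
move=> [sA pA] [sB pB]; split; first by rewrite linearD /= sA sB.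
by move=> u u0; rewrite -/(bform _ u u) bformDl ltr_wpDr ?pB //; exact: pA.
Qed.

Lemma posdefZ c A : 0 < c -> posdef A -> posdef (c *: A).
Proof.
move=> c0 [sA pA]; split; first by rewrite linearZ /= sA.
by move=> u u0; rewrite -/(bform _ u u) bformZl mulr_gt0 //; exact: pA.
Qed.

Lemma posdef_ge A B : posdef A -> B^T = B -> (forall u, bform A u u <= bform B u u) ->
  posdef B.
Proof.
move=> [sA pA] sB h; split=> // u u0; apply: lt_le_trans (h u); exact: pA.
Qed.

Lemma posdef1 : posdef (1 : 'M[R]_d).
Proof.
split=> [|u u0]; first by rewrite trmx1.
rewrite mulmx1 mxE lt_neqAle; apply/andP; split; last first.
  by apply: sumr_ge0 => i _; rewrite mxE -expr2 sqr_ge0.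
rewrite eq_sym; apply: contra u0 => /eqP h; apply/eqP/matrixP => i j.
rewrite !ord1 mxE; apply/eqP; rewrite -sqrf_eq0 expr2.
have := @psumr_eq0P R _ xpredT (fun i => u^T 0 i * u i 0).
move=> /(_ _ h i isT); rewrite mxE => ->// k _.
by rewrite mxE -expr2 sqr_ge0.
Qed.

Lemma posdef_unit A : posdef A -> A \in unitmx.
Proof.
move=> [sA pA]; rewrite unitmxE unitfE; apply/negP => /det0P [v v0 vA].
have /pA : v^T != 0 by rewrite -trmx0 (inj_eq trmx_inj).
by rewrite trmxK vA mul0mx mxE ltxx.
Qed.

Lemma posdef_mulmxV A : posdef A -> A *m invmx A = 1.
Proof. by move=> /posdef_unit/mulmxV. Qed.

Lemma posdef_mulVmx A : posdef A -> invmx A *m A = 1.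
Proof. by move=> /posdef_unit/mulVmx. Qed.

Lemma invmx_eq A N : posdef A -> N *m A = 1 -> N = invmx A.
Proof.
move=> pA h; rewrite -[N]mulmx1 -[1%:M]/(1 : 'M[R]_d) -(posdef_mulmxV pA) mulmxA h.
by rewrite mul1mx.
Qed.

Lemma invmx_sym A : A^T = A -> (invmx A)^T = invmx A.
Proof. by move=> h; rewrite trmx_inv h. Qed.

Lemma bform_inv_sub A v w : posdef A ->
  bform A (w - invmx A *m v) (w - invmx A *m v)
  = bform A w w - bform 1 w v *+ 2 + bform (invmx A) v v.
Proof.
move=> pA; have [sA _] := pA; have sN := invmx_sym sA.
have e1 u : bform A u (invmx A *m v) = bform 1 u v.
  by rewrite -bformMr -mulmxE posdef_mulmxV.
have e2 : bform A (invmx A *m v) w = bform 1 w v by rewrite bformC sA e1.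
have e3 : bform 1 (invmx A *m v) v = bform (invmx A) v v.
  by rewrite -{1}sN -bformMl mulr1.
rewrite bformBr !bformBL !e1 e2 e3.
by ring.
Qed.

Lemma posdef_inv A : posdef A -> posdef (invmx A).
Proof.
move=> pA; have [sA hA] := pA; have sN := invmx_sym sA; split=> // v v0.
have /hA : invmx A *m v != 0.
  apply: contra v0 => /eqP h.
  by rewrite -[v]mul1mx -[1%:M]/(1 : 'M[R]_d) -(posdef_mulmxV pA) -mulmxA h mulmx0.
rewrite -/(bform _ _ _) -bformMr -mulmxE (posdef_mulmxV pA).
by rewrite -{1}sN -bformMl mulr1.
Qed.

(** Cauchy-Schwarz between the forms of A and A^-1: expand the nonnegative form of A at n w - b A^-1
    v, where n = v^T A^-1 v and b = w^T v. *)
Lemma dual_CS A v w : posdef A ->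
  (bform 1 w v) ^+ 2 <= bform A w w * bform (invmx A) v v.
Proof.
move=> pA; have [sA hA] := pA; have [_ hN] := posdef_inv pA.
have [->|v0] := eqVneq v 0.
  by rewrite /bform !mulmx0 mxE expr0n mulr0.
have n0 : 0 < bform (invmx A) v v by exact: hN.
have := (posdef_psd pA).2 ((bform (invmx A) v v) *: w - invmx A *m (bform 1 w v *: v)).
rewrite bform_inv_sub // !bformZL !bformZr.
set a := bform A w w; set b := bform 1 w v; set n := bform (invmx A) v v in n0 *.
have -> : n * (n * a) - (n * (b * b)) *+ 2 + b * (b * n) = n * (n * a - b ^+ 2) by ring.
by rewrite pmulr_rge0 // subr_ge0 mulrC.
Qed.

(** [dual_CS] at w = B^-1 v, where both w^T v and w^T B w equal v^T B^-1 v; one such factor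
    cancels. *)
Lemma inv_antitone c A B v : 0 < c -> posdef A -> posdef B ->
  (forall u, bform A u u <= c * bform B u u) ->
  bform (invmx B) v v <= c * bform (invmx A) v v.
Proof.
move=> c0 pA pB h; set w := invmx B *m v.
have [sB hB] := pB; have sN := invmx_sym sB.
have e1 : bform 1 w v = bform (invmx B) v v.
  by rewrite /w -{1}sN -bformMl mulr1.
have e2 : bform B w w = bform (invmx B) v v.
  by rewrite /w -bformMr -mulmxE (posdef_mulmxV pB) e1.
have := dual_CS v w pA; rewrite e1.
have := h w; rewrite e2 => h1 h2.
have [_ q0] := posdef_psd (posdef_inv pB).
have [_ q1] := posdef_psd (posdef_inv pA).
have := q0 v; rewrite le_eqVlt => /orP[/eqP <-|q].
  by rewrite mulr_ge0 // ltW.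
rewrite -(ler_pM2l q) -expr2; apply: (le_trans h2).
by apply: (le_trans (ler_wpM2r (q1 v) h1)); rewrite [leRHS]mulrCA mulrA.
Qed.

(** * Sums of rank-one matrices *)

(** An explicit factor plays the part of a square root: tr(L L^T P) is the sum of the values of the
    form P at the columns of L. *)
Definition gram A : Prop := exists m (L : 'M[R]_(d, m)), A = L *m L^T.

Lemma gram_sym A : gram A -> A^T = A.
Proof. by move=> [m [L ->]]; rewrite trmx_mul trmxK. Qed.

Lemma gram_tr_mul A P : gram A -> psd P -> 0 <= \tr (A * P).
Proof.
move=> [m [L ->]] [_ hP]; rewrite -mulmxE -mulmxA mxtrace_mulC -mulmxA.
apply: sumr_ge0 => i _.
have := hP (col i L); rewrite /bform tr_col -row_mul.
rewrite mulmxA; move: (L^T *m P) => Q; rewrite !mxE.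
by under eq_bigr do rewrite !mxE.
Qed.

Lemma gram_conj A C : gram A -> gram (C * A * C^T).
Proof.
by move=> [m [L ->]]; exists m, (C *m L); rewrite trmx_mul -!mulmxE !mulmxA.
Qed.

Lemma psd_conj P C : psd P -> psd (C * P * C^T).
Proof.
move=> [sP hP]; split; first by rewrite -!mulmxE !trmx_mul trmxK sP mulmxA.
by move=> u; rewrite bformMr bformMl.
Qed.

End Forms.

(** * Powers and the second differences of their traces *)

Section Powers.
Variables (R : realType) (d : nat).
Implicit Types (A B C M N P Q X Y Z : 'M[R]_d) (u v w : 'cV[R]_d) (c : R).

Lemma tr_mulC A B : \tr (A * B) = \tr (B * A).
Proof. exact: mxtrace_mulC. Qed.

Lemma trmx_mulE A B : (A * B)^T = B^T * A^T.
Proof. by rewrite -!mulmxE trmx_mul. Qed.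

Lemma trmx_expr A n : A^T = A -> (A ^+ n)^T = A ^+ n.
Proof.
move=> sA; elim: n => [|n IH]; first by rewrite !expr0 trmx1.
by rewrite exprS trmx_mulE IH sA -exprSr exprS.
Qed.

(** A^n is the congruence of 1 or A by the symmetric matrix A^(n/2), so a property stable under
    congruence passes to all powers. *)
Lemma expr_closed (S : 'M[R]_d -> Prop) A n :
  (forall B C, S B -> S (C * B * C^T)) -> A^T = A -> S 1 -> S A -> S (A ^+ n).
Proof.
move=> hC sA h1 hA.
have -> : n = (n./2 + odd n + n./2)%N.
  by rewrite addnAC addnn addnC odd_double_half.
rewrite !exprD; have := hC (A ^+ odd n) (A ^+ n./2); rewrite trmx_expr //; apply.
by case: (odd n).
Qed.

Lemma gram1 : gram (1 : 'M[R]_d).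
Proof. by exists d, 1; rewrite trmx1 mulmx1. Qed.

Lemma gram_expr A n : gram A -> gram (A ^+ n).
Proof.
move=> gA; apply: expr_closed => //; [|exact: gram_sym|exact: gram1].
by move=> B C; exact: gram_conj.
Qed.

Lemma psd_expr A n : psd A -> psd (A ^+ n).
Proof.
move=> gA; apply: expr_closed => //; [|by case: gA|exact/posdef_psd/posdef1].
by move=> B C; exact: psd_conj.
Qed.

(** Summation by parts, twice. For T m = tr(A^m B^(n-m)) the right side is the gap in the tangent
    inequality. *)
Lemma second_difference_sum (T : nat -> R) n :
  \sum_(m < n) (m.+1)%:R * (T m - T m.+1 *+ 2 + T m.+2)
  = T 0%N - n.+1%:R * T n + n%:R * T n.+1.
Proof.
elim: n => [|n IH]; first by rewrite big_ord0; ring.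
by rewrite big_ord_recr /= IH; ring.
Qed.

(* The sequence tr(A^m B^(p-m)) is convex in m, because each second difference
   is tr((B-A) A^m (B-A) B^l), a trace of a product of two positive
   semidefinite matrices; this is the tangent inequality at A^-1 for the convex
   function tr(Y^-p). *)
Lemma tr_expr_tangent A B Y p : B^T = B -> B * Y = 1 -> Y * B = 1 ->
  (psd A /\ gram Y) \/ (gram A /\ psd Y) ->
  0 <= \tr (B ^+ p) - p.+1%:R * \tr (A ^+ p) + p%:R * \tr (A ^+ p.+1 * Y).
Proof.
move=> sB BY YB hyp.
have sA : A^T = A by case: hyp => -[]; [case|move/gram_sym].
(* Writing B^(p-m) as B^(p+1-m) Y gives a meaning to m = p+1, where the exponent of B is -1. *)
pose T m := \tr (A ^+ m * (B ^+ (p.+1 - m) * Y)).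
have BYq q : B ^+ q.+1 * Y = B ^+ q by rewrite exprSr -mulrA BY mulr1.
have BYqB q : B ^+ q * Y * B = B ^+ q by rewrite -mulrA YB mulr1.
have EB : B = B * Y * B^T by rewrite sB BY mul1r.
have pos m q : 0 <= \tr ((B - A) * A ^+ m * (B - A)^T * (B ^+ q * Y)).
  case: hyp => -[hA hY].
    rewrite tr_mulC; apply: gram_tr_mul; last exact/psd_conj/psd_expr.
    case: q => [|q]; first by rewrite expr0 mul1r.
    by rewrite BYq; apply: gram_expr; rewrite EB; exact: gram_conj.
  apply: gram_tr_mul; first exact/gram_conj/gram_expr.
  case: q => [|q]; first by rewrite expr0 mul1r.
  by rewrite BYq; apply: psd_expr; rewrite EB; exact: psd_conj.
have -> : \tr (B ^+ p) = T 0%N by rewrite /T subn0 BYq expr0 mul1r.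
have -> : \tr (A ^+ p) = T p by rewrite /T subSnn expr1 BY mulr1.
have -> : \tr (A ^+ p.+1 * Y) = T p.+1 by rewrite /T subnn expr0 mul1r.
rewrite -second_difference_sum; apply: sumr_ge0 => -[m hm] _ /=.
apply: mulr_ge0 => //; have := pos m (p - m.+1)%N.
set q := (p - m.+1)%N.
have -> : T m = \tr (A ^+ m * B ^+ q.+1).
  by rewrite /T -(BYq q.+1); congr (\tr (_ * (_ ^+ _ * _))); rewrite /q; lia.
have -> : T m.+1 = \tr (A ^+ m.+1 * B ^+ q).
  by rewrite /T -(BYq q); congr (\tr (_ * (_ ^+ _ * _))); rewrite /q; lia.
have -> : T m.+2 = \tr (A ^+ m.+2 * (B ^+ q * Y)).
  by rewrite /T; congr (\tr (_ * (_ ^+ _ * _))); rewrite /q; lia.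
rewrite linearB /= sA sB.
rewrite !mulrBr !mulrBl !raddfB /= -!addrA; congr (0 <= _).
have -> : \tr (B * A ^+ m * B * (B ^+ q * Y)) = \tr (A ^+ m * B ^+ q.+1).
  by rewrite -!mulrA tr_mulC -!mulrA YB mulr1 -exprS.
have -> : \tr (A * A ^+ m * B * (B ^+ q * Y)) = \tr (A ^+ m.+1 * B ^+ q).
  by rewrite -exprS -mulrA [B * _]mulrA -exprS BYq.
have -> : \tr (B * A ^+ m * A * (B ^+ q * Y)) = \tr (A ^+ m.+1 * B ^+ q).
  by rewrite -!mulrA tr_mulC -!mulrA YB mulr1 mulrA -exprSr.
have -> : \tr (A * A ^+ m * A * (B ^+ q * Y)) = \tr (A ^+ m.+2 * (B ^+ q * Y)).
  by rewrite -exprS -exprSr.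
ring.
Qed.

End Powers.

(** * Convexity and monotonicity of tr(Y^-p) *)

Section Tangent.
Variables (R : realType) (d : nat).
Implicit Types (A B C M N P Q X Y Z : 'M[R]_d) (u v w : 'cV[R]_d) (c : R).

Lemma gramD A B : gram A -> gram B -> gram (A + B).
Proof.
move=> [m [L ->]] [n [K ->]]; exists (m + n)%N, (row_mx L K).
by rewrite tr_row_mx mul_row_col.
Qed.

Lemma gramZ c A : 0 <= c -> gram A -> gram (c *: A).
Proof.
move=> c0 [m [L ->]]; exists m, (Num.sqrt c *: L).
by rewrite linearZ /= -scalemxAl -scalemxAr scalerA -expr2 sqr_sqrtr.
Qed.

Lemma gram0 : gram (0 : 'M[R]_d).
Proof. by exists 0%N, 0; rewrite mul0mx. Qed.

Lemma gram_rank1 v : gram (v *m v^T).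
Proof. by exists 1%N, v. Qed.

Lemma gram_psd A : gram A -> psd A.
Proof.
move=> gA; split=> [|u]; first exact: gram_sym.
rewrite -tr_rank1; apply: gram_tr_mul => //; split; first exact/gram_sym/gram_rank1.
move=> w; rewrite bform_rank1 (bformC _ u w) trmx1 -expr2; exact: sqr_ge0.
Qed.

Lemma gram_inv A : posdef A -> gram A -> gram (invmx A).
Proof.
move=> pA gA; have -> : invmx A = invmx A * A * (invmx A)^T.
  by rewrite invmx_sym ?gram_sym // -!mulmxE posdef_mulVmx // mul1mx.
exact: gram_conj.
Qed.

(** A factor of either matrix suffices. [tr_inv_sub] takes the tangent at Z - 2 v v^T, which has no
    evident factor, and relies on the one of Z. *)
Lemma tr_inv_tangent Z Y p : posdef Z -> posdef Y -> gram Z \/ gram Y ->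
  \tr (invmx Z ^+ p) - p%:R * \tr (invmx Z ^+ p.+1 * (Y - Z)) <= \tr (invmx Y ^+ p).
Proof.
move=> pZ pY g; have := @tr_expr_tangent R d (invmx Z) (invmx Y) Y p.
move=> /(_ (invmx_sym pY.1) (posdef_mulVmx pY) (posdef_mulmxV pY)) h.
have {}h := h (match g with
   | or_introl gZ => or_intror (conj (gram_inv pZ gZ) (posdef_psd pY))
   | or_intror gY => or_introl (conj (posdef_psd (posdef_inv pZ)) gY) end).
rewrite mulrBr raddfB /=.
have -> : \tr (invmx Z ^+ p.+1 * Z) = \tr (invmx Z ^+ p).
  by rewrite exprSr -mulrA -[invmx Z * Z]/(invmx Z *m Z) posdef_mulVmx // mulr1.
by rewrite -natr1 in h; lra.
Qed.

Lemma tr_inv_antitone Z Y p : posdef Z -> posdef Y -> gram Z -> psd (Z - Y) ->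
  \tr (invmx Z ^+ p) <= \tr (invmx Y ^+ p).
Proof.
move=> pZ pY gZ h; apply: le_trans (tr_inv_tangent p pZ pY (or_introl gZ)).
have := gram_tr_mul (gram_expr p.+1 (gram_inv pZ gZ)) h.
rewrite -opprB mulrN raddfN /= => h1.
by have := mulr_ge0 (ler0n R p) h1; lra.
Qed.

End Tangent.

(** The ratios m(i+1) / m(i) are nondecreasing, so moving two indices apart by one never decreases
    the product; this is repeated until the smaller index is 0. *)
Lemma logconvex_mul (R : realFieldType) (m : nat -> R) (a b : nat) :
  (forall i, 0 < m i) -> (forall i, m i.+1 ^+ 2 <= m i * m i.+2) ->
  m a * m b <= m 0%N * m (a + b)%N.
Proof.
move=> m0 lc.
have ratio i n : m i.+1 * m (i + n)%N <= m i * m (i + n).+1.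
  elim: n => [|n IH]; first by rewrite addn0 mulrC.
  rewrite addnS -(ler_pM2r (m0 (i + n)%N)).
  rewrite mulrAC; apply: le_trans (ler_wpM2r (ltW (m0 _)) IH) _.
  have := ler_wpM2l (ltW (m0 i)) (lc (i + n)%N); nra.
have half : forall i j, (i <= j)%N -> m i * m j <= m 0%N * m (i + j)%N.
  elim=> [|i IH] j hij; first by rewrite add0n.
  apply: le_trans (_ : m i * m j.+1 <= _); last first.
    by rewrite addSnnS; apply: IH; lia.
  by have := ratio i (j - i)%N; rewrite subnKC //; lia.
case: (leqP a b) => [/half//|/ltnW/half]; by rewrite mulrC addnC.
Qed.

(** * Moments of a vector and their change under rank-one updates *)

Section Moments.
Variables (R : realType) (d : nat).
Implicit Types (A B C M N P Q X Y Z : 'M[R]_d) (u v w : 'cV[R]_d) (c : R).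

Lemma posdef_expr A n : posdef A -> posdef (A ^+ n).
Proof.
move=> pA; elim/ltn_ind: n => -[|[|n]] IH; rewrite ?expr0 ?expr1 //; first exact: posdef1.
have -> : A ^+ n.+2 = A * A ^+ n * A^T by rewrite pA.1 -exprS -exprSr.
split=> [|u u0]; first by rewrite (psd_conj A (posdef_psd (IH n _))).1.
rewrite -/(bform _ u u) bformMr bformMl; apply: (IH n _).2 => //.
apply: contra u0 => /eqP h; rewrite -[u]mul1mx -[1%:M]/(1 : 'M[R]_d).
by rewrite -(posdef_mulVmx pA) -mulmxA -{2}pA.1 h mulmx0.
Qed.

(** The exponent is shifted so that, for A = Z^-1, moment 0 is the leverage of v and -p times moment
    p is the derivative of tr(Z^-p) along v v^T. *)
Definition mom A v (m : nat) : R := bform (A ^+ m.+1) v v.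

Lemma mom_ge0 A v m : posdef A -> 0 <= mom A v m.
Proof. by move=> pA; have [_] := posdef_psd (posdef_expr m.+1 pA); exact. Qed.

(** Consecutive moments are log-convex by Cauchy-Schwarz for the form A^(i+1) at v and A v. *)
Lemma mom_logconvex A v a b : posdef A ->
  mom A v a * mom A v b <= mom A v 0 * mom A v (a + b).
Proof.
move=> pA; have [->|v0] := eqVneq v 0.
  by rewrite /mom /bform !mulmx0 !mxE !mul0r.
apply: logconvex_mul => i; first exact: (posdef_expr i.+1 pA).2.
have := (posdef_psd (posdef_expr i.+1 pA)).2
  (mom A v i *: (A *m v) - mom A v i.+1 *: v).
have e1 u : bform (A ^+ i.+1) (A *m v) u = bform (A ^+ i.+2) v u.
  by rewrite (exprS _ i.+1) bformMl pA.1.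
have e2 : bform (A ^+ i.+2) v (A *m v) = mom A v i.+2.
  by rewrite /mom -bformMr -exprSr.
rewrite bformBr !bformBL !bformZL !bformZr !e1 e2 (bformC _ v (A *m v)).
rewrite trmx_expr ?pA.1 // e1 -!/(mom A v _).
have : 0 < mom A v i by exact: (posdef_expr i.+1 pA).2.
move: (mom A v i) (mom A v i.+1) (mom A v i.+2) => x y z x0 h.
by rewrite -subr_ge0 -(pmulr_rge0 _ x0); move: h; congr (0 <= _); ring.
Qed.

Lemma posdef_add_rank1 A c v : posdef A -> 0 <= c -> posdef (A + c *: (v *m v^T)).
Proof. by move=> pA c0; apply/(posdefD pA)/psdZ/gram_psd/gram_rank1. Qed.

Lemma posdef_sub_rank1 A c v : posdef A -> 0 <= c -> c * bform (invmx A) v v < 1 ->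
  posdef (A - c *: (v *m v^T)).
Proof.
move=> pA c0 h; split.
  by rewrite linearB linearZ /= pA.1 (gram_sym (gram_rank1 v)).
move=> u u0; rewrite -/(bform _ u u) bformBl bformZl bform_rank1.
rewrite (bformC _ v u) trmx1 -expr2.
have := dual_CS v u pA; have := pA.2 u u0; rewrite -/(bform A u u) => h1 h2.
have h3 := ler_wpM2l c0 h2; have h4 : c * bform (invmx A) v v * bform A u u < 1 * bform A u u.
  by rewrite ltr_pM2r.
by nra.
Qed.

Lemma bform_mid P Q v u w : bform (P * (v *m v^T) * Q) u w = bform P u v * bform Q v w.
Proof. by rewrite bformMr bformMl bform_rank1 -bformMl -bformMr mulr1 mul1r. Qed.

(** With N = A^-1 and B = Y^-1, telescope N^(p+1) - B^(p+1) into terms N^a (N - B) B^(p-a) and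
    insert the resolvent identity N - B = c N v v^T B. *)
Lemma mom_rank1 A Y c v p : posdef A -> posdef Y -> Y = A + c *: (v *m v^T) ->
  mom (invmx A) v p - mom (invmx Y) v p
  = c * \sum_(a < p.+1) mom (invmx A) v a * mom (invmx Y) v (p - a).
Proof.
move=> pA pY EY; set N := invmx A; set B := invmx Y.
have res : N - B = c *: (N * (v *m v^T) * B).
  have -> : N - B = N * (Y - A) * B.
    rewrite mulrBr mulrBl -[N * A]/(N *m A) posdef_mulVmx // mul1r.
    by rewrite -mulrA -[Y * B]/(Y *m B) posdef_mulmxV // mulr1.
  by rewrite EY [_ + _ - _]addrAC subrr add0r -!mulmxE -scalemxAr -scalemxAl.
pose U a := bform (N ^+ a * B ^+ (p.+1 - a)) v v.
have -> : mom N v p = U p.+1 by rewrite /U subnn expr0 mulr1.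
have -> : mom B v p = U 0%N by rewrite /U subn0 expr0 mul1r.
rewrite -(telescope_sumr U (leq0n p.+1)) big_mkord mulr_sumr.
apply: eq_bigr => -[a ha] _ /=; rewrite /U /mom.
have -> : (p.+1 - a = (p - a).+1)%N by lia.
rewrite subSS -bformBl exprSr (exprS B) [N ^+ a * (B * _)]mulrA -mulrBl -mulrBr res.
rewrite -!mulmxE -scalemxAr -scalemxAl bformZl !mulmxE; congr (_ * _).
by rewrite -bform_mid !mulrA.
Qed.

Lemma mom_add_le A Y c v p : posdef A -> posdef Y -> Y = A + c *: (v *m v^T) ->
  0 <= c -> mom (invmx Y) v p <= mom (invmx A) v p.
Proof.
move=> pA pY EY c0; rewrite -subr_ge0 (mom_rank1 p pA pY EY) mulr_ge0 //.
by apply: sumr_ge0 => i _; rewrite mulr_ge0 // mom_ge0 //; exact: posdef_inv.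
Qed.

(** In the sum of [mom_rank1] the moments of Y^-1 are at most those of A^-1, and log-convexity
    bounds each of the p+1 products by the extreme one. *)
Lemma mom_add_ge A Y c v p : posdef A -> posdef Y -> Y = A + c *: (v *m v^T) ->
  0 <= c ->
  mom (invmx A) v p * (1 - p.+1%:R * c * mom (invmx A) v 0) <= mom (invmx Y) v p.
Proof.
move=> pA pY EY c0; have := mom_rank1 p pA pY EY.
set S := \sum_(_ < _) _ => hS.
have : S <= p.+1%:R * (mom (invmx A) v 0 * mom (invmx A) v p).
  apply: (@le_trans _ _ (\sum_(i < p.+1) (mom (invmx A) v 0 * mom (invmx A) v p))).
    apply: ler_sum => -[i hi] _ /=.
    have := mom_logconvex v i (p - i) (posdef_inv pA).
    rewrite subnKC //; apply: le_trans.
    apply: ler_wpM2l; first exact/mom_ge0/posdef_inv.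
    exact: mom_add_le EY c0.
  by rewrite sumr_const card_ord -[in leLHS]mulr_natl.
by move=> /(ler_wpM2l c0); rewrite -hS; lra.
Qed.

End Moments.

(** * Effect of an exchange on the trace objectives *)

Section Exchanges.
Variables (R : realType) (d : nat).
Implicit Types (A B C M N P Q X Y Z : 'M[R]_d) (u v w : 'cV[R]_d) (c : R).

Lemma tr_mul_rank1 A c v : \tr (A * (c *: (v *m v^T))) = c * bform A v v.
Proof. by rewrite -mulmxE -scalemxAr linearZ /= tr_rank1. Qed.

Lemma mom0 A v : mom A v 0 = bform A v v.
Proof. by rewrite /mom expr1. Qed.

(* Integrating the derivative bound over the whole step loses a factor
   (1 + c tau)^(p+1); moving only by c' = c / (1 + 2 (p+1) c tau) and using
   monotonicity for the rest loses 1 + O(p c tau). *)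
Lemma tr_inv_add Z c v p : posdef Z -> gram Z -> 0 <= c ->
  \tr (invmx (Z + c *: (v *m v^T)) ^+ p) <= \tr (invmx Z ^+ p)
    - p%:R * c * mom (invmx Z) v p / (1 + 4 * p.+1%:R * c * mom (invmx Z) v 0).
Proof.
move=> pZ gZ c0; set t := mom (invmx Z) v 0; set m := mom (invmx Z) v p.
have t0 : 0 <= t by exact/mom_ge0/posdef_inv.
have m0 : 0 <= m by exact/mom_ge0/posdef_inv.
set s : R := p.+1%:R * c * t.
have s0 : 0 <= s by rewrite !mulr_ge0.
have s1 : 0 < 1 + 2 * s by lra.
have s2 : 0 < 1 + 4 * s by lra.
set c' := c / (1 + 2 * s).
have c'0 : 0 <= c' by rewrite divr_ge0 // ltW.
have c'c : c' <= c by rewrite ler_pdivrMr //; nra.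
set Y := Z + c' *: (v *m v^T); set W := Z + c *: (v *m v^T).
have pY : posdef Y by exact: posdef_add_rank1.
have pW : posdef W by exact: posdef_add_rank1.
have gY : gram Y by apply/(gramD gZ)/gramZ/gram_rank1.
have gW : gram W by apply/(gramD gZ)/gramZ/gram_rank1.
have h1 : \tr (invmx W ^+ p) <= \tr (invmx Y ^+ p).
  apply: tr_inv_antitone => //; rewrite /W /Y opprD addrACA subrr add0r -scalerBl.
  by apply/psdZ/gram_psd/gram_rank1; rewrite subr_ge0.
have h2 := tr_inv_tangent p pY pZ (or_introl gY).
have h3 := mom_add_ge p pZ pY erefl c'0.
rewrite -/m -/t in h3.
have ZY : Z - Y = (- c') *: (v *m v^T) by rewrite /Y opprD addrA subrr add0r scaleNr.
rewrite ZY tr_mul_rank1 -/(mom _ v p) in h2.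
set b := mom (invmx Y) v p in h2 h3.
apply: (le_trans h1); have {}h2 : \tr (invmx Y ^+ p) <= \tr (invmx Z ^+ p) - p%:R * (c' * b) by lra.
apply: (le_trans h2); rewrite lerD2l lerN2.
have -> : p%:R * c * m / (1 + 4 * p.+1%:R * c * t) = p%:R * (c * m / (1 + 4 * s)).
  by rewrite /s !mulrA.
apply: ler_wpM2l => //.
apply: le_trans (ler_wpM2l c'0 h3).
(* With this c' the factor 1 - (p+1) c' t equals (1 + s) / (1 + 2 s), and what remains is (1 + 2
   s)^2 <= (1 + s) (1 + 4 s). *)
have -> : c' * (m * (1 - p.+1%:R * c' * t)) = (c * m) * ((1 + s) / (1 + 2 * s) ^+ 2).
  have -> : p.+1%:R * c' * t = s / (1 + 2 * s) by rewrite /c' /s; ring.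
  rewrite /c'; field; lra.
rewrite ler_wpM2l ?mulr_ge0 // ler_pdivlMr ?exprn_gt0 // mulrC ler_pdivrMr //; nra.
Qed.

(** The tangent is taken at the smaller matrix, so its moment p must be bounded by that of Z. This
    is [mom_add_ge] read from the smaller matrix up to Z, once the two leverages are known to be
    comparable. *)
Lemma tr_inv_sub Z v p : posdef Z -> gram Z -> (0 < p)%N ->
  16 * p%:R * mom (invmx Z) v 0 < 1 ->
  posdef (Z - 2 *: (v *m v^T)) /\
  \tr (invmx (Z - 2 *: (v *m v^T)) ^+ p) <= \tr (invmx Z ^+ p)
    + 2 * p%:R * mom (invmx Z) v p / (1 - 16 * p%:R * mom (invmx Z) v 0).
Proof.
move=> pZ gZ p0; set t := mom (invmx Z) v 0; set m := mom (invmx Z) v p => ht.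
have t0 : 0 <= t by exact/mom_ge0/posdef_inv.
have m0 : 0 <= m by exact/mom_ge0/posdef_inv.
have p1 : 1 <= p%:R :> R by rewrite ler1n.
have t16 : 16 * t < 1 by nra.
set Y := Z - _.
have pY : posdef Y by apply: posdef_sub_rank1 => //; rewrite -mom0 -/t; lra.
split=> //.
have ZY : Z = Y + 2 *: (v *m v^T) by rewrite subrK.
have h3 := mom_add_ge p pY pZ ZY (ler0n R 2).
have d0 := mom_rank1 0 pY pZ ZY.
rewrite big_ord1 /= -/t in d0.
have h2 := tr_inv_tangent p pY pZ (or_intror gZ).
have ZYd : Z - Y = 2 *: (v *m v^T) by rewrite /Y opprB addrC subrK.
rewrite ZYd tr_mul_rank1 -/(mom _ v p) in h2.
rewrite -/m in h3.
have b0 : 0 <= mom (invmx Y) v 0 by exact/mom_ge0/posdef_inv.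
have bp : 0 <= mom (invmx Y) v p by exact/mom_ge0/posdef_inv.
move: d0 h2 h3 b0 bp; set b := mom (invmx Y) v 0; set bp := mom (invmx Y) v p.
rewrite /= => d0 h2 h3 b0 bp0.
(* [mom_rank1] at exponent 0 says b - t = 2 b t, and 16 t < 1 turns this into b <= (8/7) t; then 2
   (p+1) b <= 4 p b stays below 16 p t. *)
have hb : 7 * b <= 8 * t by nra.
have pp : p.+1%:R <= 2 * p%:R :> R by rewrite -natr1; lra.
have k1 : p.+1%:R * 2 * b <= 16 * p%:R * t by nra.
have k2 : bp * (1 - 16 * p%:R * t) <= m.
  apply: le_trans h3; apply: ler_wpM2l => //; lra.
have k3 : bp <= m / (1 - 16 * p%:R * t) by rewrite ler_pdivlMr //; lra.
have k4 := ler_wpM2l (ler0n R p) k3.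
rewrite -mulrA -mulrA; lra.
Qed.

(* The exchange is the midpoint of the two one-sided moves by twice the
   rank-one matrices, so convexity removes the cross term. *)
Lemma tr_inv_swap Z v w p : posdef Z -> gram Z -> (0 < p)%N ->
  16 * p%:R * mom (invmx Z) v 0 < 1 ->
  gram (Z - v *m v^T + w *m w^T) ->
  \tr (invmx (Z - v *m v^T + w *m w^T) ^+ p) <= \tr (invmx Z ^+ p)
    + p%:R * mom (invmx Z) v p / (1 - 16 * p%:R * mom (invmx Z) v 0)
    - p%:R * mom (invmx Z) w p / (1 + 16 * p%:R * mom (invmx Z) w 0).
Proof.
move=> pZ gZ p0 ht; set Z' := Z - _ + _ => gZ'.
have [pY hY] := tr_inv_sub pZ gZ p0 ht.
have hW := tr_inv_add w p pZ gZ (ler0n R 2).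
have pW := posdef_add_rank1 w pZ (ler0n R 2).
have t1 : 0 <= mom (invmx Z) w 0 by exact/mom_ge0/posdef_inv.
have m1 : 0 <= mom (invmx Z) w p by exact/mom_ge0/posdef_inv.
move: pY hY pW hW; set Y := Z - 2 *: _; set W := Z + 2 *: _ => pY hY pW hW.
have EZ : Z' + Z' = Y + W.
  by apply/matrixP => i j; rewrite /Z' /Y /W !mxE; ring.
have pZ' : posdef Z'.
  have -> : Z' = 2^-1 *: (Y + W).
    by rewrite -EZ -mulr2n -[Z' *+ 2]scaler_nat scalerA mulVf ?scale1r.
  by apply: posdefZ; rewrite ?invr_gt0 //; exact/posdefD/posdef_psd.
have a1 := tr_inv_tangent p pZ' pY (or_introl gZ').
have a2 := tr_inv_tangent p pZ' pW (or_introl gZ').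
have a3 : \tr (invmx Z' ^+ p.+1 * (Y - Z')) + \tr (invmx Z' ^+ p.+1 * (W - Z')) = 0.
  by rewrite -raddfD -mulrDr addrACA -EZ -opprD subrr mulr0 raddf0.
(* Origin of the constant 16: [tr_inv_add] at c = 2 has the factor 8 (p+1) in its denominator, at
   most 16 p because p >= 1. *)
have a4 : p%:R * 2 * mom (invmx Z) w p / (1 + 4 * p.+1%:R * 2 * mom (invmx Z) w 0)
          >= 2 * (p%:R * mom (invmx Z) w p / (1 + 16 * p%:R * mom (invmx Z) w 0)).
  rewrite [leRHS](_ : _ = 2 * (p%:R * mom (invmx Z) w p / (1 + 4 * p.+1%:R * 2 * mom (invmx Z) w 0))); last by ring.
  have p1 : 1 <= p%:R :> R by rewrite ler1n.
  have pt := mulr_ge0 (ler0n R p) t1.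
  rewrite ler_pM2l // ler_wpM2l ?mulr_ge0 // lef_pV2 ?posrE; rewrite -?natr1; nra.
move: a3 a1 a2 a4 hY hW.
set e1 := \tr (_ * (Y - _)); set e2 := \tr (_ * (W - _)).
have -> : 2 * p%:R * mom (invmx Z) v p / (1 - 16 * p%:R * mom (invmx Z) v 0)
  = 2 * (p%:R * mom (invmx Z) v p / (1 - 16 * p%:R * mom (invmx Z) v 0)) by ring.
set T := _ / _; set T2 := _ / _; set T3 := _ / _ => a3.
have -> : e2 = - e1 by lra.
by move=> *; lra.
Qed.

(** As c may be negative, the sign of the denominator is read off from B: its form at A^-1 v is t (1
    + c t), with t = v^T A^-1 v. *)
Lemma sherman_morrison A B c v : posdef A -> posdef B -> B = A + c *: (v *m v^T) ->
  0 < 1 + c * bform (invmx A) v v /\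
  invmx B = invmx A - (c / (1 + c * bform (invmx A) v v))
                        *: ((invmx A *m v) *m (invmx A *m v)^T).
Proof.
move=> pA pB EB; set N := invmx A; set t := bform N v v.
have sN : N^T = N by exact: invmx_sym pA.1.
have tp : 0 < 1 + c * t.
  have [v0|v0] := eqVneq v 0; first by rewrite /t v0 /bform mulmx0 mxE mulr0 addr0.
  have t0 : 0 < t by exact: (posdef_inv pA).2.
  have w0 : N *m v != 0.
    by apply: contraTneq t0 => h; rewrite /t /bform -mulmxA h mulmx0 mxE ltxx.
  have := pB.2 _ w0; rewrite -/(bform _ _ _) EB bformDl bformZl bform_rank1.
  have e1 : bform 1 (N *m v) v = t by rewrite -{1}sN -bformMl mulr1.
  have -> : bform A (N *m v) (N *m v) = t by rewrite -bformMr -mulmxE posdef_mulmxV.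
  by rewrite (bformC _ v) trmx1 e1 => h; rewrite -(pmulr_rgt0 _ t0); move: h; congr (0 < _); ring.
split=> //; apply/esym/invmx_eq => //.
rewrite trmx_mul sN EB mulmxDr !mulmxBl /N posdef_mulVmx // -/N.
rewrite -!scalemxAr -!scalemxAl -!mulmxA posdef_mulVmx // mulmx1.
have -> : v^T *m (N *m (v *m v^T)) = t *: v^T.
  rewrite !mulmxA [v^T *m N *m v]mx11_scalar mul_scalar_mx; congr (_ *: _).
rewrite -!scalemxAr scalerA; set U := N *m (v *m v^T).
rewrite -addrA addrC -[RHS]add0r; congr (_ + _).
have e : - (c / (1 + c * t)) + (c - c * (c / (1 + c * t)) * t) = 0 by field; rewrite gt_eqF.
by rewrite scalerA -scaleNr -scalerBl -scalerDl e scale0r.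
Qed.

(** Expansion of 0 <= tr(X (Y^-1 - A^-1) Y (Y^-1 - A^-1)); it is the tangent at A of the convex
    function tr(X Y^-1). *)
Lemma tr_weight_tangent X A Y : gram X -> posdef A -> posdef Y ->
  \tr (X * invmx A) *+ 2 - \tr (X * (invmx A * Y * invmx A)) <= \tr (X * invmx Y).
Proof.
move=> gX pA pY; set N := invmx A; set B := invmx Y.
have sN : N^T = N by exact: invmx_sym pA.1.
have sB : B^T = B by exact: invmx_sym pY.1.
have := gram_tr_mul gX (psd_conj (B - N) (posdef_psd pY)).
rewrite linearB /= sN sB !mulrBl !mulrBr.
have BY : B * Y = 1 by exact: posdef_mulVmx.
have YB : Y * B = 1 by exact: posdef_mulmxV.
rewrite !BY !mul1r -!(mulrA N Y B) -?mulrA ?YB ?mulr1 !raddfB /= mulr2n.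
by move=> *; lra.
Qed.

Lemma tr_weight_rank1 X A B c v : gram X -> posdef A -> posdef B -> B = A + c *: (v *m v^T) ->
  \tr (X * invmx B) = \tr (X * invmx A)
    - c * bform (invmx A * X * invmx A) v v / (1 + c * bform (invmx A) v v).
Proof.
move=> gX pA pB EB; have [_ ->] := sherman_morrison pA pB EB.
have sN : (invmx A)^T = invmx A by exact: invmx_sym pA.1.
rewrite mulrBr raddfB /= -[X * (_ *: _)]/(X *m (_ *: _)) -scalemxAr linearZ /= tr_rank1.
rewrite bformMr bformMl sN; congr (_ - _).
by rewrite mulrAC.
Qed.

Lemma posdef_swap M v w : posdef M -> 2 * bform (invmx M) v v < 1 ->
  posdef (M - v *m v^T + w *m w^T).
Proof.
move=> pM h; apply: posdefD; last exact/gram_psd/gram_rank1.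
rewrite -[v *m v^T]scale1r; apply: posdef_sub_rank1 => //.
by have := (posdef_psd (posdef_inv pM)).2 v; lra.
Qed.

Lemma tr_weight_swap X M v w : gram X -> posdef M -> 2 * bform (invmx M) v v < 1 ->
  \tr (X * invmx (M - v *m v^T + w *m w^T)) <= \tr (X * invmx M)
    + bform (invmx M * X * invmx M) v v / (1 - 2 * bform (invmx M) v v)
    - bform (invmx M * X * invmx M) w w / (1 + 2 * bform (invmx M) w w).
Proof.
move=> gX pM h; have pM' := posdef_swap w pM h.
move: pM'; set M' := M - _ + _ => pM'.
have pY : posdef (M - 2 *: (v *m v^T)) by exact: posdef_sub_rank1.
have pW := posdef_add_rank1 w pM (ler0n R 2).
have := tr_weight_rank1 gX pM pW erefl.
have := tr_weight_rank1 (c := - 2) (v := v) gX pM pY.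
rewrite scaleNr => /(_ erefl).
have := tr_weight_tangent gX pM' pY; have := tr_weight_tangent gX pM' pW.
set Y := M - 2 *: _; set W := M + 2 *: _.
have EZ : M' + M' = Y + W.
  by apply/matrixP => i j; rewrite /M' /Y /W !mxE; ring.
(* As M' is the midpoint of Y and W, the two tangents at M' add up to 2 tr(X M'^-1) <= tr(X Y^-1) +
   tr(X W^-1), whose right side the rank-one formula evaluates exactly. *)
have : \tr (X * (invmx M' * Y * invmx M')) + \tr (X * (invmx M' * W * invmx M'))
   = \tr (X * invmx M') *+ 2.
  rewrite -raddfD -mulrDr -mulrDl -mulrDr -EZ mulrDr mulrDl.
  by rewrite -[invmx M' * M']/(invmx M' *m M') posdef_mulVmx // mul1r mulrDr raddfD mulr2n.
set q1 := \tr (_ * (_ * Y * _)); set q2 := \tr (_ * (_ * W * _)).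
rewrite !mulNr; set b1 := 2 * _ / _; set b2 := 2 * _ / _.
have -> : bform (invmx M * X * invmx M) v v / (1 - 2 * bform (invmx M) v v) = b1 / 2.
  by rewrite /b1; field; lra.
have -> : bform (invmx M * X * invmx M) w w / (1 + 2 * bform (invmx M) w w) = b2 / 2.
  by rewrite /b2; field; have := (posdef_psd (posdef_inv pM)).2 w; lra.
by move=> *; lra.
Qed.

End Exchanges.

(** * Design matrices of index sets *)

Section Design.
Variables (R : realType) (n d : nat) (v : 'I_n -> 'cV[R]_d).
Implicit Types (A N : 'M[R]_d) (y : 'I_n -> R) (z : 'I_n -> bool).

Lemma design_gram y : (forall i, 0 <= y i) -> gram (design_mx v y).
Proof.
move=> y0; rewrite /design_mx; elim/big_rec: _ => [|i A _ gA]; first exact: gram0.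
by apply: gramD => //; apply/gramZ/gram_rank1.
Qed.

Lemma tr_design A y : \tr (A * design_mx v y) = \sum_i y i * bform A (v i) (v i).
Proof.
rewrite /design_mx mulr_sumr raddf_sum; apply: eq_bigr => i _.
by rewrite /= tr_mul_rank1.
Qed.

Lemma bform_design y u :
  bform (design_mx v y) u u = \sum_i y i * bform 1 u (v i) ^+ 2.
Proof.
rewrite /design_mx bform_suml; apply: eq_bigr => i _.
by rewrite bformZl bform_rank1 (bformC _ (v i)) trmx1 expr2.
Qed.

Definition bvec z : 'I_n -> R := fun i => (z i)%:R.

Definition swap z (i j : 'I_n) : 'I_n -> bool :=
  fun l => if l == j then true else if l == i then false else z l.

Lemma sum_swap z i j (V : zmodType) (F : 'I_n -> V) : z i -> ~~ z j ->
  \sum_(l | swap z i j l) F l = \sum_(l | z l) F l - F i + F j.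
Proof.
move=> zi zj; have ij : i != j by apply: contraNneq zj => <-.
rewrite (bigD1 j) /=; last by rewrite /swap eqxx.
rewrite [in RHS](bigD1 i) //= [F i + _]addrC addrK addrC; congr (_ + _).
apply: eq_bigl => l; rewrite /swap.
have [->|lj] := eqVneq l j; first by rewrite (negPf zj).
by have [->|li] := eqVneq l i; rewrite ?andbF ?andbT.
Qed.

Lemma design_bvec z : design_mx v (bvec z) = \sum_(i | z i) v i *m (v i)^T.
Proof.
rewrite /design_mx [RHS]big_mkcond; apply: eq_bigr => i _; rewrite /bvec.
by case: (z i); rewrite ?scale1r ?scale0r.
Qed.

Lemma design_swap z i j : z i -> ~~ z j ->
  design_mx v (bvec (swap z i j))
  = design_mx v (bvec z) - v i *m (v i)^T + v j *m (v j)^T.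
Proof. by move=> zi zj; rewrite !design_bvec sum_swap. Qed.

Lemma bvec_ge0 z i : 0 <= bvec z i. Proof. exact: ler0n. Qed.

End Design.

(** * Averaging over exchanges at a stuck set *)

Section Selection.
Variables (R : realType) (n : nat).
Implicit Types (z : 'I_n -> bool) (G t : 'I_n -> R) (c rho : R).

Definition loss c G t i : R := G i / (1 - c * t i).
Definition gain c G t j : R := G j / (1 + c * t j).

(** Only indices with c t_i < 1 may leave, which keeps the denominator of [loss] positive. *)
Definition no_swap z G t c rho : Prop :=
  forall i j, z i -> c * t i < 1 -> ~~ z j -> gain c G t j - loss c G t i < rho.

Definition good_swap z z' G t c rho : Prop := exists i j,
  [/\ z i, c * t i < 1, ~~ z j, rho <= gain c G t j - loss c G t i & z' = swap z i j].

Definition exchange z z' G t c rho : Prop :=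
  (z' = z /\ no_swap z G t c rho) \/ good_swap z z' G t c rho.

(** Let th be the least loss. Every chosen i has G_i >= th (1 - c t_i), every other j has G_j <= (th
    + rho) (1 + c t_j). Adding these with weights 1 - x_i and x_j leaves th times the sum of x minus
    K, which is nonpositive, plus error terms; the first inequality summed over the set bounds th
    itself. *)
Lemma selection z x G t c rho (K : R) :
  (forall i, 0 <= G i) -> (forall i, 0 <= t i) -> 0 <= c -> 0 <= rho ->
  (forall i, 0 <= x i <= 1) -> \sum_i x i <= K -> \sum_i (z i)%:R = K ->
  c * \sum_i bvec R z i * t i < K ->
  no_swap z G t c rho ->
  \sum_i x i * G i - \sum_i bvec R z i * G i
  <= rho * (K + c * \sum_i x i * t i)
   + c * (\sum_i bvec R z i * G i)
       * (\sum_i x i * t i + \sum_i bvec R z i * t i)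
       / (K - c * \sum_i bvec R z i * t i).
Proof.
move=> G0 t0 c0 r0 x01 sx sz cb ns.
(* If no chosen index were removable, c times the leverages of the set would add up to at least
   K. *)
have [i0 [zi0 ti0]] : exists i, z i /\ c * t i < 1.
  apply/not_existsP => h; suff : K <= c * \sum_i bvec R z i * t i by rewrite leNgt cb.
  rewrite -sz mulr_sumr; apply: ler_sum => i _; rewrite /bvec.
  case zi: (z i); last by rewrite mul0r mulr0.
  by rewrite mul1r; have /not_andP[//|/negP] := h i; rewrite -leNgt.
pose P := [pred i | z i && (c * t i < 1)].
have Pi0 : P i0 by rewrite /= zi0.
have [i1 /andP[zi1 ti1] imin] := arg_minP (loss c G t) Pi0.
set th := loss c G t i1 in imin *.
have th0 : 0 <= th by rewrite /th /loss divr_ge0 //; lra.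
have lo i : z i -> th * (1 - c * t i) <= G i.
  move=> zi; have [hi|hi] := ltP (c * t i) 1.
    have /imin : P i by rewrite /= zi.
    by rewrite /loss ler_pdivlMr //; lra.
  (* For an index that is not removable the lower bound is nonpositive. *)
  by apply: le_trans (G0 i); nra.
have hi j : ~~ z j -> G j <= (th + rho) * (1 + c * t j).
  move=> zj; have := ns _ _ zi1 ti1 zj; rewrite -/th ltrBlDr addrC => /ltW.
  by rewrite /gain ler_pdivrMr //; have := mulr_ge0 c0 (t0 j); lra.
have thE : th * (K - c * \sum_i bvec R z i * t i) <= \sum_i bvec R z i * G i.
  rewrite -sz mulr_sumr -sumrB mulr_sumr; apply: ler_sum => i _.
  rewrite /bvec; case zi: (z i); last by rewrite !mul0r mulr0 subrr mulr0.
  by rewrite !mul1r; exact: lo.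
have {}thE : th <= (\sum_i bvec R z i * G i) / (K - c * \sum_i bvec R z i * t i).
  by rewrite ler_pdivlMr // subr_gt0.
have step : \sum_i x i * G i - \sum_i bvec R z i * G i <=
   th * (\sum_i x i - \sum_i (z i)%:R) + rho * (\sum_i x i + c * \sum_i x i * t i)
   + c * (th * (\sum_i x i * t i + \sum_i bvec R z i * t i)).
  rewrite !(mulr_sumr, =^~ sumrB, =^~ big_split) /=.
  apply: ler_sum => i _; have /andP[x0 x1] := x01 i; rewrite /bvec.
  have ct := mulr_ge0 c0 (t0 i).
  case zi: (z i) => /=.
    have := lo i zi; have := mulr_ge0 th0 ct; have := mulr_ge0 r0 x0.
    have := mulr_ge0 r0 (mulr_ge0 x0 ct).
    have := mulr_ge0 (mulr_ge0 th0 ct) x0.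
    by nra.
  have := hi i (negbT zi); nra.
apply: (le_trans step); rewrite sz -addrA.
have tt0 : 0 <= \sum_i x i * t i + \sum_i bvec R z i * t i.
  rewrite addr_ge0 //; apply: sumr_ge0 => i _; rewrite mulr_ge0 ?bvec_ge0 //.
  by have /andP[] := x01 i.
set a := \sum_i x i * t i; set b := \sum_i bvec R z i * t i in tt0 *.
have := ler_wpM2l c0 (ler_wpM2r tt0 thE).
have -> : c * (\sum_i bvec R z i * G i) * (a + b) / (K - c * b)
  = c * ((\sum_i bvec R z i * G i) / (K - c * b) * (a + b)) by ring.
have : th * (\sum_i x i - K) <= 0 by rewrite mulr_ge0_le0 // subr_le0.
have : rho * (\sum_i x i + c * a) <= rho * (K + c * a) by rewrite ler_wpM2l // lerD2r.
rewrite /a /b; lra.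
Qed.

End Selection.

(** * Numerical inequalities at a stuck set *)

Section Arithmetic.
Variable R : realType.

(** Here N = (Z - l X)^-1, q = tr(N X N X) and phi = tr(X N). From phi > d / e and phi^2 <= d q
    follows phi <= e q, so the left side of the stuck inequality is at least 2 e q - phi >= e q. Its
    right side is at most (5/8) e q from the averaging error plus (d / e) / 6 <= e q / 6 from the
    threshold: a contradiction. *)
Lemma barrier_arith (q phi l e dd K rho : R) :
  0 < e -> e <= 4^-1 -> 0 < dd -> l <= 1 - 2 * e ->
  dd / e < phi -> phi <= 4 / 3 * (dd / e) -> 200 * dd / e ^+ 2 <= K ->
  phi ^+ 2 <= dd * q -> 0 <= dd + l * phi -> 0 <= phi + l * q ->
  rho * K <= dd / (8 * e) ->
  q - (phi + l * q) <= rho * (K + 16 * phi)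
     + 16 * (phi + l * q) * (phi + (dd + l * phi)) / (K - 16 * (dd + l * phi)) ->
  False.
Proof.
move=> e0 e4 dd0 le1; set D := dd / e => Dphi phiD hK hq b0 E0 hr.
have D0 : 0 < D by rewrite divr_gt0.
have ddE : dd = e * D by rewrite /D; field; rewrite gt_eqF.
have {}hK : 200 * D <= e * K.
  move: hK; rewrite (_ : 200 * dd / e ^+ 2 = 200 * D / e); last first.
    by rewrite ddE; field; rewrite gt_eqF.
  by rewrite ler_pdivrMr // [K * e]mulrC.
have {}hr : rho * K <= D / 8.
  by rewrite (_ : D / 8 = dd / (8 * e)) // /D; field; rewrite gt_eqF.
have K0 : 800 * D <= K by nra.
have phi0 : 0 < phi by lra.
have q1 : phi <= e * q.
  have : D * phi <= D * (e * q).
    rewrite (_ : D * (e * q) = dd * q); last by rewrite ddE; ring.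
    by apply: le_trans hq; rewrite expr2 ler_pM2r // ltW.
  by rewrite ler_pM2l.
have q0 : 0 < q by rewrite -(pmulr_rgt0 _ e0); lra.
have l1 : l < 1 by lra.
have lphi : l * phi <= phi by nra.
have den : K - 26 * D <= K - 16 * (dd + l * phi) by nra.
have den0 : 0 < K - 16 * (dd + l * phi) by lra.
have ratio : 16 * (phi + (dd + l * phi)) / (K - 16 * (dd + l * phi)) <= e / 2.
  by rewrite ler_pdivrMr //; nra.
have Eq : phi + l * q <= 5 / 4 * q by nra.
have r1 : 16 * (phi + l * q) * (phi + (dd + l * phi)) / (K - 16 * (dd + l * phi))
   <= (e / 2) * (5 / 4 * q).
  rewrite (_ : 16 * (phi + l * q) * (phi + (dd + l * phi)) / (K - 16 * (dd + l * phi))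
   = (phi + l * q) * (16 * (phi + (dd + l * phi)) / (K - 16 * (dd + l * phi)))); last by ring.
  rewrite mulrC; apply: ler_pM => //.
  by apply: divr_ge0; [rewrite mulr_ge0 // addr_ge0 // ltW|exact: ltW].
have r2 : rho * (K + 16 * phi) <= D / 6.
  have K1 : 0 < K by lra.
  have hrho : rho <= D / 8 / K by rewrite ler_pdivlMr.
  have : rho * (16 * phi) <= D / 8 / K * (16 * phi) by rewrite ler_wpM2r //; lra.
  have : D / 8 / K * (16 * phi) <= D / 30.
    rewrite mulrAC ler_pdivrMr //.
    have : D * (2 * phi) <= D * (K / 30) by rewrite ler_wpM2l ?(ltW D0) //; lra.
    by lra.
  by lra.
have : 2 * e * q <= (1 - l) * q by rewrite ler_wpM2r ?(ltW q0) //; lra.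
by lra.
Qed.

(** Here s is the ratio of the objectives and t = tr(X Z^-1) / d. The averaging error is at most eps
    / 100 times a quadratic in t, and (eps / 8) t^2 on the left dominates it for large t. *)
Lemma descent_arith (s sxg t eps dd K c rho : R) :
  0 < eps -> eps < 1 -> 0 <= t -> 0 < K -> 0 <= c * dd -> c * dd <= K * (eps / 200) ->
  rho * K <= eps / 16 -> s + eps / 8 * t ^+ 2 <= sxg ->
  sxg - (1 + eps / 8 * t) <= rho * (K + c * (dd * t))
     + c * (1 + eps / 8 * t) * (dd * t + dd) / (K - c * dd) ->
  s <= 1 + eps.
Proof.
move=> e0 e1 t0 K0 c0 hc hr hs.
have den0 : 0 < K - c * dd by have := ltr_pM2l K0 eps 1; rewrite e1; lra.
have hrho : rho * (c * (dd * t)) <= eps / 3200 * t.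
  have hrho : rho <= eps / 16 / K by rewrite ler_pdivlMr.
  apply: le_trans (_ : eps / 16 / K * (c * dd * t) <= _).
    by rewrite [c * (dd * t)]mulrA; apply: ler_wpM2r => //; rewrite mulr_ge0.
  apply: le_trans (_ : eps / 16 / K * (K * (eps / 200) * t) <= _).
    by rewrite ler_wpM2l ?ler_wpM2r // divr_ge0 ?divr_ge0 // ltW.
  rewrite (_ : eps / 16 / K * (K * (eps / 200) * t) = eps ^+ 2 / 3200 * t); last first.
    by field; rewrite gt_eqF.
  have e2 : eps ^+ 2 <= eps by rewrite expr2 ger_pMr // ltW.
  by have := ler_wpM2r t0 e2; lra.
have hd : c * dd / (K - c * dd) <= eps / 100.
  rewrite ler_pdivrMr //; have : eps / 100 * (c * dd) <= c * dd / 100.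
    by have := ler_wpM2r c0 (ltW e1); lra.
  lra.
rewrite (_ : c * (1 + eps / 8 * t) * (dd * t + dd) / (K - c * dd)
  = (c * dd / (K - c * dd)) * ((1 + eps / 8 * t) * (1 + t))); last by ring.
have w0 : 0 <= (1 + eps / 8 * t) * (1 + t).
  by have et := mulr_ge0 (ltW e0) t0; apply: mulr_ge0; lra.
have := ler_wpM2r w0 hd.
have : eps / 100 * ((1 + eps / 8 * t) * (1 + t)) <= eps / 100 * ((1 + t / 8) * (1 + t)).
  have et : eps * t <= t by have := ler_wpM2r t0 (ltW e1); lra.
  by apply: ler_wpM2l; [lra|apply: ler_wpM2r; lra].
(* What is left is a concave quadratic in t; 3/5 lies close to its maximiser. *)
have := mulr_ge0 (ltW e0) (sqr_ge0 (t - 3 / 5)).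
have := mulr_ge0 (ltW e0) t0.
lra.
Qed.

End Arithmetic.

(** * Scaling and squares of traces *)

Section Traces.
Variables (R : realType) (d : nat).
Implicit Types (A M N X Y Z : 'M[R]_d).

Lemma posdef_tr_gt0 A : (0 < d)%N -> posdef A -> 0 < \tr A.
Proof.
move=> d0 pA; have diag i : 0 < A i i.
  have := pA.2 (delta_mx i 0); rewrite trmx_delta -rowE -colE !mxE; apply.
  by apply/negP => /eqP/matrixP/(_ i 0)/eqP; rewrite !mxE !eqxx oner_eq0.
rewrite /mxtrace (bigD1 (Ordinal d0)) //=; apply: ltr_wpDr (diag _).
by apply: sumr_ge0 => i _; exact: ltW.
Qed.

Lemma invmx_scale c A : 0 < c -> posdef A -> invmx (c *: A) = c^-1 *: invmx A.
Proof.
move=> c0 pA; apply/esym/invmx_eq; first exact: posdefZ.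
by rewrite -scalemxAr -scalemxAl scalerA posdef_mulVmx // mulfV ?scale1r // gt_eqF.
Qed.

Lemma exprZmx c A m : (c *: A) ^+ m = c ^+ m *: A ^+ m.
Proof.
elim: m => [|m IH]; first by rewrite !expr0 scale1r.
by rewrite !exprS IH -!mulmxE -scalemxAr -scalemxAl scalerA mulrC.
Qed.

(** Cauchy-Schwarz for the eigenvalues of X M^-1, obtained from the tangent of tr(X Y^-1) at a
    multiple of M, evaluated at Y = X. The scaling c = d / tr(X M^-1) only divides by a quantity
    already known to be positive. *)
Lemma tr_square_ge X M : posdef X -> gram X -> posdef M ->
  \tr (X * invmx M) ^+ 2 <= d%:R * \tr (invmx M * X * invmx M * X).
Proof.
move=> pX gX pM; set N := invmx M.
have q0 : 0 <= \tr (N * X * N * X).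
  rewrite tr_mulC; apply: gram_tr_mul gX _.
  by have := psd_conj N (posdef_psd pX); rewrite [N^T]invmx_sym //; exact: pM.1.
have phi0 : 0 <= \tr (X * N) by apply/(gram_tr_mul gX)/posdef_psd/posdef_inv.
have [phi00|phip] := eqVneq (\tr (X * N)) 0.
  by rewrite phi00 expr0n mulr_ge0.
have {phip}phi1 : 0 < \tr (X * N) by rewrite lt_neqAle eq_sym phip.
have [d0|d0] := posnP d.
  by move: phi1; rewrite /mxtrace big1 ?ltxx // => i; by have := ltn_ord i; rewrite {2}d0.
have dp : 0 < d%:R :> R by rewrite ltr0n.
set c := d%:R / \tr (X * N).
have c0 : 0 < c by rewrite divr_gt0.
have ci0 : 0 < c^-1 by rewrite invr_gt0.
have := tr_weight_tangent gX (posdefZ ci0 pM) pX.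
rewrite invmx_scale // invrK -/N -[X * invmx X]/(X *m _) posdef_mulmxV // mxtrace1.
rewrite -!mulmxE -!scalemxAl -!scalemxAr !linearZ /= !mulmxE.
rewrite [\tr (X * (N * X * N))]tr_mulC.
move: (\tr (N * X * N * X)) (\tr (X * N)) @c phi1 {phi0 q0 c0 ci0} => q phi c phi1 h.
rewrite -(ler_pM2l (mulr_gt0 dp (exprn_gt0 2 (divr_gt0 ltr01 phi1)))).
move: h; rewrite /c => h.
have -> : d%:R * (1 / phi) ^+ 2 * phi ^+ 2 = d%:R by field; rewrite gt_eqF.
have e1 : (d%:R / phi * phi) = d%:R by rewrite divfK // gt_eqF.
rewrite e1 in h; have -> : d%:R * (1 / phi) ^+ 2 * (d%:R * q) = d%:R / phi * (d%:R / phi * q).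
  by field; rewrite gt_eqF.
have {}h : d%:R *+ 2 + (d%:R / phi) * ((d%:R / phi) * - q) <= d%:R := h.
by rewrite !mulrN in h; lra.
Qed.

End Traces.

(** * Local search relative to the fractional matrix *)

Section LocalSearch.
Variables (R : realType) (n d : nat) (v : 'I_n -> 'cV[R]_d) (x : 'I_n -> R).
Implicit Types (A M N Z : 'M[R]_d) (z : 'I_n -> bool) (l : R).

Local Notation X := (design_mx v x).
Local Notation Zmx z := (design_mx v (bvec R z)).

Definition shifted z l : 'M[R]_d := Zmx z - l *: X.
Definition lev N i : R := bform N (v i) (v i).
(** For N = M^-1, minus the derivative of tr(X M^-1) along v_i v_i^T. *)
Definition sens N i : R := bform (N * X * N) (v i) (v i).
(** For N = Z^-1 and om = 1, minus the derivative of [potential] along v_i v_i^T. The sum of moments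
    over the set then equals tr(Z^-p), so the program obtains this trace without a matrix power. The
    barrier phase takes om = 0 and be = 1. *)
Definition score N (p : nat) (om be : R) z i : R :=
  om * mom N (v i) p / (\sum_j bvec R z j * mom N (v j) p) + be * sens N i.

Hypotheses (x01 : forall i, 0 <= x i <= 1) (pX : posdef X) (d0 : (0 < d)%N).

Let x0 i : 0 <= x i. Proof. by have /andP[] := x01 i. Qed.
Let gX : gram X. Proof. exact: design_gram. Qed.
Let gZ z : gram (Zmx z). Proof. by apply: design_gram => i; exact: bvec_ge0. Qed.
Let d1 : 0 < d%:R :> R. Proof. by rewrite ltr0n. Qed.

Lemma shifted_swap z l i j : z i -> ~~ z j ->
  shifted (swap z i j) l = shifted z l - v i *m (v i)^T + v j *m (v j)^T.
Proof.
by move=> zi zj; rewrite /shifted design_swap // addrAC; congr (_ + _); rewrite addrAC.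
Qed.

Lemma lev_ge0 M i : posdef M -> 0 <= lev (invmx M) i.
Proof. by move=> pM; exact: (posdef_psd (posdef_inv pM)).2. Qed.

Lemma sens_psd M : posdef M -> psd (invmx M * X * invmx M).
Proof.
move=> pM; have := psd_conj (invmx M) (posdef_psd pX).
by rewrite invmx_sym //; exact: pM.1.
Qed.

Lemma sens_ge0 M i : posdef M -> 0 <= sens (invmx M) i.
Proof. by move=> pM; exact: (sens_psd pM).2. Qed.

Lemma sum_x_lev N : \sum_i x i * lev N i = \tr (X * N).
Proof. by rewrite tr_mulC tr_design. Qed.

Lemma sum_x_sens N : \sum_i x i * sens N i = \tr (N * X * N * X).
Proof. by rewrite tr_design. Qed.

Lemma sum_z_lev z l : posdef (shifted z l) ->
  \sum_i bvec R z i * lev (invmx (shifted z l)) i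
  = d%:R + l * \tr (X * invmx (shifted z l)).
Proof.
move=> pM; rewrite /lev /sens -tr_design; set N := invmx _.
have -> : Zmx z = shifted z l + l *: X by rewrite subrK.
rewrite mulrDr raddfD /= -[N * shifted z l]/(N *m shifted z l) posdef_mulVmx //.
rewrite mxtrace1 -[N * _]/(N *m _) -scalemxAr linearZ /= mulmxE tr_mulC.
by [].
Qed.

Lemma sum_z_sens z l : posdef (shifted z l) ->
  let N := invmx (shifted z l) in
  \sum_i bvec R z i * sens N i = \tr (X * N) + l * \tr (N * X * N * X).
Proof.
move=> pM; rewrite /lev /sens -tr_design; set N := invmx _.
have -> : Zmx z = shifted z l + l *: X by rewrite subrK.
rewrite mulrDr raddfD /= -(mulrA (N * X) N (shifted z l)) -[N * shifted z l]/(N *m shifted z l) posdef_mulVmx //.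
rewrite mulr1 [\tr (N * X)]tr_mulC -[N * X * N * (l *: X)]/((N * X * N) *m (l *: X)) -scalemxAr linearZ /= mulmxE.
by [].
Qed.

Lemma lossW c G (t : 'I_n -> R) i : 2 <= c -> 0 <= t i -> c * t i < 1 -> 0 <= G i ->
  G i / (1 - 2 * t i) <= loss c G t i.
Proof.
move=> c2 t0 ct G0; apply: ler_wpM2l => //; have h := ler_wpM2r t0 c2.
by rewrite lef_pV2 ?posrE; lra.
Qed.

Lemma gainW c G (t : 'I_n -> R) i : 2 <= c -> 0 <= t i -> 0 <= G i ->
  gain c G t i <= G i / (1 + 2 * t i).
Proof.
move=> c2 t0 G0; apply: ler_wpM2l => //; have h := ler_wpM2r t0 c2.
by rewrite lef_pV2 ?posrE; lra.
Qed.

(** * Raising the barrier *)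

(** The threshold rho satisfies rho K <= d / (8 e), as a stuck set requires, and yet n^2 rho >= d /
    e once n >= 8, so n^2 rounds suffice at each level l. *)
Lemma barrier_step z z' l e (K : R) p :
  0 < e -> e <= 4^-1 -> 200 * d%:R / e ^+ 2 <= K -> K <= n%:R ->
  \sum_i x i <= K -> \sum_i bvec R z i = K ->
  posdef (shifted z l) -> \tr (X * invmx (shifted z l)) <= 4 / 3 * (d%:R / e) ->
  let rho := d%:R / (8 * e * n%:R) in
  let N := invmx (shifted z l) in
  exchange z z' (score N p 0 1 z) (lev N) 16 rho ->
  [/\ posdef (shifted z' l),
      \tr (X * invmx (shifted z' l)) <= \tr (X * N) &
      l <= 1 - 2 * e -> \tr (X * N) <= d%:R / e \/
        \tr (X * invmx (shifted z' l)) <= \tr (X * N) - rho].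
Proof.
move=> e0 e4 hK Kn sx sz pM hphi rho N.
have -> : score N p 0 1 z = sens N by apply/funext => i; rewrite /score !mul0r add0r mul1r.
have K0 : 0 < K by apply: lt_le_trans hK; rewrite divr_gt0 ?exprn_gt0 ?mulr_gt0.
have n0 : 0 < n%:R :> R by lra.
have rho0 : 0 <= rho by rewrite divr_ge0 ?mulr_ge0 // ltW.
have t0 i : 0 <= lev N i by exact: lev_ge0.
have s0 i : 0 <= sens N i by exact: sens_ge0.
case=> [[-> ns]|[i [j [zi ti zj hr ->]]]]; last first.
  have := t0 i; have := t0 j => tj tii.
  have ti2 : 2 * bform (invmx (shifted z l)) (v i) (v i) < 1 by rewrite -/(lev N i); lra.
  have pM' : posdef (shifted (swap z i j) l) by rewrite shifted_swap //; exact: posdef_swap.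
  have : \tr (X * invmx (shifted (swap z i j) l)) <= \tr (X * N) - rho.
    rewrite shifted_swap //.
    have := tr_weight_swap (v j) gX pM ti2.
    have := @lossW 16 (sens N) (lev N) i _ tii ti (s0 i).
    have := @gainW 16 (sens N) (lev N) j _ tj (s0 j).
    rewrite -!/N -!/(sens N _) -!/(lev N _).
    set a := sens N j / _; set b := sens N i / _ => h1 h2.
    by have {}h1 := h1 (ler_nat _ 2 16); have {}h2 := h2 (ler_nat _ 2 16); lra.
  by move=> h; split => //; [lra|right].
split=> // l1; left; rewrite leNgt; apply/negP => hphi2.
have tz := sum_z_lev pM; rewrite -/N in tz.
have b0 : 0 <= d%:R + l * \tr (X * N).
  by rewrite -tz; apply: sumr_ge0 => i _; rewrite mulr_ge0 ?bvec_ge0.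
have E0 : 0 <= \tr (X * N) + l * \tr (N * X * N * X).
  by rewrite -(sum_z_sens pM); apply: sumr_ge0 => i _; rewrite mulr_ge0 ?bvec_ge0.
have hrho : rho * K <= d%:R / (8 * e).
  rewrite /rho (_ : _ * K = d%:R / (8 * e) * (K / n%:R)); last by field; rewrite !gt_eqF.
  apply: ler_piMr; first by rewrite divr_ge0 ?mulr_ge0 // ltW.
  by rewrite ler_pdivrMr // mul1r.
have D0 : 0 < d%:R / e by rewrite divr_gt0.
have cb : 16 * (d%:R + l * \tr (X * N)) < K.
  have lp : l * \tr (X * N) <= \tr (X * N) by apply: ler_piMl; lra.
  have : 200 * d%:R / e ^+ 2 = 200 * (d%:R / e) / e by field; rewrite gt_eqF.
  have : d%:R <= d%:R / e * 4^-1 by rewrite mulrAC ler_pdivlMr // ler_pM2l.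
  have : 200 * (d%:R / e) * 4 <= 200 * (d%:R / e) / e.
    by rewrite ler_pdivlMr //; have := ler_wpM2l (ltW D0) e4; lra.
  by lra.
have := @selection R n z x (sens N) (lev N) 16 rho K s0 t0 _ rho0 x01 sx sz.
rewrite tz => /(_ (ler0n _ 16) cb ns).
rewrite sum_x_sens sum_x_lev (sum_z_sens pM) -/N => hsel.
have hq := tr_square_ge pX gX pM.
exact: barrier_arith e0 e4 d1 l1 hphi2 hphi hK hq b0 E0 hrho hsel.
Qed.

(** [dual_CS] for each v_i, summed with weights x_i. Raising l by eta thus removes at most the
    fraction eta tr(X M^-1) of M. *)
Lemma X_le_form M u : posdef M -> bform X u u <= \tr (X * invmx M) * bform M u u.
Proof.
move=> pM; rewrite bform_design -sum_x_lev mulr_suml; apply: ler_sum => i _.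
by rewrite -mulrA ler_wpM2l // [leRHS]mulrC; exact: dual_CS.
Qed.

Lemma tr_weight_antitone c A B : 0 < c -> posdef A -> posdef B ->
  (forall u, bform A u u <= c * bform B u u) ->
  \tr (X * invmx B) <= c * \tr (X * invmx A).
Proof.
move=> c0 pA pB h; rewrite -!sum_x_lev mulr_sumr; apply: ler_sum => i _.
by rewrite mulrCA ler_wpM2l //; exact: inv_antitone.
Qed.

Lemma shifted_sym z l : (shifted z l)^T = shifted z l.
Proof. by rewrite /shifted linearB linearZ /= !gram_sym. Qed.

(** The increment is chosen such that eta d / e = 1/4: three quarters of the shifted matrix survive,
    and its inverse grows by at most 4/3. *)
Lemma barrier_raise z l e : 0 < e ->
  posdef (shifted z l) -> \tr (X * invmx (shifted z l)) <= d%:R / e ->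
  posdef (shifted z (l + e / (4 * d%:R))) /\
  \tr (X * invmx (shifted z (l + e / (4 * d%:R)))) <= 4 / 3 * (d%:R / e).
Proof.
move=> e0 pM hphi; set eta := e / _.
have eta0 : 0 <= eta by rewrite divr_ge0 ?mulr_ge0 // ltW.
have EM : shifted z (l + eta) = shifted z l - eta *: X.
  by rewrite /shifted scalerDl opprD addrA.
have h u : bform (shifted z l) u u <= 4 / 3 * bform (shifted z (l + eta)) u u.
  rewrite EM [bform (_ - eta *: X) u u]bformBl bformZl; have := ler_wpM2l eta0 (X_le_form u pM).
  have [_ /(_ u) m0] := posdef_psd pM.
  have : eta * \tr (X * invmx (shifted z l)) <= 4^-1.
    apply: le_trans (ler_wpM2l eta0 hphi) _.
    have -> // : eta * (d%:R / e) = 4^-1 by rewrite /eta; field; rewrite !gt_eqF.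
  by move=> /(ler_wpM2r m0); lra.
have pM' : posdef (shifted z (l + eta)).
  apply: (posdef_ge (posdefZ (_ : 0 < 3 / 4) pM)); [lra|exact: shifted_sym|].
  by move=> u; rewrite bformZl; have := h u; lra.
split=> //; apply: le_trans (tr_weight_antitone (_ : 0 < 4 / 3) pM pM' h) _; first lra.
by rewrite ler_pM2l //; lra.
Qed.

(** At l = -e the shifted matrix dominates e X for every initial set, even when Z is singular. *)
Lemma barrier_init z e : 0 < e ->
  posdef (shifted z (- e)) /\ \tr (X * invmx (shifted z (- e))) <= d%:R / e.
Proof.
move=> e0; have EM : shifted z (- e) = e *: X + Zmx z.
  by rewrite /shifted scaleNr opprK addrC.
have pM : posdef (shifted z (- e)).
  by rewrite EM; apply: posdefD; [exact: posdefZ|exact: gram_psd].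
split=> //; have := @tr_weight_antitone e^-1 X (shifted z (- e)).
rewrite invr_gt0 -[X * invmx X]/(X *m invmx X) posdef_mulmxV // mxtrace1 mulrC; apply=> //.
move=> u; rewrite EM bformDl bformZl mulrDr mulKf ?gt_eqF // lerDl.
by rewrite mulr_ge0 ?invr_ge0 ?(ltW e0) //; exact: (gram_psd (gZ z)).2.
Qed.

(** * Descent on the p-norm objective *)

Lemma shifted0 z : shifted z 0 = Zmx z.
Proof. by rewrite /shifted scale0r subr0. Qed.

Lemma sum_z_mom z p : posdef (Zmx z) ->
  \sum_i bvec R z i * mom (invmx (Zmx z)) (v i) p = \tr (invmx (Zmx z) ^+ p).
Proof.
move=> pZ; rewrite /mom -tr_design exprSr -mulrA -[_ * Zmx z]/(_ *m Zmx z).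
by rewrite posdef_mulVmx // mulr1.
Qed.

Lemma sum_x_mom N p : \sum_i x i * mom N (v i) p = \tr (N ^+ p.+1 * X).
Proof. by rewrite /mom tr_design. Qed.

Lemma ln_sub_le (a b : R) : 0 < a -> 0 < b -> ln b - ln a <= (b - a) / a.
Proof.
move=> a0 b0; rewrite -ln_div ?posrE //.
have -> : b / a = 1 + (b - a) / a by field; rewrite gt_eqF.
apply: le_ln1Dx; rewrite ltr_pdivlMr //; lra.
Qed.

Definition potential (p : nat) (B : R) Z : R :=
  ln (\tr (invmx Z ^+ p)) / p%:R + B * \tr (X * invmx Z).

Lemma tr_expr_gt0 Z p : posdef Z -> 0 < \tr (invmx Z ^+ p).
Proof. by move=> pZ; apply: posdef_tr_gt0 => //; exact/posdef_expr/posdef_inv. Qed.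

(* Hölder's inequality, from the tangent inequality at the multiple of X that
   has the same objective value as Z. *)
Lemma objective_holder Z p s : posdef Z -> (0 < p)%N -> 0 < s ->
  s ^+ p * \tr (invmx X ^+ p) = \tr (invmx Z ^+ p) ->
  s * \tr (invmx Z ^+ p) <= \tr (invmx Z ^+ p.+1 * X).
Proof.
move=> pZ p0 s0 hs; have si0 : 0 < s^-1 by rewrite invr_gt0.
have := tr_inv_tangent p pZ (posdefZ si0 pX) (or_intror (gramZ (ltW si0) gX)).
rewrite invmx_scale // invrK exprZmx mxtraceZ hs mulrBr raddfB /=.
have -> : \tr (invmx Z ^+ p.+1 * Z) = \tr (invmx Z ^+ p).
  by rewrite exprSr -mulrA -[_ * Z]/(_ *m Z) posdef_mulVmx // mulr1.
rewrite -[_ * (s^-1 *: X)]/(_ *m (s^-1 *: X)) -scalemxAr mxtraceZ mulmxE.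
rewrite gerBl pmulr_rge0 ?ltr0n // subr_ge0 => h.
by rewrite -ler_pdivlMl.
Qed.

(** The stuck alternative retains [no_swap], because this is what makes it persist: a later round
    can only return the same set. *)
Lemma descent_step z z' eps (K : R) p :
  0 < eps -> eps < 1 -> (0 < p)%N -> 0 < K -> K <= n%:R ->
  16 * p%:R * d%:R <= K * (eps / 200) ->
  \sum_i x i <= K -> \sum_i bvec R z i = K -> posdef (Zmx z) ->
  let rho := eps / (16 * n%:R) in
  let B := eps / 8 / d%:R in
  let N := invmx (Zmx z) in
  exchange z z' (score N p 1 B z) (lev N) (16 * p%:R) rho ->
  posdef (Zmx z') /\
  (potential p B (Zmx z') <= potential p B (Zmx z) - rho \/
   [/\ z' = z, no_swap z (score N p 1 B z) (lev N) (16 * p%:R) rho &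
     \tr (N ^+ p) <= (1 + eps) ^+ p * \tr (invmx X ^+ p)]).
Proof.
move=> e0 e1 p0 K0 Kn hK sx sz pZ rho B N.
have n0 : 0 < n%:R :> R by lra.
have p1 : 1 <= p%:R :> R by rewrite ler1n.
have pp0 : 0 < p%:R :> R by rewrite ltr0n.
have rho0 : 0 <= rho by rewrite divr_ge0 ?mulr_ge0 // ltW.
have B0 : 0 <= B by rewrite !divr_ge0 // ltW.
have t0 i : 0 <= lev N i by exact: lev_ge0.
have s0 i : 0 <= sens N i by exact: sens_ge0.
have m0 i : 0 <= mom N (v i) p by exact/mom_ge0/posdef_inv.
have f0 : 0 < \tr (N ^+ p) by exact: tr_expr_gt0.
have scE i : score N p 1 B z i = mom N (v i) p / \tr (N ^+ p) + B * sens N i.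
  by rewrite /score sum_z_mom // mul1r.
have sc0 i : 0 <= score N p 1 B z i.
  by rewrite scE; apply: addr_ge0; [apply: divr_ge0 (ltW f0)|exact: mulr_ge0].
case=> [[-> ns]|[i [j [zi ti zj hr ->]]]]; last first.
  have c2 : 2 <= 16 * p%:R :> R by lra.
  have ti2 : 2 * bform (invmx (Zmx z)) (v i) (v i) < 1.
    by have := t0 i; rewrite -/(lev N i) => ?; have := ler_wpM2r (t0 i) c2; lra.
  have EZ := design_swap v zi zj.
  have pZ' : posdef (Zmx (swap z i j)) by rewrite EZ; exact: posdef_swap.
  split=> //; left.
  have w1 := tr_weight_swap (v j) gX pZ ti2.
  have w2 := lossW c2 (t0 i) ti (s0 i).
  have w3 := gainW c2 (t0 j) (s0 j).
  (* The exchanged matrix is again the design matrix of a set, which supplies the factor required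
     for the tangent at the midpoint. *)
  have gZ' : gram (Zmx z - v i *m (v i)^T + v j *m (v j)^T) by rewrite -EZ.
  have := @tr_inv_swap R d (Zmx z) (v i) (v j) p pZ (gZ z) p0.
  rewrite !mom0 -/(lev N i) -/(lev N j) => /(_ ti gZ').
  rewrite -!EZ in w1 *; rewrite -/N -!/(sens N _) -!/(lev N _) in w1 *.
  set f' := \tr (invmx (Zmx (swap z i j)) ^+ p); set f := \tr (N ^+ p) in f0 *.
  have f'0 : 0 < f' by exact: tr_expr_gt0.
  move=> hf; rewrite /potential -/f' -/N -/f.
  (* Concavity of the logarithm: the bound on f' - f, divided by p f, is exactly a difference of
     [loss] and [gain]. *)
  have l1 := ln_sub_le f0 f'0.
  have l2 : (ln f' - ln f) / p%:R <=
    loss (16 * p%:R) (fun i => mom N (v i) p / f) (lev N) i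
    - gain (16 * p%:R) (fun i => mom N (v i) p / f) (lev N) j.
    rewrite ler_pdivrMr //; apply: (le_trans l1); rewrite ler_pdivrMr //.
    have -> : (loss (16 * p%:R) (fun i => mom N (v i) p / f) (lev N) i
      - gain (16 * p%:R) (fun i => mom N (v i) p / f) (lev N) j) * p%:R * f
      = p%:R * mom N (v i) p / (1 - 16 * p%:R * lev N i)
        - p%:R * mom N (v j) p / (1 + 16 * p%:R * lev N j).
      have d2 : 0 < 1 + 16 * p%:R * lev N j by have := mulr_ge0 (ltW pp0) (t0 j); lra.
      by rewrite /loss /gain; field; rewrite !gt_eqF //; lra.
    by lra.
  have l3 : gain (16 * p%:R) (score N p 1 B z) (lev N) j
     - loss (16 * p%:R) (score N p 1 B z) (lev N) i
    = gain (16 * p%:R) (fun i => mom N (v i) p / f) (lev N) j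
     - loss (16 * p%:R) (fun i => mom N (v i) p / f) (lev N) i
     + B * (gain (16 * p%:R) (sens N) (lev N) j - loss (16 * p%:R) (sens N) (lev N) i).
    by rewrite /gain /loss !scE -/f; ring.
  have l4 := ler_wpM2l B0 w1; have l5 := ler_wpM2l B0 w2; have l6 := ler_wpM2l B0 w3.
  move: l2 l3 l4 l5 l6 hr; rewrite mulrBl.
  set g1 := gain _ _ _ _; set g2 := gain _ _ _ _; set g3 := gain _ _ _ _.
  set h1 := loss _ _ _ _; set h2 := loss _ _ _ _; set h3 := loss _ _ _ _.
  set a1 := sens N i / _; set a2 := sens N j / _.
  by move=> *; lra.
split=> //; right; split=> //.
have tz : \sum_i bvec R z i * lev N i = d%:R.
  by have := @sum_z_lev z 0; rewrite shifted0 mul0r addr0; exact.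
have phi0 : 0 <= \tr (X * N).
  by rewrite -sum_x_lev; apply: sumr_ge0 => i _; rewrite mulr_ge0.
have gz : \sum_i bvec R z i * score N p 1 B z i = 1 + B * \tr (X * N).
  have := @sum_z_sens z 0; rewrite /= shifted0 mul0r addr0 => /(_ pZ) <-.
  rewrite -[X in _ = X + _](divff (lt0r_neq0 f0)) -[X in X / _ + _](sum_z_mom p pZ).
  rewrite mulr_suml mulr_sumr -big_split /=.
  by apply: eq_bigr => i _; rewrite scE; ring.
have gx : \sum_i x i * score N p 1 B z i
    = \tr (N ^+ p.+1 * X) / \tr (N ^+ p) + B * \tr (N * X * N * X).
  rewrite -sum_x_mom -sum_x_sens mulr_suml mulr_sumr -big_split /=.
  by apply: eq_bigr => i _; rewrite scE; ring.
have cb : 16 * p%:R * d%:R < K.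
  by apply: (le_lt_trans hK); rewrite gtr_pMr //; lra.
have := @selection R n z x (score N p 1 B z) (lev N) (16 * p%:R) rho K sc0 t0 _ rho0 x01 sx sz.
rewrite tz => /(_ (mulr_ge0 (ler0n _ 16) (ltW pp0)) cb ns).
rewrite gz gx sum_x_lev => hsel.
have fX : 0 < \tr (invmx X ^+ p) by exact: tr_expr_gt0.
(* The p-th root of the quotient of the traces, that is Phi_p(Z) / Phi_p(X). *)
set s := expR ((ln (\tr (N ^+ p)) - ln (\tr (invmx X ^+ p))) / p%:R).
have hs : s ^+ p * \tr (invmx X ^+ p) = \tr (N ^+ p).
  rewrite -expRM_natl [p%:R * _]mulrC divfK ?gt_eqF //.
  by rewrite expRB !lnK ?posrE // divfK // gt_eqF.
have sp : 0 < s by exact: expR_gt0.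
have hol := objective_holder pZ p0 sp hs.
rewrite -/N -ler_pdivlMr // in hol.
have hq := tr_square_ge pX gX pZ; rewrite -/N in hq.
rewrite -hs ler_pM2r //; apply: lerXn2r; rewrite ?nnegrE ?(ltW sp) //; first by lra.
set t := \tr (X * N) / d%:R.
have tE : \tr (X * N) = d%:R * t by rewrite /t mulrC divfK // gt_eqF.
have BE : B * \tr (X * N) = eps / 8 * t by rewrite /B tE; field; rewrite gt_eqF.
apply: (@descent_arith R s (\tr (N ^+ p.+1 * X) / \tr (N ^+ p) + B * \tr (N * X * N * X))
  t eps d%:R K (16 * p%:R) rho) => //.
- by rewrite /t divr_ge0 // ltW.
- rewrite /rho (_ : _ * K = eps / 16 * (K / n%:R)); last by field; rewrite gt_eqF.
  by rewrite ler_piMr ?ler_pdivrMr ?mul1r // divr_ge0 // ltW.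
- apply: lerD => //.
  rewrite (_ : eps / 8 * t ^+ 2 = B * (d%:R * t ^+ 2)); last first.
    by rewrite /B; field; rewrite gt_eqF.
  rewrite ler_wpM2l // -(ler_pM2l d1); apply: le_trans hq; rewrite tE; lra.
- by rewrite -BE -tE.
Qed.

End LocalSearch.

(** * Loops *)

Section Loops.
Variable R : realType.
Implicit Types (s : state R) (c : prog) (m : bool) (r a : nat).

Definition frame c s s1 : Prop :=
  (forall r, r \notin iwrites c -> ireg s1 r = ireg s r) /\
  (forall a, a \notin rwrites c -> rmem s1 a = rmem s a).

(** P must be insensitive to the counter, which the loop writes before the first round and after
    each one; [frame] gives the body access to everything the loop leaves alone. *)
Lemma for_ind r m c s (P : nat -> state R -> Prop) :
  r \notin iwrites c ->
  (forall q s1 y, P q s1 -> P q (set_ireg s1 r y)) ->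
  P 0%N s ->
  (forall q s1, (q < ireg s m)%N -> ireg s1 r = q -> frame (PFor r m c) s s1 ->
    P q s1 -> P q.+1 (den c s1)) ->
  P (ireg s m) (den (PFor r m c) s).
Proof.
move=> rc stab P0 PS /=.
set F := fun q s' => _; set s0 := set_ireg s r 0.
suff H q : (q <= ireg s m)%N -> [/\ ireg (iteri q F s0) r = q,
    frame (PFor r m c) s (iteri q F s0) & P q (iteri q F s0)].
  by have [] := H _ (leqnn _).
elim: q => [|q IHq] hq.
  split; [by rewrite /= eqxx| |exact: stab].
  by split=> [r'|a] //=; rewrite inE => /norP[/negPf ->].
have [e1 [e2 e3] e4] := IHq (ltnW hq); rewrite /= /F.
split; [by rewrite /= eqxx| |by apply: stab; exact: PS].
split=> [r' h|a h] /=.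
  by have := h; rewrite inE => /norP[/negPf -> h']; rewrite den_ireg // e2.
by rewrite den_rmem // e3.
Qed.

Definition PSum a (ei : iexpr) r m (e : rexpr) : prog :=
  PSeq (PRSet a ei (ICst 0) (RNat (ICst 0)))
    (PFor r m (PRSet a ei (ICst 0) (RAdd (RGet a ei (ICst 0)) e))).

(** The summand may not depend on the array receiving the sum, as that array holds the partial sums
    meanwhile. *)
Lemma PSumE a ei r m e s (g : nat -> R) :
  (forall s1, (forall r', r' != r -> ireg s1 r' = ireg s r') ->
     (ieval s1 ei = ieval s ei)) ->
  (forall s1, (forall r', r' != r -> ireg s1 r' = ireg s r') ->
     (forall a', a' != a -> rmem s1 a' = rmem s a') ->
     (ireg s1 r < ireg s m)%N -> reval s1 e = g (ireg s1 r)) ->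
  rmem (den (PSum a ei r m e) s) a = fun i j =>
    if (i == ieval s ei) && (j == 0%N) then \sum_(q < ireg s m) g q else rmem s a i j.
Proof.
move=> hei he; set s0 := set_rmem s a (ieval s ei) 0 0.
pose P q (s1 : state R) := rmem s1 a = fun i j =>
    if (i == ieval s ei) && (j == 0%N) then \sum_(l < q) g l else rmem s a i j.
have := @for_ind r m (PRSet a ei (ICst 0) (RAdd (RGet a ei (ICst 0)) e)) s0 P isT.
apply=> //.
  apply/funext => i; apply/funext => j; rewrite /= eqxx /= big_ord0.
  by [].
move=> q s1 hq rq [f1 f2] Pq; apply/funext => i; apply/funext => j /=.
have f1' r' : r' != r -> ireg s1 r' = ireg s r'.
  by move=> h; apply: f1; rewrite inE.
have f2' a' : a' != a -> rmem s1 a' = rmem s a'.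
  move=> h; rewrite f2; last by rewrite /= inE.
  by rewrite /s0 /set_rmem /=; apply/funext => i'; apply/funext => j'; rewrite (negPf h).
rewrite eqxx hei //= Pq !eqxx /=.
case: (_ && _) => //; rewrite big_ord_recr /=; congr (_ + _).
by rewrite he // rq.
Qed.

(** [g] receives the old entry, so updates in place are covered: each entry is written once and has
    its initial value until then. *)
Lemma fill_mxE a r m (r2 : nat) (m2 : bool) e s (g : nat -> nat -> R -> R) : r != r2 -> r2 != m :> nat ->
  r2 != m2 :> nat -> r != m2 :> nat ->
  (forall s1, (forall r', r' != r -> r' != r2 -> ireg s1 r' = ireg s r') ->
     (forall a', a' != a -> rmem s1 a' = rmem s a') ->
     reval s1 e = g (ireg s1 r) (ireg s1 r2) (rmem s1 a (ireg s1 r) (ireg s1 r2))) ->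
  forall i j, (i < ireg s m)%N -> (j < ireg s m2)%N ->
  rmem (den (PFor r m (PFor r2 m2 (PRSet a (IVar r) (IVar r2) e))) s) a i j
  = g i j (rmem s a i j).
Proof.
move=> rr2 r2m r2m2 rm2 he i j hi hj.
pose P q (s1 : state R) := forall i j, (j < ireg s m2)%N -> rmem s1 a i j =
  if (i < q)%N then g i j (rmem s a i j) else rmem s a i j.
suff H : P (ireg s m) (den (PFor r m (PFor r2 m2 (PRSet a (IVar r) (IVar r2) e))) s).
  by rewrite H // hi.
apply: for_ind => //; first by rewrite /= inE.
move=> q s1 hq rq [f1 f2] Pq.
have f1' r' : r' != r -> r' != r2 -> ireg s1 r' = ireg s r'.
  by move=> h h'; apply: f1; rewrite /= !inE negb_or h.
pose Q t (s2 : state R) := forall i j, (j < ireg s m2)%N -> rmem s2 a i j =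
  if (i < q)%N || ((i == q) && (j < t)%N) then g i j (rmem s a i j) else rmem s a i j.
have em2 : ireg s1 m2 = ireg s m2 by rewrite f1' // eq_sym.
have H : Q (ireg s m2) (den (PFor r2 m2 (PRSet a (IVar r) (IVar r2) e)) s1).
  rewrite -em2; apply: for_ind => //.
    by move=> i' j' hj'; rewrite Pq // ltn0 andbF orbF.
  move=> t s2 ht r2t [h1 h2] Qt i' j' hj' /=.
  have rs2 : ireg s2 r = q by rewrite h1 ?rq // inE.
  rewrite eqxx rs2 r2t /=; case: eqVneq => [->|ni] /=; last by rewrite Qt // (negPf ni).
  have [->|nj] := eqVneq j' t; last first.
    by rewrite Qt // eqxx !ltnn [in RHS]ltnS [in RHS]leq_eqVlt (negPf nj).
  rewrite ltnn ltnSn /= he.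
  - by rewrite rs2 r2t Qt ?eqxx ?ltnn // -em2.
  - by move=> r' h h'; rewrite h1 ?inE // f1'.
  - by move=> a' h; rewrite h2 ?inE //= f2 //= inE.
by move=> i' j' hj'; rewrite H // hj' andbT ltnS [in RHS]leq_eqVlt orbC.
Qed.

End Loops.

(** * The algorithm *)

Definition I0 := ICst 0.
Definition cell (a : nat) := RGet a I0 I0.
Definition entry (a r : nat) := RGet a (IVar r) I0.
Definition assign (a : nat) (e : rexpr) := PRSet a I0 I0 e.
Definition lit (m : nat) := RNat (ICst m).

(* Registers: 0-3 hold n, d, k, p; 4-11 are loop counters; 12, 14 record whether
   a removable and an addable index have been found, and 13, 15 hold the best
   ones.  Arrays: 3 the current 0/1 vector, 4 the matrix N, 5 and 6 vectors of
   length d, 7 a temporary, 8 the leverages, 9 the sensitivities, 10 the moments,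
   11 the trace, 12-16 the parameters l, omega, beta, c, rho, 17 the coefficient
   of a rank-one update, 18 and 19 the best loss and gain, 20 the accuracy e. *)

Definition matvec (dst src : nat) : prog :=
  PFor 8 true (PSum dst (IVar 8) 9 true
    (RMul (RGet 4 (IVar 8) (IVar 9)) (entry src 9))).

Definition row_dot (a : nat) (ei : iexpr) (r src : nat) : prog :=
  PSum a ei 8 true (RMul (RGet 0 (IVar r) (IVar 8)) (entry src 8)).

(* 1 - |i - j| in truncated arithmetic *)
Definition delta (r r' : nat) : rexpr :=
  RNat (ISub (ICst 1) (IAdd (ISub (IVar r) (IVar r')) (ISub (IVar r') (IVar r)))).

Definition load (e : rexpr) : prog := PFor 8 true (PRSet 5 (IVar 8) I0 e).
Definition load_row : prog := load (RGet 0 (IVar 7) (IVar 8)).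

(** The Sherman-Morrison formula for array 4, with the vector in array 5 and the coefficient in
    array 17. *)
Definition rank1_update : prog :=
  PSeq (matvec 6 5)
  (PSeq (PSum 7 I0 8 true (RMul (entry 5 8) (entry 6 8)))
  (PSeq (assign 17 (RDiv (cell 17) (RAdd (lit 1) (RMul (cell 17) (cell 7)))))
    (PFor 8 true (PFor 9 true (PRSet 4 (IVar 8) (IVar 9)
      (RSub (RGet 4 (IVar 8) (IVar 9))
            (RMul (RMul (cell 17) (entry 6 8)) (entry 6 9)))))))).

Definition update_with (e c : rexpr) : prog :=
  PSeq (load e) (PSeq (assign 17 c) rank1_update).

(** From the identity, the updates add z_i v_i v_i^T, then - l x_i v_i v_i^T, and finally - e_i
    e_i^T, which takes the identity away again. In this order all intermediate matrices are positive
    definite whenever the last one is, so no denominator vanishes. *)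
Definition invert : prog :=
  PSeq (PFor 8 true (PFor 9 true (PRSet 4 (IVar 8) (IVar 9) (delta 8 9))))
  (PSeq (PFor 7 false (update_with (RGet 0 (IVar 7) (IVar 8)) (entry 3 7)))
  (PSeq (PFor 7 false (update_with (RGet 0 (IVar 7) (IVar 8))
                         (RSub (lit 0) (RMul (cell 12) (entry 1 7)))))
    (PFor 7 true (update_with (delta 7 8) (RSub (lit 0) (lit 1)))))).

(** The sensitivity is computed as the sum of x_j (v_j^T N v_i)^2. The power loop makes n rounds, of
    which those with counter at most p multiply by N; it ends with N^(p+1) v_i exactly when p <
    n. *)
Definition measure_row : prog :=
  PSeq load_row
  (PSeq (matvec 6 5)
  (PSeq (row_dot 8 (IVar 7) 7 6)
  (PSeq (PRSet 9 (IVar 7) I0 (lit 0))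
  (PSeq (PFor 10 false (PSeq (row_dot 7 I0 10 6)
           (PRSet 9 (IVar 7) I0 (RAdd (entry 9 7)
              (RMul (entry 1 10) (RMul (cell 7) (cell 7)))))))
  (PSeq (PFor 11 false (PIf (BILe (IVar 11) (IVar 3))
           (PSeq (matvec 6 5) (load (entry 6 8))) PSkip))
    (row_dot 10 (IVar 7) 7 5)))))).

Definition measure_all : prog :=
  PSeq (PFor 7 false measure_row)
    (PSum 11 I0 7 false (RMul (entry 3 7) (entry 10 7))).

Definition scan_row : prog :=
  PSeq (assign 7 (RAdd (RDiv (RMul (cell 13) (entry 10 7)) (cell 11))
                       (RMul (cell 14) (entry 9 7))))
  (PIf (BRLe (entry 3 7) (lit 0))
    (PSeq (assign 7 (RDiv (cell 7) (RAdd (lit 1) (RMul (cell 15) (entry 8 7)))))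
      (PIf (BAnd (BILe (ICst 1) (IVar 14)) (BRLe (cell 7) (cell 19))) PSkip
        (PSeq (assign 19 (cell 7)) (PSeq (PISet 15 (IVar 7)) (PISet 14 (ICst 1))))))
    (PIf (BRLe (lit 1) (RMul (cell 15) (entry 8 7))) PSkip
      (PSeq (assign 7 (RDiv (cell 7) (RSub (lit 1) (RMul (cell 15) (entry 8 7)))))
        (PIf (BAnd (BILe (ICst 1) (IVar 12)) (BRLe (cell 18) (cell 7))) PSkip
          (PSeq (assign 18 (cell 7)) (PSeq (PISet 13 (IVar 7)) (PISet 12 (ICst 1)))))))).

Definition scan : prog :=
  PSeq (PISet 12 I0) (PSeq (PISet 14 I0) (PFor 7 false scan_row)).

Definition swap_best : prog :=
  PIf (BAnd (BAnd (BILe (ICst 1) (IVar 12)) (BILe (ICst 1) (IVar 14)))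
            (BRLe (cell 16) (RSub (cell 19) (cell 18))))
    (PSeq (PRSet 3 (IVar 13) I0 (lit 0)) (PRSet 3 (IVar 15) I0 (lit 1)))
    PSkip.

Definition iteration : prog :=
  PSeq invert (PSeq measure_all (PSeq scan swap_best)).

(** The n^2 rounds match the thresholds rho: as many gains exceed the range of either potential. *)
Definition iterations : prog := PFor 5 false (PFor 6 false iteration).

Definition set_params (l om be c rho : rexpr) : prog :=
  PSeq (assign 12 l) (PSeq (assign 13 om) (PSeq (assign 14 be)
    (PSeq (assign 15 c) (assign 16 rho)))).

Definition start : prog :=
  PSeq (PFor 7 false (PIf (BILe (IAdd (IVar 7) (ICst 1)) (IVar 2))
          (PRSet 3 (IVar 7) I0 (lit 1)) (PRSet 3 (IVar 7) I0 (lit 0))))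
    (PIf (BRLe (lit 1) (RMul (RNat (IVar 3)) (cell 2)))
      (assign 20 (RDiv (cell 2) (lit 4)))
      (assign 20 (RDiv (lit 1) (lit 4)))).

Definition barrier_phase : prog :=
  PSeq (set_params (RSub (lit 0) (cell 20)) (lit 0) (lit 1) (lit 16)
          (RDiv (RNat (IVar 1))
             (RMul (RMul (lit 8) (cell 20)) (RNat (IVar 0)))))
    (PFor 4 false (PSeq iterations
       (PIf (BRLe (cell 12) (RSub (lit 1) (RMul (lit 2) (cell 20))))
          (assign 12 (RAdd (cell 12)
             (RDiv (cell 20) (RMul (lit 4) (RNat (IVar 1))))))
          PSkip))).

Definition descent_phase : prog :=
  PIf (BRLe (lit 1) (RMul (RNat (IVar 3)) (cell 2))) PSkip
    (PSeq (set_params (lit 0) (lit 1)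
             (RDiv (RDiv (cell 2) (lit 8)) (RNat (IVar 1)))
             (RMul (lit 16) (RNat (IVar 3)))
             (RDiv (cell 2) (RMul (lit 16) (RNat (IVar 0)))))
       iterations).

Definition rounding : prog := PSeq start (PSeq barrier_phase descent_phase).

Lemma rounding_wf : wf rounding. Proof. by []. Qed.

Definition read_only (c : prog) : bool :=
  all (fun r => r \notin iwrites c) [:: 0; 1; 2; 3]%N
  && all (fun a => a \notin rwrites c) [:: 0; 1; 2]%N.

(** * Correctness of the program blocks *)

Section Blocks.
Variables (R : realType) (n d : nat) (w : input R n d).
Implicit Types (s : state R) (c : prog).

#[local] Arguments den : simpl never.

Lemma denS c1 c2 s : den (PSeq c1 c2) s = den c2 (den c1 s). Proof. by []. Qed.
Lemma denR a e1 e2 e s :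
  den (PRSet a e1 e2 e) s = set_rmem s a (ieval s e1) (ieval s e2) (reval s e).
Proof. by []. Qed.
Lemma denI r e s : den (PISet r e) s = set_ireg s r (ieval s e). Proof. by []. Qed.
Lemma denIf b c1 c2 s :
  den (PIf b c1 c2) s = if beval s b then den c1 s else den c2 s.
Proof. by []. Qed.

Local Notation v := (vecs w).
Local Notation x := (frac_sol w).

Definition holds_input s : Prop :=
  (forall r, (r < 4)%N -> ireg s r = ireg (init_state w) r) /\
  (forall a, (a < 3)%N -> rmem s a = rmem (init_state w) a).

Lemma holds_input_den c s : read_only c -> holds_input s -> holds_input (den c s).
Proof.
move=> /andP[/allP h1 /allP h2] [i1 i2]; split=> [r hr|a ha].
  by rewrite den_ireg ?i1 //; apply: h1; move: r hr => [|[|[|[|]]]].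
by rewrite den_rmem ?i2 //; apply: h2; move: a ha => [|[|[|]]].
Qed.

Lemma holds_input_frame c s s1 : read_only c -> frame c s s1 ->
  holds_input s -> holds_input s1.
Proof.
move=> /andP[/allP h1 /allP h2] [f1 f2] [i1 i2]; split=> [r hr|a ha].
  by rewrite f1 ?i1 //; apply: h1; move: r hr => [|[|[|[|]]]].
by rewrite f2 ?i2 //; apply: h2; move: a ha => [|[|[|]]].
Qed.

Lemma input_n s : holds_input s -> ireg s 0 = n. Proof. by case=> ->. Qed.
Lemma input_d s : holds_input s -> ireg s 1 = d. Proof. by case=> ->. Qed.
Lemma input_k s : holds_input s -> ireg s 2 = budget w. Proof. by case=> ->. Qed.
Lemma input_p s : holds_input s -> ireg s 3 = norm_exp w. Proof. by case=> ->. Qed.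

Lemma input_v s (i : 'I_n) (j : 'I_d) : holds_input s -> rmem s 0 i j = v i j 0.
Proof. by case=> _ ->//=; rewrite !valK. Qed.

Lemma input_x s (i : 'I_n) : holds_input s -> rmem s 1 i 0 = x i.
Proof. by case=> _ ->//=; rewrite valK. Qed.

Lemma input_eps s : holds_input s -> rmem s 2 0 0 = accuracy w.
Proof. by case=> _ ->. Qed.

Definition vec_at s a : 'cV[R]_d := \col_i rmem s a i 0.
Definition mat_at s : 'M[R]_d := \matrix_(i, j) rmem s 4 i j.

Lemma matvecE s dst src : ireg s 1 = d -> dst != src -> dst != 4%N ->
  vec_at (den (matvec dst src) s) dst = mat_at s *m vec_at s src.
Proof.
move=> hd ds d4; apply/matrixP => i j; rewrite !mxE !ord1 {j}.
pose P q (s1 : state R) := forall i, (i < q)%N ->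
  rmem s1 dst i 0 = \sum_(b < d) rmem s 4 i b * rmem s src b 0.
suff : P (ireg s 1) (den (matvec dst src) s).
  by rewrite hd => -> //; apply: eq_bigr => b _; rewrite !mxE.
apply: (@for_ind R 8 true _ s P) => //.
move=> q s1 hq rq [f1 f2] IH i'; rewrite ltnS => hi'.
have f2' a : a != dst -> rmem s1 a = rmem s a.
  by move=> h; rewrite f2 //= !inE negb_or h.
have d1 : ireg s1 1 = d by rewrite f1.
rewrite (@PSumE R dst (IVar 8) 9 true _ s1 (fun b => rmem s 4 q b * rmem s src b 0)) /=.
- rewrite rq d1 andbT; case: eqVneq => [->//|ne].
  by apply: IH; rewrite ltn_neqAle ne.
- by move=> s2 ->.
- move=> s2 h1 h2 _; rewrite h1 // rq !h2 //; [|by rewrite eq_sym..].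
  by rewrite !f2' // eq_sym.
Qed.

Lemma row_dotE s a ei r src (i : 'I_n) : holds_input s -> ireg s r = i ->
  (forall s1, (forall r', r' != 8%N -> ireg s1 r' = ireg s r') ->
     (ieval s1 ei = ieval s ei)) ->
  r != 8%N -> a != 0%N -> a != src ->
  rmem (den (row_dot a ei r src) s) a = fun i' j =>
    if (i' == ieval s ei) && (j == 0%N) then bform 1 (v i) (vec_at s src) else rmem s a i' j.
Proof.
move=> hs hr hei r8 a0 asrc; have hd := input_d hs.
rewrite (@PSumE R a ei 8 true _ s (fun b => rmem s 0 i b * rmem s src b 0)) //=.
- apply/funext => i'; apply/funext => j; rewrite hd; case: ifP => // _.
  rewrite /bform mulmx1 mxE; apply: eq_bigr => b _; rewrite !mxE input_v //.
- move=> s2 h1 h2 _; rewrite h1 // hr !h2 //; by rewrite eq_sym.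
Qed.

Lemma loadE s e (u : 'cV[R]_d) : ireg s 1 = d ->
  (forall s1, (forall r', r' != 8%N -> ireg s1 r' = ireg s r') ->
     (forall a', a' != 5%N -> rmem s1 a' = rmem s a') ->
     forall j : 'I_d, ireg s1 8 = j -> reval s1 e = u j 0) ->
  vec_at (den (load e) s) 5 = u.
Proof.
move=> hd he; apply/matrixP => i j; rewrite !mxE !ord1 {j}.
pose g m := if insub m is Some j then u j 0 else 0 : R.
have -> : u i 0 = g i by rewrite /g valK.
suff H : forall i, (i < ireg s 1)%N -> rmem (den (load e) s) 5 i 0 = g i.
  by apply: H; rewrite hd.
apply: (@for_ind R 8 true _ s (fun q s1 => forall i, (i < q)%N -> rmem s1 5 i 0 = g i)) => //.
move=> q s1 hq rq [f1 f2] IH i'; rewrite ltnS leq_eqVlt => /orP[/eqP ->|iq]; rewrite denR /=; last first.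
  by rewrite rq (ltn_eqF iq) /=; exact: IH.
rewrite rq eqxx /=; rewrite hd in hq; rewrite (he _ _ _ (Ordinal hq)) //.
- by rewrite /g insubT /=.
- by move=> r' h; apply: f1; rewrite /= !inE.
- by move=> a' h; apply: f2; rewrite /= !inE.
Qed.

Lemma rank1_updateE s : ireg s 1 = d ->
  let N := mat_at s in let u := vec_at s 5 in let c := rmem s 17 0 0 in
  mat_at (den rank1_update s)
  = N - (c / (1 + c * bform N u u)) *: ((N *m u) *m (N *m u)^T).
Proof.
move=> hd N u c; rewrite /rank1_update 3!denS.
set s1 := den (matvec 6 5) s.
have y1 : vec_at s1 6 = N *m u by exact: matvecE.
set s2 := den (PSum _ _ _ _ _) s1.
have e7 : rmem s2 7 0 0 = bform N u u.
  rewrite /s2 (@PSumE R 7 I0 8 true _ s1 (fun b => rmem s1 5 b 0 * rmem s1 6 b 0)) //=.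
    rewrite den_ireg // hd /bform -mulmxA mxE; apply: eq_bigr => b _.
    by rewrite -y1 !mxE /s1 den_rmem.
  by move=> s3 h1 h2 _; rewrite !h2.
have y2 : vec_at s2 6 = N *m u by rewrite -y1; apply/matrixP => i j; rewrite !mxE /s2 den_rmem.
rewrite denR; set s3 := set_rmem s2 17 _ _ _.
apply/matrixP => i j; rewrite !mxE.
rewrite (@fill_mxE R 4 8 true 9 true _ s3
  (fun i j m => m - rmem s3 17 0 0 * rmem s3 6 i 0 * rmem s3 6 j 0)) //.
- rewrite /s3 /= den_rmem // -!mulrA; congr (_ - _); first by rewrite /s1 den_rmem.
  have ye (b : 'I_d) : rmem s2 6 b 0 = \sum_a N b a * u a 0.
    by have := congr1 (fun f : 'cV_d => f b 0) y2; rewrite !mxE.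
  rewrite !ye e7 [rmem s2 17]den_rmem // [rmem s1 17]den_rmem // big_ord1 !mxE.
  by rewrite !mulrA.
- by move=> s4 h1 h2; rewrite -(h2 17%N) // -(h2 6%N).
- by rewrite /s3 /= [ireg s2 1]den_ireg // den_ireg // hd.
- by rewrite /s3 /= [ireg s2 1]den_ireg // den_ireg // hd.
Qed.

End Blocks.

(** * Inversion by rank-one updates *)

Section PartialSums.
Variables (R : realType) (d m : nat) (F : 'I_m -> 'M[R]_d).

Definition partial_sum (q : nat) : 'M[R]_d := \sum_(i < m | (i < q)%N) F i.

Lemma partial_sum0 : partial_sum 0 = 0.
Proof. by rewrite /partial_sum big_pred0. Qed.

Lemma partial_sum_full : partial_sum m = \sum_i F i.
Proof. by apply: eq_bigl => i; rewrite ltn_ord. Qed.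

Lemma partial_sumS (i : 'I_m) : partial_sum i.+1 = partial_sum i + F i.
Proof.
rewrite /partial_sum (bigD1 i) //= addrC; congr (_ + _).
by apply: eq_bigl => j; rewrite ltnS ltn_neqAle andbC.
Qed.

Lemma partial_sum_rest q :
  \sum_i F i = partial_sum q + \sum_(i < m | ~~ (i < q)%N) F i.
Proof. by rewrite (bigID (fun i : 'I_m => (i < q)%N)). Qed.

End PartialSums.

Lemma psd_sum (R : realType) (d m : nat) (P : pred 'I_m) (c : 'I_m -> R) (u : 'I_m -> 'cV[R]_d) :
  (forall i, 0 <= c i) -> psd (\sum_(i | P i) c i *: (u i *m (u i)^T)).
Proof.
move=> c0; elim/big_rec: _ => [|i A _ pA]; first exact: psd0.
by apply: psdD => //; apply/psdZ/gram_psd/gram_rank1.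
Qed.

Section Invert.
Variables (R : realType) (n d : nat) (w : input R n d).
Implicit Types (s : state R) (z : 'I_n -> bool).

#[local] Arguments den : simpl never.

Local Notation v := (vecs w).
Local Notation x := (frac_sol w).

Definition holds_z s z : Prop := forall i : 'I_n, rmem s 3 i 0 = (z i)%:R.

Lemma update_withE s e ce (A : 'M[R]_d) (u : 'cV[R]_d) c :
  holds_input w s ->
  (forall s1, (forall r', r' != 8%N -> ireg s1 r' = ireg s r') ->
     (forall a', a' != 5%N -> rmem s1 a' = rmem s a') ->
     forall j : 'I_d, ireg s1 8 = j -> reval s1 e = u j 0) ->
  reval (den (load e) s) ce = c ->
  posdef A -> posdef (A + c *: (u *m u^T)) -> mat_at d s = invmx A ->
  mat_at d (den (update_with e ce) s) = invmx (A + c *: (u *m u^T)).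
Proof.
move=> hs he hc pA pB hN; have hd := input_d hs.
rewrite /update_with 2!denS denR hc; set s1 := den (load e) s.
have eN : mat_at d s1 = invmx A.
  by rewrite -hN; apply/matrixP => i j; rewrite !mxE /s1 den_rmem.
rewrite rank1_updateE ?[ireg _ 1]den_ireg //.
have -> : vec_at d (set_rmem s1 17 (ieval s1 I0) (ieval s1 I0) c) 5 = u.
  by rewrite -[RHS](@loadE R d s e u hd he).
have -> : mat_at d (set_rmem s1 17 (ieval s1 I0) (ieval s1 I0) c) = invmx A by exact: eN.
by have [_ ->] := sherman_morrison pA pB erefl.
Qed.

Lemma invertE s z : holds_input w s -> holds_z s z -> (forall i, 0 <= x i) ->
  let M := shifted v x z (rmem s 12 0 0) in
  posdef M -> mat_at d (den invert s) = invmx M.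
Proof.
move=> hs hz x0; set l := rmem s 12 0 0 => M pM.
pose FZ (i : 'I_n) : 'M[R]_d := bvec R z i *: (v i *m (v i)^T).
pose FX (i : 'I_n) : 'M[R]_d := x i *: (v i *m (v i)^T).
pose e_ (i : 'I_d) : 'cV[R]_d := delta_mx i 0.
pose FE (i : 'I_d) : 'M[R]_d := 1 *: (e_ i *m (e_ i)^T).
have FE1 : \sum_i FE i = 1.
  rewrite -[RHS]/(1%:M) mx1_sum_delta; apply: eq_bigr => i _.
  by rewrite /FE /e_ scale1r trmx_delta mul_delta_mx.
have p1 : posdef (1 : 'M[R]_d) by exact: posdef1.
have MZ : M = \sum_i FZ i - l *: \sum_i FX i by [].
pose A1 q := 1 + partial_sum FZ q.
pose A2 q := A1 n - l *: partial_sum FX q.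
pose A3 q := A2 n - partial_sum FE q.
have pA1 q : posdef (A1 q) by apply: posdefD p1 _; apply: psd_sum => i; exact: bvec_ge0.
(* For l >= 0, subtracting only a part of l X leaves 1 + M plus a semidefinite rest; for l < 0 the
   updates add semidefinite matrices. *)
have pA2 q : posdef (A2 q).
  have [l0|l0] := leP 0 l.
    have -> : A2 q = 1 + M + l *: \sum_(i < n | ~~ (i < q)%N) FX i.
      rewrite MZ (partial_sum_rest FX q) /A2 /A1 partial_sum_full scalerDr opprD.
      by rewrite !addrA addrNK.
    by apply: posdefD; [exact/(posdefD p1)/posdef_psd|exact/psdZ/psd_sum].
  rewrite /A2 -scaleNr; apply: posdefD => //; apply/psdZ/psd_sum => //.
  by rewrite oppr_ge0 ltW.
have pA3 q : posdef (A3 q).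
  have -> : A3 q = M + \sum_(i < d | ~~ (i < q)%N) FE i.
    rewrite MZ /A3 /A2 /A1 !partial_sum_full -FE1 (partial_sum_rest FE q).
    by apply/matrixP => i j; rewrite !mxE; ring.
  by apply: posdefD => //; apply: psd_sum => _; exact: ler01.
have A1S (i : 'I_n) : A1 i.+1 = A1 i + bvec R z i *: (v i *m (v i)^T).
  by rewrite /A1 partial_sumS addrA.
have A2S (i : 'I_n) : A2 i.+1 = A2 i + (0 - l * x i) *: (v i *m (v i)^T).
  by rewrite /A2 partial_sumS scalerDr opprD addrA sub0r scaleNr scalerA.
have A3S (i : 'I_d) : A3 i.+1 = A3 i + (0 - 1) *: (e_ i *m (e_ i)^T).
  by rewrite /A3 partial_sumS opprD addrA sub0r scaleNr.
rewrite /invert 3!denS; set s1 := den (PFor 8 true _) s.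
have h1 : holds_input w s1 by exact: holds_input_den.
have m1 : mat_at d s1 = invmx (A1 0%N).
  rewrite /A1 partial_sum0 addr0; have -> : invmx (1 : 'M[R]_d) = 1 by apply: invmx1.
  apply/matrixP => i j; rewrite !mxE.
  rewrite (@fill_mxE R 4 8 true 9 true _ s (fun i j _ => (1 - ((i - j) + (j - i)))%:R)) //.
  - by rewrite -val_eqE /=; congr (_%:R); case: eqVneq; lia.
  - by rewrite (input_d hs).
  - by rewrite (input_d hs).
set s2 := den (PFor 7 false _) s1.
have h2 : holds_input w s2 by exact: holds_input_den.
have m2 : mat_at d s2 = invmx (A1 n).
  rewrite -{1}(input_n h1).
  apply: (@for_ind R 7 false _ s1 (fun q s' => mat_at d s' = invmx (A1 q))) => //.
  move=> q s' hq rq fr IH; have h' : holds_input w s' by exact: holds_input_frame fr h1.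
  rewrite (input_n h1) in hq; pose i := Ordinal hq.
  rewrite (A1S i); apply: update_withE => //.
  - move=> s3 e1 e2 j hj /=; rewrite hj e1 // rq e2 //; exact: (input_v i j h').
  - by rewrite /= den_rmem // den_ireg // rq fr.2 // /s1 den_rmem //; exact: (hz i).
  - by rewrite -A1S.
set s3 := den (PFor 7 false _) s2.
have h3 : holds_input w s3 by exact: holds_input_den.
have m3 : mat_at d s3 = invmx (A2 n).
  rewrite -{1}(input_n h2).
  apply: (@for_ind R 7 false _ s2 (fun q s' => mat_at d s' = invmx (A2 q))) => //.
    by rewrite /A2 partial_sum0 scaler0 subr0.
  move=> q s' hq rq fr IH; have h' : holds_input w s' by exact: holds_input_frame fr h2.
  rewrite (input_n h2) in hq; pose i := Ordinal hq.
  rewrite (A2S i); apply: update_withE => //.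
  - move=> s4 e1 e2 j hj /=; rewrite hj e1 // rq e2 //; exact: (input_v i j h').
  - rewrite /= !den_rmem // den_ireg // rq (input_x i h') fr.2 //.
    by rewrite [rmem s2 12]den_rmem // [rmem s1 12]den_rmem.
  - by rewrite -A2S.
have -> : M = A3 d.
  rewrite MZ /A3 /A2 /A1 !partial_sum_full -FE1.
  by apply/matrixP => i j; rewrite !mxE; ring.
have -> : A3 d = A3 (ireg s3 true) by rewrite (input_d h3).
apply: (@for_ind R 7 true _ s3 (fun q s' => mat_at d s' = invmx (A3 q))) => //.
  by rewrite /A3 partial_sum0 subr0.
move=> q s' hq rq fr IH; have h' : holds_input w s' by exact: holds_input_frame fr h3.
rewrite (input_d h3) in hq; pose i := Ordinal hq.
rewrite (A3S i); apply: update_withE => //.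
- move=> s4 e1 e2 j hj /=; rewrite hj e1 // rq !mxE eqxx andbT.
  by rewrite -val_eqE /=; congr (_%:R); case: eqVneq; lia.
- by rewrite -A3S.
Qed.

End Invert.

(** * Computing leverages, sensitivities and moments *)

Section Iteration.
Variables (R : realType) (n d : nat) (w : input R n d).
Implicit Types (s : state R) (z : 'I_n -> bool).

#[local] Arguments den : simpl never.

Local Notation v := (vecs w).
Local Notation x := (frac_sol w).
Local Notation p := (norm_exp w).

Lemma vec_at_den c s a : a \notin rwrites c -> vec_at d (den c s) a = vec_at d s a.
Proof. by move=> h; apply/matrixP => i j; rewrite !mxE den_rmem. Qed.

Lemma mat_at_den c s : 4%N \notin rwrites c -> mat_at d (den c s) = mat_at d s.
Proof. by move=> h; apply/matrixP => i j; rewrite !mxE den_rmem. Qed.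

Lemma load_rowE s (i : 'I_n) : holds_input w s -> ireg s 7 = i ->
  vec_at d (den load_row s) 5 = v i.
Proof.
move=> hs hi; apply: loadE; first exact: input_d hs.
by move=> s1 e1 e2 j hj /=; rewrite hj e1 // hi e2 //; exact: input_v.
Qed.

Lemma sens_sum N i : N^T = N ->
  sens v x N i = \sum_j x j * bform 1 (v j) (N *m v i) ^+ 2.
Proof.
move=> sN; rewrite /sens bformMr bformMl sN bform_design.
by apply: eq_bigr => j _; rewrite bformC trmx1.
Qed.

Lemma measure_rowE s (i : 'I_n) : holds_input w s -> ireg s 7 = i ->
  (mat_at d s)^T = mat_at d s ->
  let s' := den measure_row s in let N := mat_at d s in
  [/\ rmem s' 8 i 0 = lev v N i, rmem s' 9 i 0 = sens v x N i,
      (p < n)%N -> rmem s' 10 i 0 = mom N (v i) p &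
      forall i', i' != i :> nat -> [/\ rmem s' 8 i' 0 = rmem s 8 i' 0,
        rmem s' 9 i' 0 = rmem s 9 i' 0 & rmem s' 10 i' 0 = rmem s 10 i' 0]].
Proof.
move=> hs hi sN s' N; rewrite {}/s' /measure_row 6!denS.
set s1 := den load_row s; have h1 : holds_input w s1 by exact: holds_input_den.
have i1 : ireg s1 7 = i by rewrite den_ireg.
have u1 : vec_at d s1 5 = v i by exact: load_rowE.
set s2 := den (matvec 6 5) s1; have h2 : holds_input w s2 by exact: holds_input_den.
have i2 : ireg s2 7 = i by rewrite den_ireg.
have y2 : vec_at d s2 6 = N *m v i.
  by rewrite matvecE ?(input_d h1) // u1 mat_at_den.
have u2 : vec_at d s2 5 = v i by rewrite vec_at_den.
set s3 := den (row_dot 8 _ _ _) s2; have h3 : holds_input w s3 by exact: holds_input_den.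
have i3 : ireg s3 7 = i by rewrite den_ireg.
have m8 : rmem s3 8 = fun i' j => if (i' == i) && (j == 0%N) then lev v N i else rmem s 8 i' j.
  rewrite /s3 (@row_dotE R n d w s2 8 (IVar 7) 7 6 i) //=; last by move=> s' ->.
  rewrite y2 i2 -bformMr mul1r [rmem s2 8]den_rmem // [rmem s1 8]den_rmem //.
have y3 : vec_at d s3 6 = N *m v i by rewrite vec_at_den.
have u3 : vec_at d s3 5 = v i by rewrite vec_at_den.
set s4 := den (PRSet _ _ _ _) s3; have h4 : holds_input w s4 by exact: holds_input_den.
have i4 : ireg s4 7 = i by rewrite den_ireg.
have m9 : rmem s4 9 = fun i' j => if (i' == i) && (j == 0%N) then 0 else rmem s 9 i' j.
  rewrite /s4 denR /= i3 [rmem s3 9]den_rmem // [rmem s2 9]den_rmem // [rmem s1 9]den_rmem //.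
have y4 : vec_at d s4 6 = N *m v i by rewrite vec_at_den.
have u4 : vec_at d s4 5 = v i by rewrite vec_at_den.
pose g q := if insub q is Some j then x j * bform 1 (v j) (N *m v i) ^+ 2 else 0 : R.
set s5 := den (PFor 10 _ _) s4; have h5 : holds_input w s5 by exact: holds_input_den.
have i5 : ireg s5 7 = i by rewrite den_ireg.
have m9' : rmem s5 9 = fun i' j =>
    if (i' == i) && (j == 0%N) then \sum_(q < ireg s4 false) g q else rmem s 9 i' j.
  pose P q (s' : state R) := rmem s' 9 = fun i' j =>
    if (i' == i) && (j == 0%N) then \sum_(l < q) g l else rmem s 9 i' j.
  apply: (@for_ind R 10 false _ s4 P) => //; first by rewrite /P m9 big_ord0.
  move=> q s' hq rq fr IH; have h' : holds_input w s' by exact: holds_input_frame fr h4.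
  rewrite (input_n h4) in hq; pose j := Ordinal hq.
  rewrite /P denS denR /=; set D := den _ s'.
  have -> : ireg D 7 = i by rewrite den_ireg // fr.1.
  have -> : ireg D 10 = q by rewrite den_ireg.
  have -> : rmem D 9 = rmem s' 9 by rewrite den_rmem.
  have -> : rmem D 1 = rmem s' 1 by rewrite den_rmem.
  have -> : rmem D 7 0 0 = bform 1 (v j) (N *m v i).
    rewrite /D (@row_dotE R n d w s' 7 I0 10 6 j) //=; congr (bform _ _ _).
    by rewrite -y4; apply/matrixP => a b; rewrite !mxE fr.2.
  rewrite IH; apply/funext => i'; apply/funext => j'; rewrite !eqxx.
  case: (_ && _) => //; rewrite big_ord_recr /=; congr (_ + _).
  by rewrite /g insubT (input_x j h') expr2.
have m9s : \sum_(q < ireg s4 false) g q = sens v x N i.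
  rewrite (input_n h4) sens_sum //; apply: eq_bigr => j _.
  by rewrite /g valK.
have u5 : vec_at d s5 5 = v i by rewrite vec_at_den.
set s6 := den (PFor 11 _ _) s5; have h6 : holds_input w s6 by exact: holds_input_den.
have i6 : ireg s6 7 = i by rewrite den_ireg.
have u6 : vec_at d s6 5 = N ^+ (minn n p.+1) *m v i.
  have -> : minn n p.+1 = minn (ireg s5 false) p.+1 by rewrite (input_n h5).
  apply: (@for_ind R 11 false _ s5
    (fun q s' => vec_at d s' 5 = N ^+ (minn q p.+1) *m v i)) => //.
    by rewrite min0n expr0 u5; exact/esym/mul1mx.
  move=> q s' hq rq fr IH; have h' : holds_input w s' by exact: holds_input_frame fr h5.
  rewrite denIf /= rq (input_p h'); case: leqP => hqp; last first.
    by rewrite IH; congr (_ ^+ _ *m _); lia.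
  rewrite denS; set s6' := den _ s'.
  have hd' := input_d h'.
  have -> : minn q.+1 p.+1 = (minn q p.+1).+1 by lia.
  have y6 : vec_at d s6' 6 = N *m vec_at d s' 5.
    rewrite matvecE //; congr (_ *m _); apply/matrixP => a b; rewrite !mxE fr.2 //.
    by rewrite /s5 !den_rmem.
  rewrite exprS -mulmxE -mulmxA -IH -y6; apply: loadE.
    by rewrite /s6' den_ireg.
  by move=> s7 e1 e2 j hj /=; rewrite hj e2 // mxE.
have m10 : rmem (den (row_dot 10 (IVar 7) 7 5) s6) 10 = fun i' j =>
    if (i' == i) && (j == 0%N) then bform 1 (v i) (N ^+ (minn n p.+1) *m v i)
    else rmem s 10 i' j.
  rewrite (@row_dotE R n d w s6 10 (IVar 7) 7 5 i) //=; last by move=> s' ->.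
  rewrite u6 i6 [rmem s6 10]den_rmem // [rmem s5 10]den_rmem // [rmem s4 10]den_rmem //.
  by rewrite [rmem s3 10]den_rmem // [rmem s2 10]den_rmem // [rmem s1 10]den_rmem.
have M8 : rmem (den (row_dot 10 (IVar 7) 7 5) s6) 8 = rmem s3 8.
  by rewrite den_rmem // [rmem s6 8]den_rmem // [rmem s5 8]den_rmem // [rmem s4 8]den_rmem.
have M9 : rmem (den (row_dot 10 (IVar 7) 7 5) s6) 9 = rmem s5 9.
  by rewrite den_rmem // [rmem s6 9]den_rmem.
rewrite M8 M9 m8 m9' m10 m9s !eqxx /=; split=> //.
- by move=> pn; rewrite (minn_idPr pn) -bformMr mul1r.
- by move=> i' /negPf ->.
Qed.

Lemma measure_allE s z : holds_input w s -> holds_z s z ->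
  (mat_at d s)^T = mat_at d s ->
  let s' := den measure_all s in let N := mat_at d s in
  [/\ forall i : 'I_n, rmem s' 8 i 0 = lev v N i,
      forall i : 'I_n, rmem s' 9 i 0 = sens v x N i,
      (p < n)%N -> forall i : 'I_n, rmem s' 10 i 0 = mom N (v i) p &
      rmem s' 11 0 0 = \sum_(i < n) bvec R z i * rmem s' 10 i 0].
Proof.
move=> hs hz sN s' N; rewrite {}/s' /measure_all denS.
set s1 := den (PFor 7 _ _) s.
have h1 : holds_input w s1 by exact: holds_input_den.
have : forall i : 'I_n, (i < ireg s false)%N ->
  [/\ rmem s1 8 i 0 = lev v N i, rmem s1 9 i 0 = sens v x N i &
      (p < n)%N -> rmem s1 10 i 0 = mom N (v i) p].
  apply: (@for_ind R 7 false _ s (fun q s' => forall i : 'I_n, (i < q)%N ->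
    [/\ rmem s' 8 i 0 = lev v N i, rmem s' 9 i 0 = sens v x N i &
      (p < n)%N -> rmem s' 10 i 0 = mom N (v i) p])) => //.
  move=> q s' hq rq fr IH i; have h' : holds_input w s' by exact: holds_input_frame fr hs.
  rewrite (input_n hs) in hq.
  have eN : mat_at d s' = N by apply/matrixP => a b; rewrite !mxE fr.2.
  have := @measure_rowE s' (Ordinal hq) h' rq; rewrite eN => /(_ sN) /= [a8 a9 a10 ao].
  rewrite ltnS leq_eqVlt => /orP[/eqP iq|iq].
    by have -> : i = Ordinal hq by exact: val_inj.
  have /ao[-> -> ->] : i != q :> nat by rewrite (ltn_eqF iq).
  exact: IH.
have e11 a : a != 11%N -> rmem (den (PSum 11 I0 7 false (RMul (entry 3 7) (entry 10 7))) s1) a = rmem s1 a.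
  by move=> ha; rewrite den_rmem //= !inE negb_or ha.
rewrite (input_n hs) => H; split.
- by move=> i; rewrite e11 //; have [] := H i (ltn_ord i).
- by move=> i; rewrite e11 //; have [] := H i (ltn_ord i).
- by move=> pn i; rewrite e11 //; have [_ _] := H i (ltn_ord i); apply.
rewrite (e11 10%N) // (@PSumE R 11 I0 7 false _ s1 (fun q => rmem s1 3 q 0 * rmem s1 10 q 0)) //=.
  rewrite (input_n h1); apply: eq_bigr => i _.
  by rewrite [rmem s1 3]den_rmem // hz.
by move=> s2 e1 e2 _; rewrite !e2.
Qed.

End Iteration.

(** * Choosing and performing an exchange *)

Section Exchange.
Variables (R : realType) (n d : nat) (w : input R n d).
Implicit Types (s : state R) (z : 'I_n -> bool).

#[local] Arguments den : simpl never.

Local Notation v := (vecs w).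
Local Notation x := (frac_sol w).
Local Notation p := (norm_exp w).

Definition scan_G s (i : 'I_n) : R :=
  rmem s 13 0 0 * rmem s 10 i 0 / rmem s 11 0 0 + rmem s 14 0 0 * rmem s 9 i 0.
Definition scan_t s (i : 'I_n) : R := rmem s 8 i 0.

(** State of a running optimum after the first q indices, with [found] telling whether an eligible
    one has occurred. A reversed [le] turns the minimum into the maximum used for gains. *)
Definition best (q found idx : nat) (val : R) (P : 'I_n -> bool) (f : 'I_n -> R)
    (le : rel R) : Prop :=
  (found = 0%N /\ forall i : 'I_n, (i < q)%N -> ~~ P i) \/
  (found = 1%N /\ exists i0 : 'I_n, [/\ idx = i0, P i0, val = f i0 &
     forall i : 'I_n, (i < q)%N -> P i -> le (f i0) (f i)]).

Lemma best_skip q found idx val P f (le : rel R) (i : 'I_n) : i = q :> nat -> ~~ P i ->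
  best q found idx val P f le -> best q.+1 found idx val P f le.
Proof.
move=> iq nP [[f0 H]|[f1 [i0 [e1 e2 e3 H]]]]; [left|right]; split=> //.
  move=> j; rewrite ltnS leq_eqVlt => /orP[/eqP jq|]; last exact: H.
  by have -> : j = i by apply: val_inj; rewrite /= iq.
exists i0; split=> // j; rewrite ltnS leq_eqVlt => /orP[/eqP jq|]; last exact: H.
have -> : j = i by apply: val_inj; rewrite /= iq.
by rewrite (negPf nP).
Qed.

Lemma best_keep q found idx val P f (le : rel R) (i : 'I_n) : i = q :> nat ->
  (1 <= found)%N -> le val (f i) ->
  best q found idx val P f le -> best q.+1 found idx val P f le.
Proof.
move=> iq fd hle [[f0 H]|[f1 [i0 [e1 e2 e3 H]]]]; first by rewrite f0 in fd.
right; split=> //; exists i0; split=> // j.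
rewrite ltnS leq_eqVlt => /orP[/eqP jq _|]; last exact: H.
by have -> : j = i by [apply: val_inj; rewrite /= iq]; rewrite -e3.
Qed.

Lemma best_replace q found idx val (P : pred 'I_n) f (le : rel R) (i : 'I_n) : i = q :> nat ->
  reflexive le -> transitive le -> total le ->
  P i -> ~~ ((1 <= found)%N && le val (f i)) ->
  best q found idx val P f le -> best q.+1 1 i (f i) P f le.
Proof.
move=> iq rl tl tt Pi nk H; right; split=> //; exists i; split=> // j.
rewrite ltnS leq_eqVlt => /orP[/eqP jq _|jq Pj].
  by have -> : j = i by apply: val_inj; rewrite /= iq.
case: H => [[_ H]|[f1 [i0 [_ _ e3 H]]]]; first by have := H j jq; rewrite Pj.
rewrite f1 e3 /= in nk; have := tt (f i) (f i0); rewrite (negPf nk) orbF.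
by move/tl; apply; exact: H.
Qed.

Lemma scanE s z : holds_input w s -> holds_z s z ->
  let s' := den scan s in let c := rmem s 15 0 0 in
  let G := scan_G s in let t := scan_t s in
  best n (ireg s' 12) (ireg s' 13) (rmem s' 18 0 0)
    (fun i => z i && (c * t i < 1)) (loss c G t) <=%R /\
  best n (ireg s' 14) (ireg s' 15) (rmem s' 19 0 0)
    (fun i => ~~ z i) (gain c G t) (fun a b => b <= a).
Proof.
move=> hs hz s' c G t; rewrite {}/s' /scan 2!denS !denI.
set s1 := set_ireg _ 14 _.
have h1 : holds_input w s1 by exact: (@holds_input_den _ _ _ w (PSeq (PISet 12 I0) (PISet 14 I0)) s).
pose P q (s' : state R) := best q (ireg s' 12) (ireg s' 13) (rmem s' 18 0 0)
    (fun i => z i && (c * t i < 1)) (loss c G t) <=%R /\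
  best q (ireg s' 14) (ireg s' 15) (rmem s' 19 0 0)
    (fun i => ~~ z i) (gain c G t) (fun a b => b <= a).
suff : P (ireg s1 false) (den (PFor 7 false scan_row) s1) by rewrite (input_n h1).
apply: (@for_ind R 7 false _ s1 P) => //; first by split; left.
move=> q s' hq rq fr; have h' : holds_input w s' by exact: holds_input_frame fr h1.
rewrite (input_n h1) in hq; pose i := Ordinal hq.
have iq : i = q :> nat by [].
move=> [IHl IHg].
have f3 : rmem s' 3 = rmem s 3 by rewrite fr.2.
have f8 : rmem s' 8 = rmem s 8 by rewrite fr.2.
have f9 : rmem s' 9 = rmem s 9 by rewrite fr.2.
have f10 : rmem s' 10 = rmem s 10 by rewrite fr.2.
have f11 : rmem s' 11 = rmem s 11 by rewrite fr.2.
have f13 : rmem s' 13 = rmem s 13 by rewrite fr.2.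
have f14 : rmem s' 14 = rmem s 14 by rewrite fr.2.
have f15 : rmem s' 15 = rmem s 15 by rewrite fr.2.
rewrite /P /scan_row denS denR denIf /= rq f3 f10 f13 f11 f14 f9.
rewrite -iq hz -/(scan_G s i) -/G.
case: (boolP (z i)) => zi; rewrite ?ler10 ?lexx.
  rewrite denIf /= rq f15 f8 -iq -/(scan_t s i) -/t -/c.
  case: leP => ct.
    split; first by apply: (best_skip iq) IHl; rewrite /= zi /= -leNgt.
    by apply: (best_skip iq) IHg; rewrite zi.
  rewrite denS denR denIf /= rq f15 f8 -iq -/(scan_t s i) -/t -/c -/(loss c G t i).
  case: ifPn => cmp /=.
    split; last by apply: (best_skip iq) IHg; rewrite zi.
    by case/andP: cmp => c1 c2; exact: (best_keep iq).
  rewrite ?denS ?denR ?denI /= ?rq; split; last by apply: (best_skip iq) IHg; rewrite zi.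
  by apply: (best_replace iq) cmp IHl; rewrite ?zi //; exact: le_trans.
rewrite denS denR denIf /= rq f15 f8 -iq -/(scan_t s i) -/t -/c -/(gain c G t i).
case: ifPn => cmp /=.
  split; first by apply: (best_skip iq) IHl; rewrite (negPf zi).
  by case/andP: cmp => c1 c2; exact: (best_keep iq).
rewrite ?denS ?denR ?denI /= ?rq; split; first by apply: (best_skip iq) IHl; rewrite (negPf zi).
apply: (best_replace iq (le := fun a b => b <= a) _ _ _ zi) cmp IHg.
- by move=> a; exact: lexx.
- by move=> a b c1 h1' h2'; exact: le_trans h2' h1'.
- by move=> a b; exact: le_total.
Qed.

Lemma swap_bestE s z (G t : 'I_n -> R) c : holds_z s z ->
  best n (ireg s 12) (ireg s 13) (rmem s 18 0 0)
    (fun i => z i && (c * t i < 1)) (loss c G t) <=%R ->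
  best n (ireg s 14) (ireg s 15) (rmem s 19 0 0)
    (fun i => ~~ z i) (gain c G t) (fun a b => b <= a) ->
  exists2 z', holds_z (den swap_best s) z' & exchange z z' G t c (rmem s 16 0 0).
Proof.
move=> hz hl hg; rewrite /swap_best denIf /=; set rho := rmem s 16 0 0.
case: hl => [[-> H]|[-> [i [hi /andP[zi ti] -> Hi]]]] /=.
  exists z => //; left; split=> // i j zi ti.
  by have := H i (ltn_ord i); rewrite zi ti.
case: hg => [[-> H]|[-> [j [hj zj -> Hj]]]] /=.
  exists z => //; left; split=> // i' j _ _ zj.
  by have := H j (ltn_ord j); rewrite zj.
case: leP => cmp /=; last first.
  exists z => //; left; split=> // i' j' zi' ti' zj'.
  apply: le_lt_trans cmp; apply: lerB; first exact: (Hj j' (ltn_ord j') zj').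
  by apply: (Hi i' (ltn_ord i')); rewrite zi' ti'.
exists (swap z i j); last by right; exists i, j.
move=> l; rewrite denS !denR /= hi hj !eqxx !andbT /swap.
have -> : (l == j) = (l == j :> nat) by [].
have -> : (l == i) = (l == i :> nat) by [].
by case: ifP => //; case: ifP.
Qed.

(** The first part holds on every input and carries the budget; the second carries the analysis,
    where the shifted matrix is positive definite and the moments are either exact or have weight
    zero. *)
Definition iteration_rel (l om be c rho : R) z z' : Prop :=
  (z' = z \/ exists i j, [/\ z i, ~~ z j & z' = swap z i j]) /\
  ((forall i, 0 <= x i) -> (p < n)%N \/ om = 0 -> posdef (shifted v x z l) ->
   let N := invmx (shifted v x z l) in
   exchange z z' (score v x N p om be z) (lev v N) c rho).

Lemma iterationE s z : holds_input w s -> holds_z s z ->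
  exists2 z', holds_z (den iteration s) z' &
    iteration_rel (rmem s 12 0 0) (rmem s 13 0 0) (rmem s 14 0 0)
      (rmem s 15 0 0) (rmem s 16 0 0) z z'.
Proof.
move=> hs hz; rewrite /iteration 3!denS.
set s1 := den invert s; set s2 := den measure_all s1; set s3 := den scan s2.
have h1 : holds_input w s1 by exact: holds_input_den.
have h2 : holds_input w s2 by exact: holds_input_den.
have z1 : holds_z s1 z by move=> i; rewrite den_rmem.
have z2 : holds_z s2 z by move=> i; rewrite den_rmem.
have z3 : holds_z s3 z by move=> i; rewrite den_rmem.
have [hl hg] := scanE h2 z2.
have [z' hz' ex] := swap_bestE z3 hl hg.
exists z' => //; split.
  case: ex => [[->]|[i [j [zi _ zj _ ->]]]]; first by left.
  by right; exists i, j.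
set M := shifted _ _ _ _ => x0 pn pM; have eN : mat_at d s1 = invmx M by exact: invertE.
have sN : (mat_at d s1)^T = mat_at d s1 by rewrite eN; exact: invmx_sym pM.1.
have [m8 m9 m10 m11] := measure_allE h1 z1 sN.
have e15 : rmem s2 15 = rmem s 15 by rewrite den_rmem // /s1 den_rmem.
have e16 : rmem s3 16 = rmem s 16 by rewrite den_rmem // /s2 den_rmem // /s1 den_rmem.
have et : scan_t s2 = lev v (invmx M) by apply/funext => i; rewrite /scan_t m8 eN.
have eG : scan_G s2 = score v x (invmx M) p (rmem s 13 0 0) (rmem s 14 0 0) z.
  apply/funext => i; rewrite /scan_G /score m9 eN.
  rewrite [rmem s2 13]den_rmem // [rmem s1 13]den_rmem //.
  rewrite [rmem s2 14]den_rmem // [rmem s1 14]den_rmem //.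
  case: pn => [pn|->]; last by rewrite !mul0r.
  rewrite m11 m10 // eN.
  by congr (_ / _ + _); apply: eq_bigr => j _; rewrite m10 // eN.
by rewrite e15 e16 et eG in ex.
Qed.

End Exchange.

(** * Invariants of the whole program *)

Section Phases.
Variables (R : realType) (n d : nat) (w : input R n d).
Implicit Types (s : state R) (z : 'I_n -> bool).

#[local] Arguments den : simpl never.

Local Notation v := (vecs w).
Local Notation x := (frac_sol w).
Local Notation p := (norm_exp w).
Local Notation eps := (accuracy w).

Lemma iterationsE s z (Inv : nat -> ('I_n -> bool) -> Prop) :
  holds_input w s -> holds_z s z -> Inv 0%N z ->
  (forall t z1 z2, Inv t z1 ->
     iteration_rel w (rmem s 12 0 0) (rmem s 13 0 0) (rmem s 14 0 0)
       (rmem s 15 0 0) (rmem s 16 0 0) z1 z2 -> Inv t.+1 z2) ->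
  exists2 z', holds_z (den iterations s) z' & Inv (n * n)%N z'.
Proof.
move=> hs hz I0 IS.
pose P q s' := exists2 z', holds_z s' z' & Inv (q * n)%N z'.
suff : P (ireg s false) (den iterations s) by rewrite /P (input_n hs).
apply: for_ind => //; first by exists z.
move=> q s1 hq rq fr1 [z1 hz1 I1]; have h1 : holds_input w s1 by exact: holds_input_frame fr1 hs.
pose Q r s' := exists2 z', holds_z s' z' & Inv (q * n + r)%N z'.
suff : Q (ireg s1 false) (den (PFor 6 false iteration) s1).
  by rewrite /Q /P (input_n h1) mulSn addnC.
apply: for_ind => //; first by exists z1 => //; rewrite addn0.
move=> r s2 hr rr fr2 [z2 hz2 I2]; have h2 : holds_input w s2 by exact: holds_input_frame fr2 h1.
have [z3 hz3 st] := iterationE h2 hz2.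
exists z3 => //; rewrite addnS; apply: IS I2 _.
by move: st; rewrite !fr2.2 // !fr1.2.
Qed.

Definition rounding_accuracy : R := (if 1 <= p%:R * eps then eps else 1) / 4.

Lemma startE s : holds_input w s ->
  holds_z (den start s) (fun i : 'I_n => (i < budget w)%N) /\
  rmem (den start s) 20 0 0 = rounding_accuracy.
Proof.
move=> hs; rewrite /start denS; set s1 := den (PFor _ _ _) s.
have h1 : holds_input w s1 by exact: holds_input_den.
split; last first.
  rewrite denIf /= (input_p h1) (input_eps h1) /rounding_accuracy.
  by case: ifP => _; rewrite denR /= ?(input_eps h1).
have H : forall i : 'I_n, (i < ireg s false)%N -> rmem s1 3 i 0 = (i < budget w)%N%:R.
  apply: (@for_ind R 7 false _ s (fun q s' => forall i : 'I_n, (i < q)%N ->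
    rmem s' 3 i 0 = (i < budget w)%N%:R)) => //.
  move=> q s' hq rq fr IH i; have h' : holds_input w s' by exact: holds_input_frame fr hs.
  rewrite denIf /= rq (input_k h') addn1 ltnS leq_eqVlt => /orP[/eqP iq|iq].
    by rewrite -iq; case: ifP => _; rewrite denR /= rq iq !eqxx.
  by case: ifP => _; rewrite denR /= rq (ltn_eqF iq) /=; exact: IH.
move=> i; rewrite denIf; case: ifP => _; rewrite den_rmem // H //;
by rewrite (input_n hs).
Qed.

(** Only the unconditional part of [iteration_rel] enters, so the budget is kept even when the
    fractional matrix is singular. *)
Lemma rounding_invariant s (J : ('I_n -> bool) -> Prop) :
  holds_input w s -> J (fun i : 'I_n => (i < budget w)%N) ->
  (forall z i j, J z -> z i -> ~~ z j -> J (swap z i j)) ->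
  exists2 z, holds_z (den rounding s) z & J z.
Proof.
move=> hs J0 JS; rewrite /rounding 2!denS.
have [hz1 _] := startE hs; set s1 := den start s in hz1 *.
have h1 : holds_input w s1 by exact: holds_input_den.
have it s2 z2 : holds_input w s2 -> holds_z s2 z2 -> J z2 ->
    exists2 z', holds_z (den iterations s2) z' & J z'.
  move=> h2 hz2 J2; apply: (iterationsE (Inv := fun=> J) h2 hz2 J2).
  move=> t z3 z4 J3 [[->|[i [j [zi zj ->]]]] _] //; exact: JS.
set s2 := den barrier_phase s1.
have h2 : holds_input w s2 by exact: holds_input_den.
have [z2 hz2 J2] : exists2 z, holds_z s2 z & J z.
  rewrite /s2 /barrier_phase denS; set s3 := den (set_params _ _ _ _ _) s1.
  have h3 : holds_input w s3 by exact: holds_input_den.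
  have hz3 : holds_z s3 (fun i : 'I_n => (i < budget w)%N) by move=> i; rewrite den_rmem.
  apply: (@for_ind R 4 false _ s3 (fun _ s' => exists2 z, holds_z s' z & J z)) => //.
    by exists (fun i : 'I_n => (i < budget w)%N).
  move=> q s' hq rq fr [z3 hz3' J3]; have h' : holds_input w s' by exact: holds_input_frame fr h3.
  have [z4 hz4 J4] := it _ _ h' hz3' J3.
  exists z4 => // i; rewrite denS denIf; case: ifP => _ //.
  by rewrite den_rmem.
rewrite /descent_phase denIf; case: ifP => _; first by exists z2.
rewrite denS; apply: it J2; first exact: holds_input_den.
by move=> i; rewrite den_rmem.
Qed.

End Phases.

Lemma sum_nat_swap n (z : 'I_n -> bool) i j : z i -> ~~ z j ->
  (\sum_l swap z i j l = \sum_l z l)%N.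
Proof.
move=> zi zj; have E (z' : 'I_n -> bool) : (\sum_l z' l)%:R = \sum_(l | z' l) 1 :> int.
  by rewrite natr_sum [RHS]big_mkcond; apply: eq_bigr => l _; case: (z' l).
by apply/eqP; rewrite -(eqr_nat int) !E sum_swap // subrK.
Qed.

Lemma sum_bvec_swap (R : realType) n (z : 'I_n -> bool) i j : z i -> ~~ z j ->
  \sum_l bvec R (swap z i j) l = \sum_l bvec R z l.
Proof. by move=> zi zj; rewrite /bvec -!natr_sum sum_nat_swap. Qed.

Lemma ln2_le1 (R : realType) : ln 2 <= 1 :> R.
Proof. by have := @le_ln1Dx R 1; rewrite -[1 + 1]/(2 : R); apply; lra. Qed.

Lemma decrease_step (R : realType) (a b f r : R) (t : nat) :
  b <= a - r -> a <= f - t%:R * r -> b <= f - t.+1%:R * r.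
Proof. by rewrite -natr1; lra. Qed.

(** * Correctness of the two phases *)

Section Correctness.
Variables (R : realType) (n d : nat) (w : input R n d).
Implicit Types (s : state R) (z : 'I_n -> bool).

#[local] Arguments den : simpl never.

Local Notation v := (vecs w).
Local Notation x := (frac_sol w).
Local Notation p := (norm_exp w).
Local Notation k := (budget w).
Local Notation eps := (accuracy w).
Local Notation X := (design_mx v x).
Local Notation Zmx z := (design_mx v (bvec R z)).
Local Notation e := (rounding_accuracy w).
Local Notation K := (k%:R : R).

Hypotheses (x01 : forall i, 0 <= x i <= 1) (sx : \sum_i x i <= K).
Hypotheses (pX : posdef X) (d0 : (0 < d)%N) (p0 : (0 < p)%N).
Hypotheses (e0 : 0 < eps) (e1 : eps < 1) (kn : (k < n)%N).
Hypothesis hk : 3200 * (d%:R / (Num.max eps (p%:R)^-1 * eps)) <= K.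
Hypothesis opt : forall z, \sum_i bvec R z i = K -> posdef (Zmx z) ->
  \tr (invmx X ^+ p) <= \tr (invmx (Zmx z) ^+ p).

Let x0 i : 0 <= x i. Proof. by have /andP[] := x01 i. Qed.
Let d1 : 0 < d%:R :> R. Proof. by rewrite ltr0n. Qed.
Let d_ge1 : 1 <= d%:R :> R. Proof. by rewrite ler1n. Qed.
Let p1 : 1 <= p%:R :> R. Proof. by rewrite ler1n. Qed.
Let pp : 0 < p%:R :> R. Proof. by rewrite ltr0n. Qed.
Let Kn : K <= n%:R. Proof. by rewrite ler_nat ltnW. Qed.

(** The constant 3200 = 16 * 200 serves twice: 200 d / e^2 is 3200 d / eps^2 for e = eps / 4, and
    the descent asks for 16 p d <= K eps / 200. For e = 1/4 the barrier asks for 3200 d <= K, which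
    follows from the latter. *)
Lemma accuracy_bounds : [/\ 0 < e, e <= 4^-1, 200 * d%:R / e ^+ 2 <= K &
  p%:R * eps < 1 -> 3200 * p%:R * d%:R <= K * eps].
Proof.
have ep := e0; have el1 := e1; have p1' := p1; have d1' := d_ge1; have Kn' := Kn.
rewrite /rounding_accuracy; case: (leP 1 (p%:R * eps)) => h /=.
  have mx : Num.max eps p%:R^-1 = eps.
    by apply/max_idPl; rewrite -[p%:R^-1]mul1r ler_pdivrMr // mulrC.
  split; [lra|lra| |by []].
  apply: le_trans hk; rewrite mx le_eqVlt; apply/orP; left; apply/eqP.
  by field; rewrite gt_eqF.
have mx : Num.max eps p%:R^-1 = p%:R^-1.
  by apply/max_idPr; rewrite -[p%:R^-1]mul1r ler_pdivlMr // mulrC ltW.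
have h2 : 3200 * p%:R * d%:R <= K * eps.
  rewrite -ler_pdivrMr //; apply: le_trans hk; rewrite mx le_eqVlt; apply/orP; left; apply/eqP.
  by field; rewrite !gt_eqF.
split; [lra|lra| |by []].
have -> : 200 * d%:R / (1 / 4) ^+ 2 = 3200 * d%:R :> R by field.
have : K * eps <= K by apply: ler_piMr => //; exact: ltW.
have : d%:R <= p%:R * d%:R :> R by apply: ler_peMl => //; exact: ltW.
by lra.
Qed.

Lemma K_large : 3200 <= K.
Proof.
have [e0' e4 hK _] := accuracy_bounds; have d1' := d_ge1; apply: le_trans hK.
rewrite ler_pdivlMr ?exprn_gt0 //.
have : e ^+ 2 <= 16^-1 by rewrite expr2; have := ler_pM (ltW e0') (ltW e0') e4 e4; lra.
by lra.
Qed.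

(** Z dominates l X, and both traces are antitone in Z. *)
Lemma loewner_transfer z l : 0 < l -> posdef (shifted v x z l) ->
  [/\ posdef (Zmx z), \tr (X * invmx (Zmx z)) <= l^-1 * d%:R &
     \tr (invmx (Zmx z) ^+ p) <= l^-1 ^+ p * \tr (invmx X ^+ p)].
Proof.
move=> l0 pM; have gX : gram X by exact: design_gram.
have EZ : Zmx z = shifted v x z l + l *: X by rewrite subrK.
have plX : posdef (l *: X) by exact: posdefZ.
have pZ : posdef (Zmx z) by rewrite EZ; apply: posdefD => //; exact: posdef_psd.
split=> //.
  have := @tr_weight_antitone R n d v x x01 l^-1 X (Zmx z).
  rewrite invr_gt0 -[X * invmx X]/(X *m invmx X) posdef_mulmxV // mxtrace1; apply=> //.
  move=> u; rewrite EZ bformDl bformZl mulrDr mulKf ?gt_eqF // lerDr.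
  by rewrite mulr_ge0 ?invr_ge0 ?(ltW l0) //; exact: (posdef_psd pM).2.
have gZ : gram (Zmx z) by apply: design_gram => i; exact: bvec_ge0.
have := tr_inv_antitone p pZ plX gZ; rewrite invmx_scale // exprZmx mxtraceZ; apply.
exact: posdef_psd.
Qed.

Lemma barrier_phaseE s z0 : holds_input w s -> holds_z s z0 ->
  \sum_i bvec R z0 i = K -> rmem s 20 0 0 = e ->
  exists2 z, holds_z (den barrier_phase s) z &
    \sum_i bvec R z i = K /\ exists2 l, 1 - 2 * e < l & posdef (shifted v x z l).
Proof.
move=> hs hz sz he; have [ee0 e4 hK _] := accuracy_bounds.
have ep := e0; have el1 := e1; have p1' := p1; have d1' := d_ge1; have Kn' := Kn.
have KL := K_large; have n3 : 3200 <= n%:R :> R by exact: le_trans Kn.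
have n0 : 0 < n%:R :> R by lra.
have D0 : 0 < d%:R / e by rewrite divr_gt0.
rewrite /barrier_phase denS; set s1 := den (set_params _ _ _ _ _) s.
have h1 : holds_input w s1 by exact: holds_input_den.
have hz1 : holds_z s1 z0 by move=> i; rewrite den_rmem.
have m12 : rmem s1 12 0 0 = - e by rewrite /s1 /set_params !denS !denR /= he sub0r.
have m13 : rmem s1 13 0 0 = 0 by [].
have m14 : rmem s1 14 0 0 = 1 by [].
have m15 : rmem s1 15 0 0 = 16 by [].
have m16 : rmem s1 16 0 0 = d%:R / (8 * e * n%:R).
  by rewrite /s1 /set_params !denS !denR /= he (input_n hs) (input_d hs).
have m20 : rmem s1 20 0 0 = e by rewrite den_rmem.
set rho := d%:R / (8 * e * n%:R) in m16.
set eta := e / (4 * d%:R).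
pose phi z l := \tr (X * invmx (shifted v x z l)).
pose P q s' := exists2 z, holds_z s' z & let l := rmem s' 12 0 0 in
  [/\ \sum_i bvec R z i = K, posdef (shifted v x z l), phi z l <= 4 / 3 * (d%:R / e) &
    l > 1 - 2 * e \/ l = - e + q%:R * eta].
set loop := PFor 4 false _.
have H : P (ireg s1 false) (den loop s1).
  apply: for_ind => //.
    exists z0; rewrite ?m12 //.
    have [a1 a2] := barrier_init x01 pX z0 ee0.
    by split=> //; [rewrite /phi; lra|right; rewrite mul0r addr0].
  move=> q s' hq rq fr [z1 hz' [sz1 pM1 phi1 hl]].
  have h' : holds_input w s' by exact: holds_input_frame fr h1.
  set l := rmem s' 12 0 0 in pM1 phi1 hl.
  (* Below the target, either the level d / e has been reached or each of the t rounds has gained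
     rho; after n^2 rounds the second alternative also puts phi below d / e. *)
  pose Inv t z := [/\ \sum_i bvec R z i = K, posdef (shifted v x z l),
    phi z l <= 4 / 3 * (d%:R / e) &
    l <= 1 - 2 * e -> phi z l <= d%:R / e \/ phi z l <= 4 / 3 * (d%:R / e) - t%:R * rho].
  have [||z2 hz2 [sz2 pM2 phi2 hl2]] := iterationsE (Inv := Inv) h' hz'.
  - by split=> // _; right; rewrite mul0r subr0.
  - move=> t z3 z4 [sz3 pM3 phi3 hl3].
    rewrite (fr.2 13%N) // (fr.2 14%N) // (fr.2 15%N) // (fr.2 16%N) // m13 m14 m15 m16 => -[hJ hex].
    have {}hex := hex x0 (or_intror erefl) pM3.
    have sz4 : \sum_i bvec R z4 i = K.
      by case: hJ => [->//|[i [j [zi zj ->]]]]; rewrite sum_bvec_swap.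
    have [a1 a2 a3] := barrier_step x01 pX d0 ee0 e4 hK Kn sx sz3 pM3 phi3 hex.
    split=> //; first by rewrite /phi; lra.
    move=> hl'; case: (a3 hl') => [h|h]; first by left; exact: le_trans a2 h.
    case: (hl3 hl') => [h3|h3]; first by left; exact: le_trans a2 h3.
    by right; exact: decrease_step h h3.
  have n2rho : d%:R / e <= (n * n)%:R * rho.
    rewrite natrM /rho (_ : n%:R * n%:R * _ = d%:R / e * (n%:R / 8)); last first.
      by field; rewrite !gt_eqF.
    by apply: ler_peMr; [exact: ltW|lra].
  have m12' : rmem (den iterations s') 12 0 0 = l by rewrite den_rmem.
  have m20' : rmem (den iterations s') 20 0 0 = e by rewrite den_rmem // fr.2 // m20.
  have d' : ireg (den iterations s') 1 = d by rewrite den_ireg // (input_d h').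
  rewrite denS denIf /= m12' m20'.
  case: leP => hl'; last first.
    exists z2; [by move=> i; exact: hz2|rewrite m12'].
    by split=> //; left.
  exists z2; first by move=> i; rewrite den_rmem.
  rewrite denR /= m12' m20' d' -/eta.
  have phiD : phi z2 l <= d%:R / e by case: (hl2 hl') => //; lra.
  have [a1 a2] := barrier_raise x01 d0 ee0 pM2 phiD.
  split=> //; case: hl => [?|->]; first by lra.
  by right; rewrite -natr1; ring.
have [z hz' [sz' pM' _ hl]] := H.
exists z => //; split=> //.
eexists; last exact: pM'.
case: hl => // ->; rewrite (input_n h1).
have eta0 : 0 <= eta by apply: divr_ge0; [exact: ltW|apply: mulr_ge0].
(* The n rises of l would add up to at least 50, while l has only the distance 1 - e to cover, so
   the target must have been passed. *)
have : 50 / e <= K * eta.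
  apply: le_trans (ler_wpM2r eta0 hK).
  by rewrite le_eqVlt; apply/orP; left; apply/eqP; rewrite /eta; field; rewrite !gt_eqF.
have : 50 <= 50 / e by rewrite ler_pdivlMr //; lra.
have : K * eta <= n%:R * eta by rewrite ler_wpM2r.
by lra.
Qed.

(** When p eps < 1, Z dominates X / 2 at the start, so the potential exceeds its lower bound (1/p)
    ln tr(X^-p) by at most 1 + eps / 4. Gains in all n^2 rounds would total n eps / 16 >= 200, so a
    stuck set must occur. *)
Lemma descent_phaseE s z0 : holds_input w s -> holds_z s z0 ->
  \sum_i bvec R z0 i = K ->
  (exists2 l, 1 - 2 * e < l & posdef (shifted v x z0 l)) ->
  exists2 z, holds_z (den descent_phase s) z &
    posdef (Zmx z) /\ \tr (invmx (Zmx z) ^+ p) <= (1 + eps) ^+ p * \tr (invmx X ^+ p).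
Proof.
move=> hs hz sz [l hl pM]; have [ee0 e4 hK hp] := accuracy_bounds.
have ep := e0; have el1 := e1; have p1' := p1; have d1' := d_ge1; have Kn' := Kn.
have KL := K_large; have n3 : 3200 <= n%:R :> R by exact: le_trans Kn.
have n0 : 0 < n%:R :> R by lra.
have l0 : 0 < l by lra.
have [pZ phi0 tr0] := loewner_transfer l0 pM.
have fX : 0 < \tr (invmx X ^+ p) by exact: tr_expr_gt0.
rewrite /descent_phase denIf /= (input_p hs) (input_eps hs); case: leP => hpe.
  have ee : e = eps / 4 by rewrite /rounding_accuracy hpe.
  exists z0 => //; split=> //; apply: (le_trans tr0).
  rewrite ler_pM2r //; apply: lerXn2r; rewrite ?nnegrE ?invr_ge0 ?(ltW l0) //; first lra.
  (* Here l > 1 - eps / 2, and (1 + eps) (1 - eps / 2) >= 1. *)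
  rewrite -[l^-1]mul1r ler_pdivrMr //; nra.
have {}hp := hp hpe.
have ee : e = 1 / 4 by rewrite /rounding_accuracy leNgt hpe.
have linv : l^-1 <= 2 by rewrite -[l^-1]mul1r ler_pdivrMr //; lra.
rewrite denS; set s1 := den (set_params _ _ _ _ _) s.
have h1 : holds_input w s1 by exact: holds_input_den.
have hz1 : holds_z s1 z0 by move=> i; rewrite den_rmem.
set rho := eps / (16 * n%:R); set B := eps / 8 / d%:R.
have m12 : rmem s1 12 0 0 = 0 by [].
have m13 : rmem s1 13 0 0 = 1 by [].
have m14 : rmem s1 14 0 0 = B.
  by rewrite /s1 /set_params !denS !denR /= (input_eps hs) (input_d hs).
have m15 : rmem s1 15 0 0 = 16 * p%:R.
  by rewrite /s1 /set_params !denS !denR /= (input_p hs).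
have m16 : rmem s1 16 0 0 = rho.
  by rewrite /s1 /set_params !denS !denR /= (input_eps hs) (input_n hs).
have K0 : 0 < K by lra.
have Ke : K * eps <= K by apply: ler_piMr; [exact: ltW|exact: ltW].
have pd : p%:R <= p%:R * d%:R :> R by apply: ler_peMr; [exact: ltW|].
(* K >= K eps >= 3200 p d and K <= n; hence the moments are exact in this phase. *)
have pn : (p < n)%N by rewrite -(ltr_nat R); lra.
have hcd : 16 * p%:R * d%:R <= K * (eps / 200) by lra.
pose F z := potential v x p B (Zmx z).
have szJ z3 z4 : (z4 = z3 \/ exists i j, [/\ z3 i, ~~ z3 j & z4 = swap z3 i j]) ->
    \sum_i bvec R z3 i = K -> \sum_i bvec R z4 i = K.
  by move=> [->//|[i [j [zi zj ->]]]] <-; rewrite sum_bvec_swap.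
pose stuck z := let N := invmx (Zmx z) in
  no_swap z (score v x N p 1 B z) (lev v N) (16 * p%:R) rho /\
  \tr (N ^+ p) <= (1 + eps) ^+ p * \tr (invmx X ^+ p).
pose Inv t z := [/\ \sum_i bvec R z i = K, posdef (Zmx z) &
  F z <= F z0 - t%:R * rho \/ stuck z].
have [||z hz' [sz' pZ' alt]] := iterationsE (Inv := Inv) h1 hz1.
- by split=> //; left; rewrite mul0r subr0.
- move=> t z3 z4 [sz3 pZ3 alt3]; rewrite m12 m13 m14 m15 m16 => -[hJ].
  rewrite shifted0 => /(_ x0 (or_introl pn) pZ3) hex.
  have sz4 := szJ _ _ hJ sz3.
  have [pZ4 alt4] := descent_step x01 pX d0 e0 e1 p0 K0 Kn hcd sx sz3 pZ3 hex.
  split=> //; case: alt3 => [hF|st]; last first.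
    right; case: hex => [[-> _] //|[i [j [zi ti zj hr _]]]].
    by have := st.1 i j zi ti zj; rewrite ltNge hr.
  case: alt4 => [hF'|[-> st1 st2]]; last by right.
  by left; exact: decrease_step hF' hF.
exists z => //; split=> //.
case: alt => [hF|[_ //]]; exfalso.
have hp1 := opt sz' pZ'.
have fZ : 0 < \tr (invmx (Zmx z) ^+ p) by exact: tr_expr_gt0.
have fZ0 : 0 < \tr (invmx (Zmx z0) ^+ p) by exact: tr_expr_gt0.
have lnZ : ln (\tr (invmx X ^+ p)) <= ln (\tr (invmx (Zmx z) ^+ p)).
  by rewrite ler_ln ?posrE.
have lnZ0 : ln (\tr (invmx (Zmx z0) ^+ p)) <= p%:R * ln 2 + ln (\tr (invmx X ^+ p)).
  have -> : p%:R * ln 2 = ln (2 ^+ p) :> R by rewrite lnXn // mulr_natl.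
  rewrite -lnM ?posrE ?exprn_gt0 // ler_ln ?posrE ?mulr_gt0 ?exprn_gt0 //.
  apply: (le_trans tr0); rewrite ler_pM2r //.
  by apply: lerXn2r => //; rewrite nnegrE ?invr_ge0 ?(ltW l0).
have B0 : 0 <= B by rewrite !divr_ge0 // ltW.
have F0 : F z0 <= 1 + ln (\tr (invmx X ^+ p)) / p%:R + eps / 4.
  rewrite /F /potential; apply: lerD.
    rewrite ler_pdivrMr // mulrDl divfK ?gt_eqF // mul1r.
    by apply: (le_trans lnZ0); rewrite lerD2r ler_piMr ?ln2_le1 // ltW.
  apply: le_trans (ler_wpM2l B0 phi0) _.
  apply: (@le_trans _ _ (B * (2 * d%:R))); first by rewrite ler_wpM2l // ler_wpM2r // ltW.
  by rewrite le_eqVlt; apply/orP; left; apply/eqP; rewrite /B; field; rewrite gt_eqF.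
have F1 : ln (\tr (invmx X ^+ p)) / p%:R <= F z.
  rewrite /F /potential -[leLHS]addr0; apply: lerD.
    by rewrite ler_pM2r ?invr_gt0.
  rewrite mulr_ge0 // -sum_x_lev; apply: sumr_ge0 => i _.
  by rewrite mulr_ge0 //; exact: lev_ge0.
have n2rho : (n * n)%:R * rho = n%:R * eps / 16.
  by rewrite natrM /rho; field; rewrite gt_eqF.
have : 3200 <= n%:R * eps.
  have : K * eps <= n%:R * eps by rewrite ler_wpM2r // ltW.
  by have : 1 <= p%:R * d%:R :> R; [exact: le_trans pd|lra].
rewrite n2rho in hF; lra.
Qed.

End Correctness.

(** * From traces of powers to Phi_p *)

Section Objective.
Variables (R : realType) (d p : nat).
Implicit Types A B : 'M[R]_d.
Hypotheses (d0 : (0 < d)%N) (p0 : (0 < p)%N).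

Lemma PhiE A : posdef A ->
  Phi p A = (((d%:R)^-1 * \tr (invmx A ^+ p)) `^ (p%:R)^-1)%:E.
Proof. by move=> pA; rewrite /Phi asboolT. Qed.

Lemma Phi_le A B c : posdef A -> posdef B -> 0 <= c ->
  \tr (invmx A ^+ p) <= c ^+ p * \tr (invmx B ^+ p) ->
  (Phi p A <= c%:E * Phi p B)%E.
Proof.
move=> pA pB c0 h; rewrite !PhiE // -EFinM lee_fin.
have tA := ltW (tr_expr_gt0 d0 p pA); have tB := ltW (tr_expr_gt0 d0 p pB).
have di : 0 <= d%:R^-1 :> R by rewrite invr_ge0.
have e : c = (c ^+ p) `^ (p%:R)^-1.
  by rewrite -powR_mulrn // -powRrM mulfV ?powRr1 // pnatr_eq0 -lt0n.
rewrite [X in _ <= X * _]e -powRM ?exprn_ge0 ?mulr_ge0 //.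
apply: ge0_ler_powR; rewrite ?nnegrE ?invr_ge0 ?mulr_ge0 ?exprn_ge0 //.
by rewrite mulrCA ler_wpM2l.
Qed.

Lemma Phi_le_tr A B : posdef A -> posdef B -> (Phi p A <= Phi p B)%E ->
  \tr (invmx A ^+ p) <= \tr (invmx B ^+ p).
Proof.
move=> pA pB; rewrite !PhiE // lee_fin leNgt => /negP h; rewrite leNgt; apply/negP => h2.
have tA := ltW (tr_expr_gt0 d0 p pA); have tB := ltW (tr_expr_gt0 d0 p pB).
have di : 0 < d%:R^-1 :> R by rewrite invr_gt0 ltr0n.
apply: h; apply: gt0_ltr_powR; rewrite ?nnegrE ?mulr_ge0 ?(ltW di) ?invr_gt0 ?ltr0n //.
by rewrite ltr_pM2l.
Qed.

End Objective.

Lemma sum_prefix n k : (\sum_(i < n) (i < k)%N = minn n k)%N.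
Proof.
elim: n => [|n IH]; first by rewrite big_ord0 min0n.
by rewrite big_ord_recr /= IH; case: ltnP; lia.
Qed.

(** * The rounding guarantee *)

Section Rounding.
Variables (R : realType) (n d : nat) (w : input R n d).

#[local] Arguments den : simpl never.

Local Notation v := (vecs w).
Local Notation x := (frac_sol w).
Local Notation p := (norm_exp w).
Local Notation k := (budget w).
Local Notation eps := (accuracy w).

Let s0 := init_state w.

Lemma holds_z_inj s (z z' : 'I_n -> bool) : @holds_z R n s z -> @holds_z R n s z' -> z = z'.
Proof.
move=> h h'; apply/funext => i; have := h i; rewrite h' => /eqP.
by rewrite eqr_nat; case: (z i); case: (z' i).
Qed.

Lemma holds_input_init : holds_input w s0. Proof. by []. Qed.

Lemma rounding_budget (z : 'I_n -> bool) : holds_z (den rounding s0) z ->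
  (\sum_i z i <= k)%N.
Proof.
have [||z' hz' Jz'] := @rounding_invariant _ _ _ w s0
  (fun z => (\sum_i z i = \sum_(i < n) (i < k)%N)%N) holds_input_init.
- by [].
- by move=> z1 i j J1 zi zj; rewrite sum_nat_swap.
by move/(holds_z_inj hz') <-; rewrite Jz' sum_prefix geq_minr.
Qed.

Lemma rounding_objective (z : 'I_n -> bool) : (0 < d)%N -> (0 < p)%N ->
  optimal k p v x -> 0 < eps < 1 ->
  3200 * (d%:R / (Num.max eps (p%:R)^-1 * eps)) <= k%:R ->
  holds_z (den rounding s0) z ->
  (Phi p (design_mx v (bvec R z)) <= (1 + eps)%:E * Phi p (design_mx v x))%E.
Proof.
move=> d0 p0 [[sx x01] opt] /andP[e0 e1] hk hz.
have [pX|npX] := pselect (posdef (design_mx v x)); last first.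
  (* If the fractional matrix is not positive definite, the right side is +oo. *)
  by rewrite [X in (_ * X)%E]/Phi asboolF // mulry gtr0_sg ?mul1e ?leey // ltr_wpDr // ltW.
suff [pZ trZ] : posdef (design_mx v (bvec R z)) /\
    \tr (invmx (design_mx v (bvec R z)) ^+ p)
    <= (1 + eps) ^+ p * \tr (invmx (design_mx v x) ^+ p).
  by apply: Phi_le => //; lra.
(* For n <= k the initial set contains every index and no exchange is possible; Z - X is then the
   sum of (1 - x_i) v_i v_i^T. *)
case: (ltnP k n) => kn; last first.
  have [||z' hz' Jz'] := @rounding_invariant _ _ _ w s0 (fun z => forall i, z i) holds_input_init.
  - by move=> i; exact: leq_trans kn.
  - by move=> z1 i j J1 _; rewrite J1.
  have {}Jz : forall i, z i by rewrite (holds_z_inj hz hz').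
  have psdZX : psd (design_mx v (bvec R z) - design_mx v x).
    rewrite /design_mx -sumrB.
    under eq_bigr do rewrite -scalerBl.
    by apply: psd_sum => i; rewrite /bvec Jz subr_ge0; have /andP[] := x01 i.
  have pZ : posdef (design_mx v (bvec R z)).
    by rewrite -(subrK (design_mx v x) (design_mx v (bvec R z))) addrC; exact: posdefD.
  split=> //; apply: (@le_trans _ _ (\tr (invmx (design_mx v x) ^+ p))).
    by apply: tr_inv_antitone => //; apply: design_gram => i; exact: bvec_ge0.
  by apply: ler_peMl; [exact/ltW/tr_expr_gt0|rewrite exprn_ege1 // lerDl ltW].
have opt' z' : \sum_i bvec R z' i = k%:R -> posdef (design_mx v (bvec R z')) ->
    \tr (invmx (design_mx v x) ^+ p) <= \tr (invmx (design_mx v (bvec R z')) ^+ p).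
  move=> sz' pZ'; apply: (Phi_le_tr d0 p0 pX pZ').
  apply: opt; split.
    by rewrite sz'.
  by move=> i; rewrite /bvec; case: (z' i); rewrite ?lexx ler01.
have [hz1 acc1] := startE holds_input_init.
have h1 : holds_input w (den start s0) by exact: holds_input_den.
have sz1 : \sum_(i < n) bvec R (fun i : 'I_n => (i < k)%N) i = k%:R.
  by rewrite /bvec -natr_sum sum_prefix (minn_idPr (ltnW kn)).
have [z2 hz2 [sz2 ex2]] := barrier_phaseE x01 sx pX d0 p0 e0 e1 kn hk h1 hz1 sz1 acc1.
have h2 : holds_input w (den barrier_phase (den start s0)) by exact: holds_input_den.
have [z3 hz3 [pZ3 tr3]] := descent_phaseE x01 sx pX d0 p0 e0 e1 kn hk opt' h2 hz2 sz2 ex2.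
by rewrite (holds_z_inj hz (_ : holds_z _ z3)).
Qed.

Lemma rounding_holds_z : exists z : 'I_n -> bool, holds_z (den rounding s0) z.
Proof.
by have [//|//|z hz _] := @rounding_invariant _ _ _ w s0 (fun=> True) holds_input_init; exists z.
Qed.

Lemma output_holds_z K s (z : 'I_n -> bool) : holds_z s z -> @output R n (K, s) = z.
Proof.
by move=> hz; apply/funext => i; rewrite /output /= hz pnatr_eq0; case: (z i).
Qed.

End Rounding.

Theorem theorem1p2 (R : realType) :
  exists (A : cmd) (e : nat) (C c1 c2 c3 : R),
    [/\ 0 < C, 0 < c1, 0 < c2 & 0 < c3] /\
    runs_in_time R A e /\
    forall (n d k p : nat) (v : 'I_n -> 'cV[R]_d) (x : 'I_n -> R) (eps : R),
      (0 < d)%N -> (d <= k)%N -> (1 <= p)%N ->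
      optimal k p v x ->
      0 < eps < 1 ->
      let gamma : R := Num.max eps (p%:R)^-1 in
      let w : input R n d := Input k p v x eps in
      C * (d%:R / (gamma * eps)) <= k%:R ->
      1 - c1 * (((d%:R ^+ 2 + d%:R / gamma) ^+ 2 / (eps ^+ 2 * p%:R ^+ 2))
                * expR (- (c2 * (gamma * Num.sqrt d%:R))))
        - expR (- (c3 * (eps * d%:R / gamma)))
      <= prob_output A (input_size w ^ e) w
           (fun z : 'I_n -> bool =>
              (Phi p (design_mx v (fun i => (z i)%:R))
                 <= (1 + eps)%:E * Phi p (design_mx v x))%E
              && (\sum_(i < n) z i <= k)%N).
Proof.
have [e he] := @run_prog R rounding rounding_wf.
(* No coin is flipped, so the success probability is 1 and any positive c1, c2, c3 do; 3200 is the
   constant from [accuracy_bounds]. *)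
exists (compile rounding), e, 3200, 1, 1, 1; split; first by split; rewrite ?ltr0n ?ltr01.
split=> [n d w|n d k p v x eps d0 dk p0 opt eps01 gamma w hk]; first by rewrite he.
have [z hz] := rounding_holds_z w.
set E := (fun z : 'I_n -> bool => _).
have Ez : E z = true.
  by rewrite /E (rounding_budget hz) andbT; exact: rounding_objective hz.
rewrite /prob_output he (output_holds_z _ hz) andTb Ez mulr1n.
set A := _ ^+ 2 / _; have A0 : 0 <= A.
  by apply: divr_ge0; [exact: sqr_ge0|apply: mulr_ge0; exact: sqr_ge0].
have := mulr_ge0 A0 (expR_ge0 (- (1 * (gamma * Num.sqrt d%:R)))).
have := expR_ge0 (- (1 * (eps * d%:R / gamma))).
lra.
Qed.
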